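(* Let $s\in(0,1)$, $1<p<\frac ns$, define $q$ by $\frac1q=\frac1p-\frac sn$ and $q'$ by $\frac1{q'}+\frac1q=1$. For all $\phi,f,g\in C_c^\infty(\mathbb R^n)$, $$\Big|\int_{\mathbb R^n}[(-\Delta)^{s/2},\phi](f)\,g\Big|\lesssim[\phi]_{BMO}\,\|(-\Delta)^{s/2}f\|_{L^p}\,\|(-\Delta)^{s/2}g\|_{L^{q'}},$$ where $[(-\Delta)^{s/2},\phi](f)=(-\Delta)^{s/2}(\phi f)-\phi(-\Delta)^{s/2}f$.
   Context: Fractional Laplacian: $\widehat{(-\Delta)^{s/2}g}(\xi)=(2\pi|\xi|)^s\widehat g(\xi)$, $\widehat g(\xi)=\int g(x)e^{-2\pi ix\cdot\xi}dx$. BMO seminorm $[\phi]_{BMO}=\sup_B\frac1{|B|}\int_B|\phi-(\phi)_B|$ over balls. $A\lesssim B$ means $A\le CB$, $C$ depending only on parameters. *)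

(* Defs.v *)
From mathcomp Require Import all_boot all_order all_algebra.
From mathcomp Require Import all_classical all_reals all_analysis.
From mathcomp Require Import complex.
Set Implicit Arguments. Unset Strict Implicit. Unset Printing Implicit Defensive.
Import Order.TTheory GRing.Theory Num.Theory.
Import numFieldNormedType.Exports.
Local Open Scope classical_set_scope.
Local Open Scope ring_scope.
Local Open Scope complex_scope.

Section Defs.
Variable R : realType.

Definition dotR n (x y : 'rV[R]_n) : R := \sum_(i < n) x 0 i * y 0 i.
Definition enorm n (x : 'rV[R]_n) : R := Num.sqrt (dotR x x).

Definition vcons n (t : R) (v : 'rV[R]_n) : 'rV[R]_n.+1 :=
  \row_(i < n.+1) match unlift ord0 i with None => t | Some j => v 0 j end.

(* n-dimensional Lebesgue integral, as the iterated one-dimensional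
   Lebesgue integral (Fubini/Tonelli) of an extended-real valued function *)
Fixpoint lint (n : nat) : ('rV[R]_n -> \bar R) -> \bar R :=
  match n with
  | 0 => fun F => F 0
  | n'.+1 => fun F =>
      (\int[@lebesgue_measure R]_(t in [set: R]) lint (fun v => F (vcons t v)))%E
  end.

Definition rint n (F : 'rV[R]_n -> R) : R := fine (lint (fun x => (F x)%:E)).

Definition cint n (F : 'rV[R]_n -> R[i]) : R[i] :=
  Complex (rint (fun x => complex.Re (F x))) (rint (fun x => complex.Im (F x))).

Definition cabs (z : R[i]) : R := Num.sqrt (complex.Re z ^+ 2 + complex.Im z ^+ 2).

Definition cexpi (t : R) : R[i] := Complex (cos t) (sin t).

Definition fourier n (g : 'rV[R]_n -> R) (xi : 'rV[R]_n) : R[i] :=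
  cint (fun x => (g x)%:C * cexpi (- (2 * pi * dotR x xi))).

(* fractional Laplacian (-Delta)^{s/2} g : the function whose Fourier
   transform is (2 pi |xi|)^s \hat g(xi), i.e. the inverse Fourier transform *)
Definition fraclap n (s : R) (g : 'rV[R]_n -> R) (x : 'rV[R]_n) : R[i] :=
  cint (fun xi => ((2 * pi * enorm xi) `^ s)%:C * fourier g xi
                    * cexpi (2 * pi * dotR x xi)).

Definition commut n (s : R) (phi f : 'rV[R]_n -> R) (x : 'rV[R]_n) : R[i] :=
  fraclap s (fun y => phi y * f y) x - (phi x)%:C * fraclap s f x.

Definition Lpnorm n (p : R) (F : 'rV[R]_n -> R[i]) : \bar R :=
  (lint (fun x => ((cabs (F x)) `^ p)%:E) `^ p^-1)%E.

Definition eball n (c : 'rV[R]_n) (r : R) : set 'rV[R]_n :=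
  [set y | enorm (y - c) < r].
Definition vol n (B : set 'rV[R]_n) : R := rint (\1_B).
Definition avg n (B : set 'rV[R]_n) (u : 'rV[R]_n -> R) : R :=
  rint (fun x => \1_B x * u x) / vol B.

Definition bmo n (phi : 'rV[R]_n -> R) : \bar R :=
  ereal_sup [set (avg (eball c r) (fun x => `|phi x - avg (eball c r) phi|))%:E
            | c in [set: 'rV[R]_n] & r in [set r : R | 0 < r]].

Definition partial n (i : 'I_n) (f : 'rV[R]_n -> R) : 'rV[R]_n -> R :=
  fun x => 'D_(delta_mx 0 i) f x.
Definition iter_partial n (l : seq 'I_n) (f : 'rV[R]_n -> R) :=
  foldr (@partial n) f l.
Definition smooth n (f : 'rV[R]_n -> R) : Prop :=
  forall l : seq 'I_n, continuous (iter_partial l f) /\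
    forall (i : 'I_n) (x : 'rV[R]_n), derivable (iter_partial l f) x (delta_mx 0 i).
Definition compact_support n (f : 'rV[R]_n -> R) : Prop :=
  compact (closure [set x | f x != 0]).
Definition Cc_infty n (f : 'rV[R]_n -> R) : Prop := smooth f /\ compact_support f.

End Defs.

(* Main.v *)
(* Write F and G for the fractional Laplacians of f and g.  By Parseval the
   left-hand side is the integral of phi (f G - g F).  Since |xi|^(-s) is a
   superposition of Gaussians, f is c^-1 times the integral of r^(s-1) gamma_r * F
   over r > 0, gamma_r being a Gaussian kernel of width r, and likewise for g.
   Hence the left-hand side is at most c^-1 times the integral of
   r^(s-1) |phi x - phi y| gamma_r (x - y) |F y| |G x|, an absolutely convergent
   form whose kernel, after integration in r, is O(|x - y|^(s-n)).  That kernel is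
   in turn an integral, over all cubes containing both x and y, of a power of the
   side u.  On each cube John-Nirenberg and Hoelder bound the double integral by
   [phi]_BMO times the L^r averages of |F| and |G|, for some 1 < r < min(p, q').
   Hoelder over cube centres and sides reduces the claim to one function at a
   time, and there H is split, at scale u, at height u^(-n/p). *)
Require Import Defs.
From HB Require Import structures.
From mathcomp Require Import all_boot all_order all_algebra.
From mathcomp Require Import all_classical all_reals all_analysis measurable_realfun.
From mathcomp Require Import complex.
From mathcomp Require Import ring lra.
Set Implicit Arguments. Unset Strict Implicit. Unset Printing Implicit Defensive.
Import Order.TTheory GRing.Theory Num.Theory.
Import numFieldNormedType.Exports.
Local Open Scope classical_set_scope.
Local Open Scope ring_scope.

(** The exponents satisfy 1/p + 1/q' = k with k = 1 + s/n, so p k and q' k are conjugate, and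
    Hoelder over centres and sides is applied with them. Each exceeds the exponent it comes from,
    which makes the integral over small sides converge. Taking r below both p and q' leaves room for
    the power r/(r - 1) of the oscillation. Absolute values must wait until f and g have both been
    resynthesised with the same even kernel: only the difference of the two terms carries phi x -
    phi y. Smoothness of phi enters qualitatively: it makes integrals converge and provides a scale
    below which phi hardly oscillates, where the induction for John-Nirenberg starts; no constant
    depends on that scale. John-Nirenberg needs a positive bound and the normalisation nonzero
    norms, so the cases where a factor on the right vanishes are treated apart; the left side
    vanishes there. As the statement integrates one variable at a time, a measure [mu n] and a
    majorant [decay] of product form mediate between iterated and genuine integrals. Complex
    transforms are carried as one real cosine transform with a free phase. *)

Definition rV_display : measure_display -> measure_display.
Proof. exact. Qed.

(** * Lebesgue measure on row vectors *)

Section rV_measurable.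
Context {R : realType} {n : nat}.
Let coors : 'I_n -> 'rV[R]_n -> measurableTypeR R := fun i x => x ord0 i.

Let rV_set0 : g_sigma_preimage coors set0.
Proof. exact: sigma_algebra0. Qed.
Let rV_setC A : g_sigma_preimage coors A -> g_sigma_preimage coors (~` A).
Proof. exact: sigma_algebraC. Qed.
Let rV_bigcup (F : _^nat) : (forall i, g_sigma_preimage coors (F i)) ->
  g_sigma_preimage coors (\bigcup_i (F i)).
Proof. exact: sigma_algebra_bigcup. Qed.

(** The sigma-algebra generated by the coordinates. That it contains the open sets is proved later,
    in [open_measurable_rV]. *)
HB.instance Definition _ :=
  @isMeasurable.Build (rV_display (R.-ocitv.-measurable).-sigma)
  'rV[R]_n (g_sigma_preimage coors) rV_set0 rV_setC rV_bigcup.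
End rV_measurable.

Section rV_measurable_fun.
Context {R : realType}.

Lemma measurable_coord n (i : 'I_n) :
  measurable_fun [set: 'rV[R]_n] (fun x : 'rV[R]_n => x ord0 i).
Proof.
move=> _ Y mY; rewrite setTI; apply: sub_sigma_algebra => /=.
rewrite -bigcup_seq/=; exists i => /=; first by rewrite mem_index_enum.
by exists Y => //; rewrite setTI.
Qed.

Lemma measurable_rVP d (T : measurableType d) n (f : T -> 'rV[R]_n) :
  measurable_fun [set: T] f <->
  forall i, measurable_fun [set: T] (fun x => f x ord0 i).
Proof.
apply: (@iff_trans _ (g_sigma_preimage
    (fun i => (fun x => (f x ord0 i : measurableTypeR R))) `<=` measurable)).
  rewrite (g_sigma_preimage_comp (fun i (x : 'rV[R]_n) => (x ord0 i : measurableTypeR R))).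
  split=> [mf A [/= C preC <-]|prefS]; first exact: mf.
  by move=> _ A mA; apply: prefS; exists A.
split=> [tnthfS i|mf].
- move=> _ A mA.
  apply: tnthfS; apply: sub_sigma_algebra.
  case: n i => [[] []//|n i] in f *.
  rewrite -bigcup_mkord_ord.
  exists i; first exact: ltn_ord.
  by exists A => //; rewrite inord_val.
- apply: smallest_sub; first exact: sigma_algebra_measurable.
  case: n => [|n] in f mf *; first by rewrite big_ord0.
  rewrite -bigcup_mkord_ord; apply: bigcup_sub => i Ii.
  by move=> A [B mB <-]; exact: mf.
Qed.

Definition vtail n (x : 'rV[R]_n.+1) : 'rV[R]_n := \row_j x ord0 (lift ord0 j).

Lemma vcons0 n t (v : 'rV[R]_n) : vcons t v ord0 ord0 = t.
Proof. by rewrite mxE unlift_none. Qed.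

Lemma vconsS n t (v : 'rV[R]_n) j : vcons t v ord0 (lift ord0 j) = v ord0 j.
Proof. by rewrite mxE liftK. Qed.

Lemma vtail_vcons n t (v : 'rV[R]_n) : vtail (vcons t v) = v.
Proof. by apply/rowP => j; rewrite mxE vconsS. Qed.

Lemma measurable_vcons n :
  measurable_fun [set: measurableTypeR R * 'rV[R]_n] (fun p => vcons p.1 p.2).
Proof.
apply/measurable_rVP => i; case: (unliftP ord0 i) => [k ->|->].
  apply: (eq_measurable_fun (fun p : measurableTypeR R * 'rV[R]_n => p.2 ord0 k)).
    by move=> p _; rewrite vconsS.
  exact: (measurableT_comp (measurable_coord k)).
apply: (eq_measurable_fun (fun p : measurableTypeR R * 'rV[R]_n => p.1)).
  by move=> p _; rewrite vcons0.
exact: measurable_fst.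
Qed.

Lemma measurable_uncons n :
  measurable_fun [set: 'rV[R]_n.+1]
    (fun x => (x ord0 ord0, vtail x) : measurableTypeR R * 'rV[R]_n).
Proof.
apply/measurable_fun_pairP; split; first exact: measurable_coord.
apply/measurable_rVP => i; rewrite /comp/=.
apply: (eq_measurable_fun (fun x : 'rV[R]_n.+1 => x ord0 (lift ord0 i))).
  by move=> x _; rewrite mxE.
exact: measurable_coord.
Qed.

End rV_measurable_fun.

(* The canonical instance of the library is shadowed by the one for subprobabilities. *)
Lemma product_sigma_finite d1 d2 (T1 : measurableType d1) (T2 : measurableType d2)
    (R : realType) (m1 : {sigma_finite_measure set T1 -> \bar R})
    (m2 : {sigma_finite_measure set T2 -> \bar R}) :
  sigma_finite setT (m1 \x m2)%E.
Proof.
have /sigma_finiteP[F [TF ndF Foo]] := sigma_finiteT m1.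
have /sigma_finiteP[G [TG ndG Goo]] := sigma_finiteT m2.
exists (fun n => F n `*` G n).
  rewrite -setXTT TF TG predeqE => -[x y]; split.
    move=> [/= [n _ Fnx] [k _ Gky]]; exists (maxn n k) => //; split.
    - by move: x Fnx; exact/subsetPset/ndF/leq_maxl.
    - by move: y Gky; exact/subsetPset/ndG/leq_maxr.
  by move=> [n _ []/= ? ?]; split; exists n.
move=> k; have [? ?] := Foo k; have [? ?] := Goo k.
split; first exact: measurableX.
by rewrite product_measure1E// lte_mul_pinfty// ge0_fin_numE.
Qed.

Section rV_measure.
Context {R : realType}.

Section vcons_measure.
Variables (n : nat) (m : {sigma_finite_measure set 'rV[R]_n -> \bar R}).

(** One more coordinate in front, through the same [vcons] as in the recursion of [lint]: Tonelli
    for this measure is then exactly one step of that recursion. *)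
Definition vcons_measure : set 'rV[R]_n.+1 -> \bar R :=
  pushforward (@lebesgue_measure R \x m)%E (fun p => vcons p.1 p.2).

Let vcons_measure0 : vcons_measure set0 = 0%E.
Proof. by rewrite /vcons_measure /pushforward preimage_set0 measure0. Qed.

Let vcons_measure_ge0 A : (0 <= vcons_measure A)%E.
Proof. exact: (@measure_ge0 _ _ _ (@lebesgue_measure R \x m)%E). Qed.

Let vcons_measure_sigma_additive : semi_sigma_additive vcons_measure.
Proof.
pose nu : {measure set _ -> \bar R} := (@lebesgue_measure R \x m)%E.
move=> F mF tF mUF; rewrite /vcons_measure /pushforward preimage_bigcup.
apply: (@measure_semi_sigma_additive _ _ _ nu).
- by move=> k; rewrite -[X in measurable X]setTI; exact: measurable_vcons.
- apply/trivIsetP => /= i j _ _ ij; rewrite -preimage_setI.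
  by move/trivIsetP : tF => /(_ _ _ _ _ ij) ->//; rewrite preimage_set0.
- by rewrite -preimage_bigcup -[X in measurable X]setTI; exact: measurable_vcons.
Qed.

HB.instance Definition _ := isMeasure.Build _ _ _ vcons_measure
  vcons_measure0 vcons_measure_ge0 vcons_measure_sigma_additive.

Let vcons_measure_sigma_finite : sigma_finite setT vcons_measure.
Proof.
have [F FT Foo] := product_sigma_finite (@lebesgue_measure R) m.
(* [vcons] is a bijection with a measurable inverse, so an exhaustion of the product is carried over
   by preimage under the inverse. *)
exists (fun k => (fun x : 'rV[R]_n.+1 => (x ord0 ord0, vtail x)) @^-1` F k).
  by rewrite -preimage_bigcup -FT preimage_setT.
move=> k; have [mFk Fk] := Foo k; split.
  rewrite -[X in measurable X]setTI; exact: measurable_uncons.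
suff E : (fun p : measurableTypeR R * 'rV[R]_n => vcons p.1 p.2) @^-1`
    ((fun x : 'rV[R]_n.+1 => (x ord0 ord0, vtail x)) @^-1` F k) = F k.
  by rewrite /vcons_measure /pushforward E.
by apply/seteqP; split => -[t v] /=; rewrite vcons0 vtail_vcons.
Qed.

HB.instance Definition _ := Measure_isSigmaFinite.Build _ _ _ vcons_measure
  vcons_measure_sigma_finite.
End vcons_measure.

Let dirac_sigma_finite : sigma_finite setT (\d_ (0 : 'rV[R]_0) : set 'rV[R]_0 -> \bar R).
Proof.
apply: fin_num_fun_sigma_finite; first by rewrite measure0.
by move=> A mA; rewrite diracE.
Qed.

(** In dimension 0 [lint] evaluates at the only point, hence a Dirac mass as the base of [mu]. *)
Definition dirac0 : set 'rV[R]_0 -> \bar R := \d_ (0 : 'rV[R]_0).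
HB.instance Definition _ := Measure.on dirac0.
HB.instance Definition _ := Measure_isSigmaFinite.Build _ _ _ dirac0 dirac_sigma_finite.

Fixpoint mu n : {sigma_finite_measure set 'rV[R]_n -> \bar R} :=
  match n with
  | 0 => dirac0
  | n'.+1 => vcons_measure (mu n')
  end.

End rV_measure.

(** * Iterated integrals as integrals against [mu n] *)

Section integral_rV.
Context {R : realType}.
Local Notation leb := (@lebesgue_measure R).
Local Open Scope ereal_scope.

Lemma ge0_integral_vcons_prod n (F : 'rV[R]_n.+1 -> \bar R) :
  measurable_fun [set: 'rV[R]_n.+1] F -> (forall x, 0 <= F x) ->
  \int[mu n.+1]_x F x =
  \int[leb \x mu n]_p F (vcons p.1 p.2).
Proof.
move=> mF F0.
by rewrite [LHS](ge0_integral_pushforward (@measurable_vcons R n) (leb \x mu n))//.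
Qed.

Lemma measurable_vcons_comp n (F : 'rV[R]_n.+1 -> \bar R) :
  measurable_fun [set: 'rV[R]_n.+1] F ->
  measurable_fun [set: measurableTypeR R * 'rV[R]_n] (fun p => F (vcons p.1 p.2)).
Proof. by move=> mF; apply: (measurableT_comp mF); exact: measurable_vcons. Qed.

Lemma ge0_integral_vcons n (F : 'rV[R]_n.+1 -> \bar R) :
  measurable_fun [set: 'rV[R]_n.+1] F -> (forall x, 0 <= F x) ->
  \int[mu n.+1]_x F x = \int[leb]_t \int[mu n]_v F (vcons t v).
Proof.
move=> mF F0; rewrite ge0_integral_vcons_prod//.
rewrite (@fubini_tonelli1 _ _ _ _ _ leb (mu n) (fun p => F (vcons p.1 p.2)))//.
exact: measurable_vcons_comp.
Qed.

Lemma measurable_slice n (F : 'rV[R]_n.+1 -> \bar R) t :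
  measurable_fun [set: 'rV[R]_n.+1] F ->
  measurable_fun [set: 'rV[R]_n] (fun v => F (vcons t v)).
Proof.
move=> mF; apply: (measurableT_comp mF); apply/measurable_rVP => i.
case: (unliftP ord0 i) => [k ->|->].
  by under eq_fun do rewrite vconsS; exact: measurable_coord.
by under eq_fun do rewrite vcons0; exact: measurable_cst.
Qed.

Lemma measurable_integral_slice n (F : 'rV[R]_n.+1 -> \bar R) :
  measurable_fun [set: 'rV[R]_n.+1] F -> (forall x, 0 <= F x) ->
  measurable_fun [set: measurableTypeR R] (fun t => \int[mu n]_v F (vcons t v)).
Proof.
move=> mF F0.
apply: (@measurable_fun_fubini_tonelli_F _ _ _ _ R (mu n) (fun p => F (vcons p.1 p.2))) => //.
exact: measurable_vcons_comp.
Qed.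

Lemma integral_rV0 (F : 'rV[R]_0 -> \bar R) : \int[mu 0]_x F x = F 0%R.
Proof.
have mF : measurable_fun [set: 'rV[R]_0] F.
  apply: (eq_measurable_fun (cst (F 0%R))); last exact: measurable_cst.
  by move=> x _; congr F; apply/rowP => -[].
rewrite [LHS](integral_dirac (0%R : 'rV[R]_0) measurableT mF).
by rewrite diracT mul1e.
Qed.

Lemma ge0_lintE n (F : 'rV[R]_n -> \bar R) :
  measurable_fun [set: 'rV[R]_n] F -> (forall x, 0 <= F x) ->
  lint F = \int[mu n]_x F x.
Proof.
elim: n F => [|n IH] F mF F0; first by rewrite integral_rV0.
rewrite ge0_integral_vcons//=; apply: eq_integral => t _.
by apply: IH => //; exact: measurable_slice.
Qed.

Lemma oneDsqr_gt0 (t : R) : (0 < oneDsqr t)%R.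
Proof. exact: lt_le_trans ltr01 (oneDsqr_ge1 t). Qed.

(** The universal integrable majorant. Being a product, it restricts to each slice as a multiple of
    the majorant one dimension lower. *)
Definition decay n (x : 'rV[R]_n) : R := (\prod_(i < n) (oneDsqr (x ord0 i))^-1)%R.

Lemma decay_gt0 n (x : 'rV[R]_n) : (0 < decay x)%R.
Proof. by apply: prodr_gt0 => i _; rewrite invr_gt0 oneDsqr_gt0. Qed.

Lemma decay_vcons n t (v : 'rV[R]_n) :
  decay (vcons t v) = ((oneDsqr t)^-1 * decay v)%R.
Proof.
rewrite /decay big_ord_recl vcons0; congr (_ * _)%R.
by apply: eq_bigr => i _; rewrite vconsS.
Qed.

Lemma measurable_oneDsqrV : measurable_fun [set: R] (fun t : R => (oneDsqr t)^-1)%R.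
Proof. by apply: continuous_measurable_fun; exact: continuous_oneDsqrV. Qed.

Lemma measurable_prod_coord n (h : 'I_n -> R -> R) :
  (forall i, measurable_fun [set: R] (h i)) ->
  measurable_fun [set: 'rV[R]_n] (fun x : 'rV[R]_n => \prod_(i < n) h i (x ord0 i))%R.
Proof.
move=> mh.
apply: (@measurable_prod _ 'rV[R]_n R setT _ (index_enum 'I_n)
  (fun i (x : 'rV[R]_n) => h i (x ord0 i))) => i _.
by apply: (measurableT_comp (mh i)); exact: measurable_coord.
Qed.

Lemma measurable_decay n : measurable_fun [set: 'rV[R]_n] (@decay n).
Proof. exact: (@measurable_prod_coord n (fun _ t => (oneDsqr t)^-1%R) (fun _ => measurable_oneDsqrV)). Qed.

Lemma integralT_oneDsqrV : \int[leb]_t ((oneDsqr t)^-1)%:E = pi%:E.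
Proof.
rewrite ge0_symfun_integralT.
- have -> : [set x : R | (0 <= x)%R] = `[0%R, +oo[%classic by rewrite set_itvcy.
  rewrite integral0y_oneDsqr -EFinM; congr EFin; by field.
- by move=> x; rewrite invr_ge0 ltW// oneDsqr_gt0.
- exact: continuous_oneDsqrV.
- by move=> x; rewrite /= /oneDsqr sqrrN.
Qed.

Lemma integral_decay n : \int[mu n]_x (decay x)%:E = (pi ^+ n)%:E.
Proof.
elim: n => [|n IH]; first by rewrite integral_rV0 /decay big_ord0 expr0.
rewrite ge0_integral_vcons; last 2 first.
- by apply/measurable_EFinP; exact: measurable_decay.
- by move=> x; rewrite lee_fin ltW ?decay_gt0.
under eq_integral => t _.
  under eq_integral => v _ do rewrite decay_vcons EFinM.
  rewrite ge0_integralZl//; last 2 first.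
  - by apply/measurable_EFinP; exact: measurable_decay.
  - by move=> x _; rewrite lee_fin ltW ?decay_gt0.
  rewrite IH; over.
rewrite ge0_integralZr//.
- by rewrite integralT_oneDsqrV -EFinM exprS.
- by apply/measurable_EFinP; exact: measurable_oneDsqrV.
- by rewrite lee_fin exprn_ge0// pi_ge0.
Qed.

(** Mere integrability passes to almost every slice only, whereas this passes to every slice; so for
    signed functions too [lint] agrees with the integral at each level of the recursion
    ([dominated_lintE]). *)
Definition dominated n (F : 'rV[R]_n -> R) :=
  measurable_fun [set: 'rV[R]_n] F /\ exists C, forall x, (`|F x| <= C * decay x)%R.

Lemma integrable_decay n : (mu n).-integrable setT (EFin \o @decay n).
Proof.
apply/integrableP; split; first by apply/measurable_EFinP; exact: measurable_decay.
under eq_integral => x _ do rewrite /= ger0_norm ?ltW ?decay_gt0//.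
by rewrite integral_decay ltry.
Qed.

Lemma dominated_integrable n (F : 'rV[R]_n -> R) :
  dominated F -> (mu n).-integrable setT (EFin \o F).
Proof.
move=> [mF [C FC]].
apply: (@le_integrable _ _ _ _ _ measurableT _ (fun x => C%:E * (decay x)%:E)).
- exact/measurable_EFinP.
- move=> x _; rewrite /= lee_fin; apply: (le_trans (FC x)).
  by rewrite ler_norm.
- apply: integrableZl => //; exact: integrable_decay.
Qed.

Lemma dominated_slice n (F : 'rV[R]_n.+1 -> R) t :
  dominated F -> dominated (fun v => F (vcons t v)).
Proof.
move=> [mF [C FC]]; split.
  by apply/measurable_EFinP; apply: (@measurable_slice _ (EFin \o F)); exact/measurable_EFinP.
exists (C * (oneDsqr t)^-1)%R => v.
by rewrite -mulrA -decay_vcons.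
Qed.

Lemma integrable_vcons n (F : 'rV[R]_n.+1 -> \bar R) :
  (mu n.+1).-integrable setT F ->
  (leb \x mu n).-integrable setT (fun p => F (vcons p.1 p.2)).
Proof.
move=> /integrableP[mF Foo]; apply/integrableP; split.
  exact: measurable_vcons_comp.
rewrite -(@ge0_integral_vcons_prod n (fun x => `|F x|))//.
exact: measurableT_comp.
Qed.

Lemma integral_vcons n (F : 'rV[R]_n.+1 -> \bar R) :
  (mu n.+1).-integrable setT F ->
  \int[mu n.+1]_x F x = \int[leb]_t \int[mu n]_v F (vcons t v).
Proof.
move=> iF; have mF := measurable_int _ iF.
rewrite (@integral12_prod_meas1 _ _ _ _ _ leb (mu n) (fun p => F (vcons p.1 p.2))); last first.
  exact: integrable_vcons.
rewrite integralE [RHS]integralE; congr (_ - _); rewrite ge0_integral_vcons_prod//.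
- by under [in RHS]eq_integral do rewrite funepos_comp.
- exact: measurable_funepos.
- by under [in RHS]eq_integral do rewrite funeneg_comp.
- exact: measurable_funeneg.
Qed.

Lemma dominated_lintE n (F : 'rV[R]_n -> R) : dominated F ->
  lint (fun x => (F x)%:E) = \int[mu n]_x (F x)%:E.
Proof.
elim: n F => [|n IH] F dF; first by rewrite integral_rV0.
rewrite integral_vcons//=; last exact: dominated_integrable.
apply: eq_integral => t _; apply: (IH (fun v => F (vcons t v))).
exact: dominated_slice.
Qed.

Lemma dominated_rintE n (F : 'rV[R]_n -> R) : dominated F ->
  rint F = (\int[mu n]_x F x)%R.
Proof. by move=> dF; rewrite /rint dominated_lintE. Qed.

End integral_rV.

(** * Affine changes of variable on the line *)

Section affine.
Context {R : realType}.
Local Notation leb := (@lebesgue_measure R).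
Local Open Scope ereal_scope.

Lemma measurable_affine1 (a c : R) :
  measurable_fun [set: measurableTypeR R] (fun t : R => (a * t + c)%R : measurableTypeR R).
Proof.
apply: continuous_measurable_fun => x; apply: cvgD; last exact: cvg_cst.
by apply: cvgM => //; exact: cvg_cst.
Qed.

(** Lebesgue measure is determined by its values on half-open intervals, and the image measure under
    the affine map, multiplied by [|a|], has the same values there. *)
Lemma ge0_integral_affine1 (a c : R) (f : R -> \bar R) : (a != 0)%R ->
  measurable_fun [set: R] f -> (forall t, 0 <= f t) ->
  \int[leb]_t f (a * t + c)%R = (`|a|^-1)%:E * \int[leb]_t f t.
Proof.
move=> a0 mf f0.
pose phi := fun t : R => (a * t + c)%R : measurableTypeR R.
pose k : {nonneg R} := NngNum (normr_ge0 a).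
have mphi : measurable_fun [set: measurableTypeR R] phi by exact: measurable_affine1.
pose nup : {measure set (measurableTypeR R) -> \bar R} := pushforward leb phi.
pose nu' : {measure set (measurableTypeR R) -> \bar R} := mscale k (nup mphi).
have H A : measurable A -> leb A = nu' A.
  apply: lebesgue_measure_unique => _ [[x y] _ <-] /=.
  rewrite /nu' /mscale/= /nup/= /pushforward/=.
  (* For negative [a] the preimage is half-open at the other end, which does not change its
     length. *)
  have [ag|al|/eqP] := ltgtP a 0%R; last by rewrite (negbTE a0).
    have -> : phi @^-1` `]x, y] = `[((y - c) / a)%R, ((x - c) / a)%R[%classic.
      apply/seteqP; split => t /=; rewrite /phi !in_itv/= => /andP[h1 h2];
        (apply/andP; split).
      - by rewrite ler_ndivrMr// mulrC lerBrDr.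
      - by rewrite ltr_ndivlMr// mulrC ltrBlDr.
      - by move: h2; rewrite ltr_ndivlMr// ltrBlDr mulrC.
      - by move: h1; rewrite ler_ndivrMr// lerBrDr mulrC.
    rewrite !lebesgue_measure_itv/= !lte_fin ltr_ndivrMr// divfK// ltrD2r.
    case: ifPn => xy; last by rewrite mule0.
    rewrite -!EFinB -EFinM ltr0_norm//; congr EFin.
    by field.
  have -> : phi @^-1` `]x, y] = `]((x - c) / a)%R, ((y - c) / a)%R]%classic.
    apply/seteqP; split => t /=; rewrite /phi !in_itv/= => /andP[h1 h2];
      (apply/andP; split).
    - by rewrite ltr_pdivrMr// mulrC ltrBlDr.
    - by rewrite ler_pdivlMr// mulrC lerBrDr.
    - by move: h1; rewrite ltr_pdivrMr// ltrBlDr mulrC.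
    - by move: h2; rewrite ler_pdivlMr// lerBrDr mulrC.
  rewrite !lebesgue_measure_itv/= !lte_fin ltr_pdivrMr// divfK// ltrD2r.
  case: ifPn => xy; last by rewrite mule0.
  rewrite -!EFinB -EFinM gtr0_norm//; congr EFin.
  by field.
have -> : \int[leb]_t f t = \int[nu']_t f t.
  by apply: eq_measure_integral => A mA _; exact: H.
rewrite ge0_integral_mscale//= muleA -EFinM mulVf ?normr_eq0// mul1e.
by rewrite (@ge0_integral_pushforward _ _ _ _ R _ mphi leb setT f).
Qed.

End affine.

(** * Borel sets of row vectors *)

Section rV_borel.
Context {R : realType}.

Lemma measurable_rV_ball n (c : 'rV[R]_n) (e : R) :
  measurable [set x : 'rV[R]_n | forall i, `|c ord0 i - x ord0 i| < e].
Proof.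
apply/measurable_indicP.
rewrite (_ : \1_ _ = fun x : 'rV[R]_n => \prod_(i < n) \1_[set t : R | `|c ord0 i - t| < e] (x ord0 i)); last first.
  apply/funext => x; rewrite indicE.
  have [xb|xb] := pselect (forall i, `|c ord0 i - x ord0 i| < e).
    rewrite mem_set// big1// => i _; rewrite indicE mem_set//=.
  rewrite memNset//.
  move/existsNP : xb => [i xi].
  by apply/esym/eqP/prodf_eq0; exists i => //; rewrite indicE memNset.
apply: (@measurable_prod_coord R n (fun i => \1_[set t : R | `|c ord0 i - t| < e])) => i.
apply: measurable_indic; apply: open_measurable.
rewrite (_ : [set t | _] = ball (c ord0 i) e); last by [].
exact: ball_open.
Qed.

Lemma rV_ballP n (c x : 'rV[R]_n) e : 0 < e ->
  (ball c e x <-> forall i, `|c ord0 i - x ord0 i| < e).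
Proof.
move=> e0; split; first by move=> [_ h] i; exact: h.
by move=> h; split => // i j; rewrite (ord1 i); exact: h.
Qed.

(** An open set is the union of the balls with rational centre and radius 1/(k+1) contained in it.
    The pairs (centre, k) are enumerated by [pickle], codes of no use being sent to the empty
    set. *)
Lemma open_measurable_rV n (U : set 'rV[R]_n) : open U -> measurable U.
Proof.
move=> oU.
pose c (p : 'rV[rat]_n * nat) : 'rV[R]_n := map_mx ratr p.1.
pose e (p : 'rV[rat]_n * nat) : R := p.2.+1%:R^-1.
pose b (p : 'rV[rat]_n * nat) := [set x : 'rV[R]_n | forall i, `|c p ord0 i - x ord0 i| < e p].
pose B j := if unpickle j is Some p then if `[<b p `<=` U>] then b p else set0 else set0.
rewrite (_ : U = \bigcup_j B j).
  apply: bigcupT_measurable => j; rewrite /B; case: unpickle => [p|//].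
  case: ifP => // _; exact: measurable_rV_ball.
apply/seteqP; split => [x Ux|x [j _]]; last first.
  rewrite /B; case: unpickle => [p|//].
  by case: ifP => // /asboolP; exact.
have /nbhs_ballP[d /= d0 dU] : nbhs x U by exact: open_nbhs_nbhs.
have [k kd] : exists k : nat, k.+1%:R^-1 < d / 2.
  have := near_infty_natSinv_lt (PosNum (divr_gt0 d0 (ltr0Sn R 1))).
  by move=> [k _ /(_ k (leqnn k))] h; exists k.
have k0 : 0 < k.+1%:R^-1 :> R by rewrite invr_gt0.
have hq i : exists q : rat, `|ratr q - x ord0 i| < k.+1%:R^-1.
  have xx : x ord0 i - k.+1%:R^-1 < x ord0 i + k.+1%:R^-1.
    by rewrite ltrBlDr -addrA ltrDl addr_gt0.
  have [q] := rat_in_itvoo xx.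
  by rewrite in_itv/= => qx; exists q; rewrite ltr_distl.
have [q hq'] := choice hq.
pose p := (\row_i q i : 'rV[rat]_n, k).
exists (pickle p) => //; rewrite /B pickleK.
have bx : b p x by move=> i; rewrite /c /= !mxE; exact: hq'.
case: ifPn => // /asboolP; case => y by_.
apply: dU; apply/rV_ballP => // i.
have := by_ i; have := bx i; rewrite /e/=.
set u := c p ord0 i => h1 h2.
have : `|x ord0 i - y ord0 i| <= `|u - x ord0 i| + `|u - y ord0 i|.
  by rewrite (distrC u (x ord0 i)); exact: ler_distD.
by move: kd h1 h2; set r := k.+1%:R^-1; lra.
Qed.

Lemma continuous_measurable_rV n (f : 'rV[R]_n -> R) :
  continuous f -> measurable_fun [set: 'rV[R]_n] f.
Proof.
move=> cf; apply: (measurability _ (RGenOpens.measurableE R)).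
move=> _ [_ [a [b ->] <-]]; apply: measurableI => //.
apply: open_measurable_rV; apply: open_comp; last exact: interval_open.
by move=> x _; exact: cf.
Qed.

End rV_borel.

Section rV_ops.
Context {R : realType} d (T : measurableType d).

Lemma measurable_rVD n (f g : T -> 'rV[R]_n) :
  measurable_fun setT f -> measurable_fun setT g ->
  measurable_fun setT (fun t => f t + g t).
Proof.
move=> /measurable_rVP mf /measurable_rVP mg; apply/measurable_rVP => i.
by under eq_fun do rewrite mxE; exact: measurable_funD.
Qed.

Lemma measurable_rVZ n (k : R) (f : T -> 'rV[R]_n) :
  measurable_fun setT f -> measurable_fun setT (fun t => k *: f t).
Proof.
move=> /measurable_rVP mf; apply/measurable_rVP => i.
by under eq_fun do rewrite mxE; exact: measurable_funM.
Qed.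

Lemma measurable_rVB n (f g : T -> 'rV[R]_n) :
  measurable_fun setT f -> measurable_fun setT g ->
  measurable_fun setT (fun t => f t - g t).
Proof.
move=> mf mg; under eq_fun do rewrite -scaleN1r.
by apply: measurable_rVD => //; exact: measurable_rVZ.
Qed.

Lemma measurable_dotR n (f g : T -> 'rV[R]_n) :
  measurable_fun setT f -> measurable_fun setT g ->
  measurable_fun setT (fun t => dotR (f t) (g t)).
Proof.
move=> /measurable_rVP mf /measurable_rVP mg.
apply: (@measurable_sum _ T R setT _ (index_enum 'I_n)
  (fun i t => f t ord0 i * g t ord0 i)) => i.
exact: measurable_funM.
Qed.

End rV_ops.

(** * Changes of variable, product integrands and cubes in several dimensions *)

Section rV_integral.
Context {R : realType}.
Local Notation leb := (@lebesgue_measure R).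
Local Open Scope ereal_scope.

Lemma affine_vcons n (a : R) (c : 'rV[R]_n.+1) t v :
  (a *: vcons t v + c = vcons (a * t + c ord0 ord0) (a *: v + vtail c))%R.
Proof.
apply/rowP => i; case: (unliftP ord0 i) => [k ->|->].
  by rewrite vconsS !mxE liftK.
by rewrite vcons0 !mxE unlift_none.
Qed.

Lemma measurable_affine n (a : R) (c : 'rV[R]_n) :
  measurable_fun [set: 'rV[R]_n] (fun x : 'rV[R]_n => a *: x + c)%R.
Proof.
by apply: measurable_rVD; [apply: measurable_rVZ; exact: measurable_id|exact: measurable_cst].
Qed.

Lemma ge0_integral_affine n (a : R) (c : 'rV[R]_n) (F : 'rV[R]_n -> \bar R) :
  (a != 0)%R -> measurable_fun setT F -> (forall x, 0 <= F x) ->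
  \int[mu n]_x F (a *: x + c)%R = (`|a|^-1 ^+ n)%:E * \int[mu n]_x F x.
Proof.
move=> a0; elim: n c F => [|n IH] c F mF F0.
  rewrite !integral_rV0 expr0 mul1e; congr F.
  by apply/rowP => -[].
rewrite ge0_integral_vcons//; last first.
  by apply: (measurableT_comp mF); exact: measurable_affine.
under eq_integral => t _.
  under eq_integral => v _ do rewrite affine_vcons.
  rewrite (IH (vtail c) (fun v => F (vcons (a * t + c ord0 ord0)%R v)))//; last first.
    exact: measurable_slice.
  over.
rewrite ge0_integralZl//; last 2 first.
- apply: (measurableT_comp (measurable_integral_slice mF F0)).
  exact: measurable_affine1.
- by move=> t _; exact: integral_ge0.
rewrite (@ge0_integral_affine1 _ a (c ord0 ord0) (fun t => \int[mu n]_v F (vcons t v)))//; last 2 first.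
- exact: measurable_integral_slice.
- by move=> t; exact: integral_ge0.
by rewrite muleA -EFinM -exprSr ge0_integral_vcons.
Qed.

Lemma integrable_affine n (a : R) (c : 'rV[R]_n) (F : 'rV[R]_n -> \bar R) :
  (a != 0)%R -> (mu n).-integrable setT F ->
  (mu n).-integrable setT (fun x => F (a *: x + c)%R).
Proof.
move=> a0 /integrableP[mF Foo]; apply/integrableP; split.
  by apply: (measurableT_comp mF); exact: measurable_affine.
rewrite (@ge0_integral_affine _ a c (fun x => `|F x|))//; last exact: measurableT_comp.
by rewrite lte_mul_pinfty// lee_fin exprn_ge0// invr_ge0.
Qed.

Lemma integral_affine n (a : R) (c : 'rV[R]_n) (F : 'rV[R]_n -> \bar R) :
  (a != 0)%R -> (mu n).-integrable setT F ->
  \int[mu n]_x F (a *: x + c)%R = (`|a|^-1 ^+ n)%:E * \int[mu n]_x F x.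
Proof.
move=> a0 iF; have mF := measurable_int _ iF.
rewrite integralE [X in _ = _ * X]integralE.
rewrite muleBr//; last first.
  apply: fin_num_adde_defl.
  rewrite fin_numN; apply: (integrable_fin_num measurableT).
  exact: integrable_funeneg.
rewrite -(@ge0_integral_affine _ a c F^\+)//; last exact: measurable_funepos.
rewrite -(@ge0_integral_affine _ a c F^\-)//; last exact: measurable_funeneg.
by congr (_ - _); apply: eq_integral => x _; rewrite (funepos_comp, funeneg_comp).
Qed.

Lemma integral_prod_coord n (h : 'I_n -> R -> R) (c : 'I_n -> R) :
  (forall i, measurable_fun [set: R] (h i)) -> (forall i t, (0 <= h i t)%R) ->
  (forall i, \int[leb]_t (h i t)%:E = (c i)%:E) ->
  \int[mu n]_x (\prod_(i < n) h i (x ord0 i))%:E = (\prod_(i < n) c i)%:E.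
Proof.
elim: n h c => [|n IH] h c mh h0 hc.
  by rewrite integral_rV0 !big_ord0.
have c0 i : (0 <= c i)%R.
  by rewrite -lee_fin -hc; apply: integral_ge0 => t _; rewrite lee_fin.
have mp k (g : 'I_k -> R -> R) : (forall i, measurable_fun [set: R] (g i)) ->
    measurable_fun setT (fun x : 'rV[R]_k => (\prod_(i < k) g i (x ord0 i))%:E).
  by move=> mg; apply/measurable_EFinP; exact: measurable_prod_coord.
rewrite ge0_integral_vcons//; last 2 first.
- exact: mp.
- by move=> x; rewrite lee_fin; apply: prodr_ge0.
under eq_integral => t _.
  under eq_integral => v _.
    rewrite big_ord_recl vcons0.
    under eq_bigr do rewrite vconsS.
    rewrite EFinM; over.
  rewrite ge0_integralZl//; last 3 first.
  - by apply: (mp _ (fun i => h (lift ord0 i))).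
  - by move=> x _; rewrite lee_fin; apply: prodr_ge0.
  - by rewrite lee_fin.
  rewrite (IH (fun i => h (lift ord0 i)) (fun i => c (lift ord0 i)))//.
  over.
rewrite ge0_integralZr//; last 3 first.
- by apply/measurable_EFinP; exact: mh.
- by move=> t _; rewrite lee_fin; exact: h0.
- by rewrite lee_fin; apply: prodr_ge0.
by rewrite hc -EFinM [in RHS]big_ord_recl.
Qed.

(** Here [u] is half the side, whence the volumes [(2 * u) ^+ n]. Cubes are half-open so that the
    2^n halves of a cube tile it exactly, without null sets ([chi_split]). *)
Definition cube n (z : 'rV[R]_n) (u : R) : set 'rV[R]_n :=
  [set x | forall i, (z ord0 i - u <= x ord0 i < z ord0 i + u)%R].

Lemma indic_cube n (z : 'rV[R]_n) u x :
  (\1_(cube z u) x = \prod_(i < n) \1_(`[z ord0 i - u, z ord0 i + u[%classic : set R) (x ord0 i) :> R)%R.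
Proof.
rewrite indicE; have [xb|xb] := pselect (cube z u x).
  rewrite mem_set// big1// => i _; rewrite indicE mem_set//=.
  by rewrite in_itv/=; exact: xb.
rewrite memNset//.
move/existsNP : xb => [i xi].
apply/esym/eqP/prodf_eq0; exists i => //; rewrite indicE memNset//=.
Qed.

Lemma measurable_cube n (z : 'rV[R]_n) u : measurable (cube z u).
Proof.
apply/measurable_indicP.
pose h (i : 'I_n) : R -> R := \1_(`[(z ord0 i - u)%R, (z ord0 i + u)%R[%classic : set R).
apply: (eq_measurable_fun (fun x : 'rV[R]_n => \prod_(i < n) h i (x ord0 i))%R).
  by move=> x _; rewrite indic_cube.
by apply: (@measurable_prod_coord R n h) => i; apply: measurable_indic.
Qed.

Lemma mu_cube n (z : 'rV[R]_n) (u : R) : (0 <= u)%R -> mu n (cube z u) = ((2 * u) ^+ n)%:E.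
Proof.
move=> u0; rewrite -[cube z u]setIT -integral_indic//; last exact: measurable_cube.
under eq_integral do rewrite indic_cube.
pose h (i : 'I_n) : R -> R := \1_(`[(z ord0 i - u)%R, (z ord0 i + u)%R[%classic : set R).
rewrite (@integral_prod_coord n h (fun=> (2 * u)%R))//.
- by rewrite prodr_const card_ord.
- by move=> i; apply: measurable_indic.
- move=> i; rewrite /h integral_indic// setIT.
  rewrite [LHS](lebesgue_measure_itv `[(z ord0 i - u)%R, (z ord0 i + u)%R[)/= lte_fin.
  case: ifPn => [_|]; first by rewrite -EFinB; congr EFin; ring.
  by rewrite -leNgt => zu; congr EFin; lra.
Qed.

End rV_integral.

(** * Hoelder's inequality and integrals of powers *)

Section hoelder_ge0.
Context {R : realType} d (T : measurableType d) (m : {measure set T -> \bar R}).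
Local Open Scope ereal_scope.

Lemma ge0_hoelder (f g : T -> R) (p q : R) :
  measurable_fun setT f -> measurable_fun setT g ->
  (forall x, 0 <= f x)%R -> (forall x, 0 <= g x)%R ->
  (0 < p)%R -> (0 < q)%R -> (p^-1 + q^-1 = 1)%R ->
  \int[m]_x (f x * g x)%:E <=
  (\int[m]_x (f x `^ p)%:E) `^ p^-1 * (\int[m]_x (g x `^ q)%:E) `^ q^-1.
Proof.
move=> mf mg f0 g0 p0 q0 pq.
have := hoelder m mf mg p0 q0 pq; rewrite Lnorm1 unlock.
have E : (\int[m]_x `|(EFin \o (f \* g)%R) x| = \int[m]_x (f x * g x)%:E).
  by apply: eq_integral => x _; congr EFin; rewrite /= ger0_norm// mulr_ge0.
have N h r : (forall x, 0 <= h x)%R -> (\int[m]_x (`|h x| `^ r)%:E = \int[m]_x (h x `^ r)%:E).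
  by move=> h0; apply: eq_integral => x _; rewrite ger0_norm.
by rewrite E (N f p f0) (N g q g0).
Qed.

(** An indicator equals its square and its positive powers, so both factors of Hoelder may carry
    it. *)
Lemma hoelder_indic (D : set T) (h : T -> R) (p q : R) : measurable D ->
  measurable_fun setT h -> (forall x, 0 <= h x)%R ->
  (0 < p)%R -> (0 < q)%R -> (p^-1 + q^-1 = 1)%R ->
  \int[m]_x (\1_D x * h x)%:E <=
  (\int[m]_x (\1_D x * h x `^ p)%:E) `^ p^-1 * (m D) `^ q^-1.
Proof.
move=> mD mh h0 p0 q0 pq.
have m1 : measurable_fun setT (\1_D : T -> R) by exact: measurable_indic.
have := @ge0_hoelder (fun x => \1_D x * h x)%R (\1_D) p q.
under eq_integral => x _.
  have -> : (\1_D x * h x * \1_D x = \1_D x * h x)%R.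
    by rewrite indicE; case: (_ \in _); rewrite ?mulr1 ?mul1r ?mul0r.
  over.
under [X in _ -> _ -> _ -> _ -> _ -> _ -> _ -> _ <= X `^ _ * _]eq_integral => x _.
  have -> : ((\1_D x * h x) `^ p = \1_D x * h x `^ p)%R.
    by rewrite indicE; case: (_ \in _); rewrite ?mul1r ?mul0r// powR0// gt_eqF.
  over.
under [X in _ -> _ -> _ -> _ -> _ -> _ -> _ -> _ <= _ * X `^ _]eq_integral => x _.
  have -> : ((\1_D x) `^ q = \1_D x :> R)%R.
    by rewrite indicE; case: (_ \in _); rewrite ?powR1// powR0// gt_eqF.
  over.
rewrite [X in _ -> _ -> _ -> _ -> _ -> _ -> _ -> _ <= _ * X `^ _]integral_indic// setIT.
apply => //; first exact: measurable_funM.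
by move=> x; rewrite mulr_ge0.
Qed.

End hoelder_ge0.

Section power_integrals.
Context {R : realType}.
Local Notation leb := (@lebesgue_measure R).

(** The sum is at most twice the larger term. This covers exponents below 1 as well, where convexity
    would fail. *)
Lemma powRD_le (x y a : R) : 0 <= x -> 0 <= y -> 0 < a ->
  (x + y) `^ a <= 2 `^ a * (x `^ a + y `^ a).
Proof.
move=> x0 y0 a0.
wlog xy : x y x0 y0 / x <= y => [H|].
  have [|/ltW yx] := leP x y; first exact: H.
  by rewrite addrC [X in _ <= _ * X]addrC; exact: H.
apply: (@le_trans _ _ ((2 * y) `^ a)).
  apply: ge0_ler_powR; rewrite ?nnegrE ?addr_ge0 ?mulr_ge0 ?(ltW a0)//.
  by rewrite mulr_natl mulr2n lerD2r.
by rewrite powRM// ler_wpM2l ?powR_ge0// lerDr powR_ge0.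
Qed.

Lemma continuous_powR (a x : R) : 0 < x -> {for x, continuous (fun u : R => u `^ a)}.
Proof.
move=> x0; apply: differentiable_continuous; apply/derivable1_diffP.
by apply: derivable_powR; rewrite in_itv/= x0.
Qed.

Lemma is_derive_powR_div (a x : R) : a != 0 -> 0 < x ->
  is_derive x 1 (fun u : R => u `^ a / a) (x `^ (a - 1)).
Proof.
move=> a0 x0.
have h := is_derive1_powR a x0.
rewrite (_ : (fun u => _) = (a^-1 \*: (fun u : R => u `^ a) : R -> R)); last first.
  by apply/funext => u; rewrite /= mulrC.
apply: is_derive_eq.
by rewrite /GRing.scale/= mulrA mulVf// mul1r.
Qed.

Lemma measurable_fun_powR (D : set R) (a : R) : measurable_fun D (fun u : R => u `^ a).
Proof. by apply: measurable_funTS; exact: measurable_powR. Qed.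

Lemma measurable_powR_comp d (T : measurableType d) (f : T -> R) (a : R) :
  measurable_fun setT f -> measurable_fun setT (fun x => f x `^ a).
Proof.
by move=> mf; apply: (measurableT_comp (f := fun t : R => t `^ a)).
Qed.

Lemma integral_powRy (a X : R) : 0 < a -> 0 < X ->
  (\int[leb]_(u in `]X, +oo[) (u `^ (- a - 1))%:E = (X `^ (- a) / a)%:E)%E.
Proof.
move=> a0 X0.
have an0 : - a != 0 by rewrite oppr_eq0 gt_eqF.
rewrite integral_itv_obnd_cbnd; last first.
  by apply/measurable_EFinP; exact: measurable_fun_powR.
rewrite (@ge0_continuous_FTC2y R _ (fun u : R => u `^ (- a) / (- a)) X 0).
- by rewrite -EFinB sub0r invrN mulrN opprK.
- by move=> x _; exact: powR_ge0.
- apply: continuous_in_subspaceT => x; rewrite inE/= in_itv/= andbT => Xx.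
  by apply: continuous_powR; exact: lt_le_trans X0 Xx.
- rewrite -(mul0r (- a)^-1); apply: cvgM; last exact: cvg_cst.
  apply/cvgrPdist_lt => e e0; near=> x.
  have x0 : 0 < x by near: x; exact: nbhs_pinfty_gt.
  rewrite sub0r normrN ger0_norm ?powR_ge0// powRN.
  rewrite invf_plt ?posrE ?powR_gt0//.
  have : (e^-1) `^ a^-1 < x by near: x; apply: nbhs_pinfty_gt; rewrite num_real.
  move=> /(gt0_ltr_powR a0); rewrite !nnegrE powR_ge0 ltW// => /(_ isT isT).
  by rewrite -powRrM mulVf ?gt_eqF// powRr1// invr_ge0 ltW.
- by move=> x Xx; have /@ex_derive := is_derive_powR_div an0 (lt_trans X0 Xx).
- apply: cvg_at_right_filter; apply: cvgM; last exact: cvg_cst.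
  exact: continuous_powR.
- move=> x; rewrite in_itv/= andbT => Xx.
  rewrite derive1E; have /@derive_val -> // := is_derive_powR_div an0 (lt_trans X0 Xx).
Unshelve. all: by end_near. Qed.

(** For a < 1 the integrand is unbounded near 0, so the fundamental theorem is applied on
    [1/(i+1), X] and monotone convergence does the rest. *)
Lemma integral_powR0_le (a X : R) : 0 < a -> 0 < X ->
  (\int[leb]_(u in `]0%R, X]) (u `^ (a - 1))%:E <= (X `^ a / a)%:E)%E.
Proof.
move=> a0 X0.
have an0 : a != 0 by rewrite gt_eqF.
pose F (i : nat) : set R := `[i.+1%:R^-1, X]%classic.
have FU : `]0, X]%classic = \bigcup_i F i.
  apply/seteqP; split => [x /=|x [i _]].
    rewrite in_itv/= => /andP[x0 xX].
    have := near_infty_natSinv_lt (PosNum x0).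
    move=> [k _ /(_ k (leqnn k))] h; exists k => //=.
    by rewrite /F/= in_itv/= xX (ltW h).
  rewrite /F /= !in_itv/= => /andP[h ->]; rewrite andbT.
  by apply: lt_le_trans h; rewrite invr_gt0.
have mf i : measurable_fun (F i) (fun u : R => (u `^ (a - 1))%:E).
  by apply/measurable_EFinP; exact: measurable_fun_powR.
have cv : (\int[leb]_(x in F i) (x `^ (a - 1))%:E @[i --> \oo] -->
    \int[leb]_(x in \bigcup_i F i) (x `^ (a - 1))%:E)%E.
  apply: (@ge0_nondecreasing_set_cvg_integral _ (measurableTypeR R) R F (fun u : R => (u `^ (a - 1))%:E) leb) => //.
  - apply/nondecreasing_seqP => i; apply/subsetPset => x.
    rewrite /F/= !in_itv/= => /andP[h ->]; rewrite andbT.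
    by apply: le_trans h; rewrite lef_pV2 ?posrE// ler_nat.
  - by move=> i; exact: measurable_itv.
  - by move=> i x _; rewrite lee_fin powR_ge0.
rewrite FU -(cvg_lim _ cv)//.
apply: lime_le; first by apply/cvg_ex; eexists; exact: cv.
near=> i.
have iX : i.+1%:R^-1 < X.
  by near: i; exact: (near_infty_natSinv_lt (PosNum X0)).
have i0 : 0 < i.+1%:R^-1 :> R by rewrite invr_gt0.
rewrite (@continuous_FTC2 R _ (fun u : R => u `^ a / a))//.
- by rewrite -EFinB lee_fin gerBl divr_ge0 ?powR_ge0// ltW.
- apply: continuous_in_subspaceT => x; rewrite inE/= in_itv/= => /andP[ix _].
  by apply: continuous_powR; exact: lt_le_trans i0 ix.
- split.
  + move=> x; rewrite in_itv/= => /andP[ix _].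
    by have /@ex_derive := is_derive_powR_div an0 (lt_trans i0 ix).
  + apply: cvg_at_right_filter; apply: cvgM; last exact: cvg_cst.
    exact: continuous_powR.
  + apply: cvg_at_left_filter; apply: cvgM; last exact: cvg_cst.
    exact: continuous_powR.
- move=> x; rewrite in_itv/= => /andP[ix _].
  by rewrite derive1E; have /@derive_val -> := is_derive_powR_div an0 (lt_trans i0 ix).
Unshelve. all: by end_near. Qed.

End power_integrals.

(** * Averages over cubes *)

Section averaging.
Context {R : realType} (n : nat).
Local Notation leb := (@lebesgue_measure R).
Local Notation V := 'rV[R]_n.

Definition chi (z : V) (u : R) (x : V) : R := \1_(cube z u) x.

Lemma chi_ge0 z u x : 0 <= chi z u x.
Proof. by rewrite /chi indicE. Qed.

Lemma chiE z u x : chi z u x = \prod_(i < n)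
  (if (z ord0 i - u <= x ord0 i) && (x ord0 i < z ord0 i + u) then 1 else 0).
Proof.
rewrite /chi indic_cube; apply: eq_bigr => i _; rewrite indicE.
case: ifPn => h; first by rewrite mem_set//= in_itv/=.
by rewrite memNset//= in_itv/=; exact/negP.
Qed.

Lemma measurable_chi d (T : measurableType d) (z x : T -> V) (u : T -> R) :
  measurable_fun setT z -> measurable_fun setT u -> measurable_fun setT x ->
  measurable_fun setT (fun t => chi (z t) (u t) (x t)).
Proof.
move=> /measurable_rVP mz mu /measurable_rVP mx.
under eq_fun do rewrite chiE.
apply: (@measurable_prod _ T R setT _ (index_enum 'I_n) (fun i t =>
  (if (z t ord0 i - u t <= x t ord0 i) && (x t ord0 i < z t ord0 i + u t) then 1 else 0))) => i _.
apply: measurable_fun_ifT => //.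
apply: measurable_and.
  by apply: measurable_fun_ler => //; exact: measurable_funB.
by apply: measurable_fun_ltr => //; exact: measurable_funD.
Qed.

(** The centres whose cube contains x form a cube around x that is closed at the opposite end;
    changing the signs of both z and x turns it into a [cube]. *)
Lemma integral_chi_center (x : V) (u : R) : 0 < u ->
  (\int[mu n]_z (chi z u x)%:E = ((2 * u) ^+ n)%:E)%E.
Proof.
move=> u0.
have -> : (\int[mu n]_z (chi z u x)%:E = \int[mu n]_z (chi (- x) u ((- 1) *: z + 0)%R)%:E)%E.
  apply: eq_integral => z _; congr EFin; rewrite !chiE; apply: eq_bigr => i _.
  rewrite !mxE addr0 mulN1r.
  rewrite (_ : (_ <= x ord0 i) && _ = (- x ord0 i - u <= - z ord0 i) && (- z ord0 i < - x ord0 i + u))//.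
  by apply/idP/idP => /andP[h1 h2]; apply/andP; split; lra.
rewrite (@ge0_integral_affine _ _ (- 1) 0 (fun z => (chi (- x) u z)%:E))//.
- rewrite normrN1 invr1 expr1n mul1e /chi.
  rewrite integral_indic ?setIT//; last exact: measurable_cube.
  by apply: mu_cube; exact: ltW.
- apply/measurable_EFinP; apply: measurable_chi.
  + exact: measurable_cst.
  + exact: measurable_cst.
  + exact: measurable_id.
- by move=> z; rewrite lee_fin chi_ge0.
Qed.

Lemma integral_average (h : V -> R) (u : R) : 0 < u -> measurable_fun setT h ->
  (forall x, 0 <= h x) ->
  (\int[mu n]_z \int[mu n]_x (chi z u x * h x)%:E =
   ((2 * u) ^+ n)%:E * \int[mu n]_x (h x)%:E)%E.
Proof.
move=> u0 mh h0.
rewrite (@fubini_tonelli _ _ _ _ _ (mu n) (mu n) (fun p => (chi p.1 u p.2 * h p.2)%:E)); last 2 first.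
- apply/measurable_EFinP; apply: measurable_funM.
    by apply: measurable_chi => //; exact: measurable_cst.
  exact: measurableT_comp.
- by move=> p; rewrite lee_fin mulr_ge0// chi_ge0.
under eq_integral => x _.
  under eq_integral => z _ do rewrite /= EFinM.
  rewrite ge0_integralZr//; last 3 first.
  - apply/measurable_EFinP; apply: measurable_chi.
    + exact: measurable_id.
    + exact: measurable_cst.
    + exact: measurable_cst.
  - by move=> z _; rewrite lee_fin chi_ge0.
  - by rewrite lee_fin.
  rewrite integral_chi_center//; over.
rewrite ge0_integralZl//.
- exact/measurable_EFinP.
- by move=> x _; rewrite lee_fin.
- by rewrite lee_fin exprn_ge0// mulr_ge0// ltW.
Qed.

End averaging.

Section scale_sum.
Context {R : realType} (n : nat).
Local Notation leb := (@lebesgue_measure R).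
Local Notation V := 'rV[R]_n.

Lemma measurable_invr : measurable_fun [set: R] (@GRing.inv R).
Proof.
apply: (eq_measurable_fun (fun x : R => if 0 <= x then x `^ (-1) else - (- x) `^ (-1))).
  move=> x _; case: ifPn => [x0|]; first by rewrite powR_inv1.
  by rewrite -ltNge => /ltW x0; rewrite powR_inv1 ?oppr_ge0// invrN opprK.
apply: measurable_fun_ifT.
- by apply: measurable_fun_ler => //; exact: measurable_cst.
- exact: measurable_fun_powR.
- apply: measurable_funN; apply: (measurableT_comp (f := fun x : R => x `^ (-1))).
    exact: measurable_fun_powR.
  exact: measurable_funN.
Qed.

Definition avgc (h : V -> R) (u : R) (z : V) : R :=
  ((2 * u) ^+ n)^-1 * \int[mu n]_x (chi z u x * h x).

Lemma measurable_chi_fst (z : V) u : measurable_fun setT (chi z u).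
Proof. by apply: measurable_indic; exact: measurable_cube. Qed.

Lemma integral_chi (z : V) (u : R) : 0 <= u ->
  (\int[mu n]_x (chi z u x)%:E = ((2 * u) ^+ n)%:E)%E.
Proof.
move=> u0; rewrite /chi integral_indic ?setIT//; last exact: measurable_cube.
exact: mu_cube.
Qed.

Lemma chi_integral_le (h : V -> R) (M u : R) (z : V) : 0 <= u ->
  measurable_fun setT h -> (forall x, 0 <= h x) -> (forall x, h x <= M) ->
  (\int[mu n]_x (chi z u x * h x)%:E <= (M * (2 * u) ^+ n)%:E)%E.
Proof.
move=> u0 mh h0 hM.
have M0 : 0 <= M by apply: le_trans (hM 0); exact: h0.
apply: (@le_trans _ _ (\int[mu n]_x (M%:E * (chi z u x)%:E)))%E; last first.
  rewrite ge0_integralZl//; first by rewrite integral_chi// -EFinM.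
  - by apply/measurable_EFinP; exact: measurable_chi_fst.
  - by move=> x _; rewrite lee_fin chi_ge0.
apply: ge0_le_integral => //.
- by move=> x _; rewrite lee_fin mulr_ge0// chi_ge0.
- by apply/measurable_EFinP; apply: measurable_funM => //; exact: measurable_chi_fst.
- apply/measurable_EFinP; apply: measurable_funM => //; exact: measurable_chi_fst.
- by move=> x _; rewrite lee_fin mulrC ler_wpM2r// chi_ge0.
Qed.

Lemma integral_chi_fineK (h : V -> R) (M u : R) (z : V) : 0 <= u ->
  measurable_fun setT h -> (forall x, 0 <= h x) -> (forall x, h x <= M) ->
  ((\int[mu n]_x (chi z u x * h x))%R%:E = \int[mu n]_x (chi z u x * h x)%:E)%E.
Proof.
move=> u0 mh h0 hM; rewrite fineK// ge0_fin_numE.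
  exact: le_lt_trans (chi_integral_le z u0 mh h0 hM) (ltry _).
by apply: integral_ge0 => x _; rewrite lee_fin mulr_ge0// chi_ge0.
Qed.

Lemma Rintegral_chi_ge0 (h : V -> R) (u : R) (z : V) : (forall x, 0 <= h x) ->
  0 <= \int[mu n]_x (chi z u x * h x).
Proof. by move=> h0; apply: Rintegral_ge0 => x _; rewrite mulr_ge0 ?chi_ge0. Qed.

Lemma avgc_ge0 (h : V -> R) (u : R) (z : V) : 0 <= u -> (forall x, 0 <= h x) ->
  0 <= avgc h u z.
Proof.
move=> u0 h0; rewrite mulr_ge0 ?Rintegral_chi_ge0//.
by rewrite invr_ge0 exprn_ge0// mulr_ge0.
Qed.

Lemma measurable_avgc d (T : measurableType d) (h : V -> R) (u : T -> R) (z : T -> V) :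
  measurable_fun setT h -> (forall x, 0 <= h x) ->
  measurable_fun setT u -> measurable_fun setT z ->
  measurable_fun setT (fun t => avgc h (u t) (z t)).
Proof.
move=> mh h0 mu_ mz.
apply: measurable_funM.
  apply: (measurableT_comp (f := @GRing.inv R)); first exact: measurable_invr.
  by apply: measurable_funX; exact: measurable_funM.
rewrite /Rintegral; apply: (measurableT_comp (f := fine)) => //.
apply: (@measurable_fun_fubini_tonelli_F _ _ _ _ R (mu n)
  (fun p : T * V => (chi (z p.1) (u p.1) p.2 * h p.2)%:E)).
  apply/measurable_EFinP; apply: measurable_funM; last exact: measurableT_comp.
  apply: measurable_chi => //.
  - exact: (measurableT_comp mz).
  - exact: (measurableT_comp mu_).
by move=> p; rewrite lee_fin mulr_ge0// chi_ge0.
Qed.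

Lemma avgcE (h : V -> R) (M u : R) (z : V) : 0 <= u ->
  measurable_fun setT h -> (forall x, 0 <= h x) -> (forall x, h x <= M) ->
  ((avgc h u z)%:E = (((2 * u) ^+ n)^-1)%:E * \int[mu n]_x (chi z u x * h x)%:E)%E.
Proof. by move=> u0 mh h0 hM; rewrite EFinM (integral_chi_fineK z u0 mh h0 hM). Qed.

Lemma integral_avgc (h : V -> R) (M u : R) : 0 < u ->
  measurable_fun setT h -> (forall x, 0 <= h x) -> (forall x, h x <= M) ->
  (\int[mu n]_z (avgc h u z)%:E = \int[mu n]_x (h x)%:E)%E.
Proof.
move=> u0 mh h0 hM.
under eq_integral do rewrite (avgcE _ (ltW u0) mh h0 hM).
have Q0 : 0 < (2 * u) ^+ n by rewrite exprn_gt0// mulr_gt0.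
rewrite ge0_integralZl//; last 3 first.
- apply: (@measurable_fun_fubini_tonelli_F _ _ _ _ R (mu n)
    (fun p : V * V => (chi p.1 u p.2 * h p.2)%:E)).
    apply/measurable_EFinP; apply: measurable_funM; last exact: measurableT_comp.
    by apply: measurable_chi => //; exact: measurable_cst.
  by move=> p; rewrite lee_fin mulr_ge0// chi_ge0.
- by move=> z _; apply: integral_ge0 => x _; rewrite lee_fin mulr_ge0// chi_ge0.
- by rewrite lee_fin invr_ge0 ltW.
by rewrite integral_average// muleA -EFinM mulVf ?gt_eqF// mul1e.
Qed.

(** Hoelder against the indicator of the cube. With b = a/(a-1) the volume appears to the power a/b
    = a - 1, exactly what separates the two normalisations. *)
Lemma avgc_jensen (h : V -> R) (M u a : R) (z : V) : 0 < u -> 1 < a ->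
  measurable_fun setT h -> (forall x, 0 <= h x) -> (forall x, h x <= M) ->
  (avgc h u z) `^ a <= avgc (fun x => h x `^ a) u z.
Proof.
move=> u0 a1 mh h0 hM.
have a0 : 0 < a by exact: lt_trans a1.
have M0 : 0 <= M by apply: le_trans (hM 0); exact: h0.
set Q := (2 * u) ^+ n; have Q0 : 0 < Q by rewrite exprn_gt0// mulr_gt0.
have mha : measurable_fun setT (fun x => h x `^ a).
  exact: measurable_powR_comp.
have ha0 x : 0 <= h x `^ a by exact: powR_ge0.
have haM x : h x `^ a <= M `^ a.
  by apply: ge0_ler_powR; rewrite ?nnegrE// ltW.
pose b := a / (a - 1).
have b0 : 0 < b by rewrite divr_gt0// subr_gt0.
have ab : a^-1 + b^-1 = 1.
  by rewrite /b invf_div; field; rewrite gt_eqF.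
have := hoelder_indic (mu n) (measurable_cube z u) mh h0 a0 b0 ab.
rewrite [X in (_ * X `^ b^-1)%E](_ : _ = Q%:E); last by apply: mu_cube; exact: ltW.
rewrite -/(chi z u) -(integral_chi_fineK z (ltW u0) mh h0 hM).
rewrite -(integral_chi_fineK z (ltW u0) mha ha0 haM).
rewrite /avgc -/Q.
set I := (\int[_]_x (_ * h x))%R; set J := (\int[_]_x (_ * _ `^ a))%R.
have I0 : 0 <= I by exact: Rintegral_chi_ge0.
have J0 : 0 <= J by exact: Rintegral_chi_ge0.
rewrite !poweR_EFin -EFinM lee_fin => IJ.
have : I `^ a <= J * Q `^ (a - 1).
  have : I `^ a <= (J `^ a^-1 * Q `^ b^-1) `^ a.
    by apply: ge0_ler_powR; rewrite ?nnegrE ?mulr_ge0 ?powR_ge0 ?(ltW a0).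
  rewrite powRM ?powR_ge0// -!powRrM mulVf ?gt_eqF// powRr1//.
  suff -> : b^-1 * a = a - 1 by [].
  by rewrite /b invf_div divfK// gt_eqF.
rewrite powRM ?invr_ge0 ?(ltW Q0)// => h1.
rewrite -[leRHS](mulKf (x := Q `^ a)) ?powR_eq0 ?gt_eqF//.
have -> : Q^-1 `^ a = (Q `^ a)^-1.
  by rewrite -powR_inv1 ?(ltW Q0)// -powRrM mulN1r powRN.
rewrite ler_wpM2l ?invr_ge0 ?powR_ge0//.
rewrite mulrA -[X in X * J](_ : Q `^ (a - 1) = _) 1?mulrC//.
rewrite powRB; last by rewrite gt_eqF// implybT.
by rewrite powRr1 ?(ltW Q0)// mulrC.
Qed.

Section fixed_scale.
Variables (p a : R) (H : V -> R) (M : R).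
Hypotheses (p1 : 1 < p) (pa : p < a).
Hypotheses (mH : measurable_fun setT H) (H0 : forall x, 0 <= H x)
  (HM : forall x, H x <= M).
Hypothesis H1 : (\int[mu n]_x (H x `^ p)%:E <= 1)%E.

Let p0 : 0 < p. Proof. exact: lt_trans p1. Qed.
Let a0 : 0 < a. Proof. exact: lt_trans pa. Qed.

(* [H] is split at height [l]: Jensen controls the low part, and the
   averages of the high part are at most [l], so their power [a]
   costs only a factor [l ^ (a - 1)]. *)
Lemma integral_powR_avgc_le (u l : R) : 0 < u -> l = u `^ (- (n%:R / p)) ->
  (\int[mu n]_z (avgc H u z `^ a)%:E <=
   (2 `^ a)%:E * (\int[mu n]_x (if H x <= l then H x `^ a else 0)%:E
    + (l `^ (a - 1))%:E * \int[mu n]_x (if H x <= l then 0 else H x)%:E))%E.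
Proof.
move=> u0 lE.
have l0 : 0 < l by rewrite lE; exact: powR_gt0.
have M0 : 0 <= M by apply: le_trans (HM 0); exact: H0.
have mle : measurable_fun setT (fun x => H x <= l).
  by apply: measurable_fun_ler => //; exact: measurable_cst.
pose F x := if H x <= l then H x else 0.
pose G x := if H x <= l then 0 else H x.
have mF : measurable_fun setT F by apply: measurable_fun_ifT => //; exact: measurable_cst.
have mG : measurable_fun setT G by apply: measurable_fun_ifT => //; exact: measurable_cst.
have F0 x : 0 <= F x by rewrite /F; case: ifP.
have G0 x : 0 <= G x by rewrite /G; case: ifP.
have FM x : F x <= M by rewrite /F; case: ifP.
have GM x : G x <= M by rewrite /G; case: ifP.
have Q0 : 0 < (2 * u) ^+ n by rewrite exprn_gt0// mulr_gt0.
have split z : avgc H u z = avgc F u z + avgc G u z.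
  apply: EFin_inj; rewrite EFinD.
  rewrite (avgcE z (ltW u0) mH H0 HM) (avgcE z (ltW u0) mF F0 FM) (avgcE z (ltW u0) mG G0 GM).
  rewrite -ge0_muleDr; last 2 first.
  - by apply: integral_ge0 => x _; rewrite lee_fin mulr_ge0// chi_ge0.
  - by apply: integral_ge0 => x _; rewrite lee_fin mulr_ge0// chi_ge0.
  congr (_ * _)%E; rewrite -ge0_integralD//; last 4 first.
  - by move=> x _; rewrite lee_fin mulr_ge0// chi_ge0.
  - by apply/measurable_EFinP; apply: measurable_funM => //; exact: measurable_chi_fst.
  - by move=> x _; rewrite lee_fin mulr_ge0// chi_ge0.
  - by apply/measurable_EFinP; apply: measurable_funM => //; exact: measurable_chi_fst.
  apply: eq_integral => x _; rewrite -EFinD -mulrDr; congr (_ * _)%:E.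
  by rewrite /F /G; case: ifP; rewrite ?addr0 ?add0r.
have mavF : measurable_fun setT (fun z => avgc F u z).
  by apply: measurable_avgc => //; exact: measurable_cst.
have mavG : measurable_fun setT (fun z => avgc G u z).
  by apply: measurable_avgc => //; exact: measurable_cst.
have mavFa : measurable_fun setT (fun z => avgc F u z `^ a).
  exact: measurable_powR_comp.
have mavGa : measurable_fun setT (fun z => avgc G u z `^ a).
  exact: measurable_powR_comp.
(* Where H exceeds l one has H <= l^(1-p) H^p, and H^p has integral at most 1, so the average is at
   most u^(-n) l^(1-p). The height u^(-n/p) is the one for which this equals l. *)
have avG z : avgc G u z <= l.
  rewrite -lee_fin (avgcE z (ltW u0) mG G0 GM).
  apply: (@le_trans _ _ ((((2 * u) ^+ n)^-1)%:E * ((l `^ (1 - p))%:E * \int[mu n]_x (H x `^ p)%:E)))%E.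
    rewrite lee_pmul2l// ?lte_fin ?invr_gt0//.
    rewrite -ge0_integralZl//; last 3 first.
    - apply/measurable_EFinP; exact: measurable_powR_comp.
    - by move=> x _; rewrite lee_fin powR_ge0.
    - by rewrite lee_fin powR_ge0.
    apply: ge0_le_integral => //.
    - by move=> x _; rewrite lee_fin mulr_ge0// chi_ge0.
    - by apply/measurable_EFinP; apply: measurable_funM => //; exact: measurable_chi_fst.
    - apply/measurable_EFinP; apply: measurable_funM; first exact: measurable_cst.
      exact: measurable_powR_comp.
    - move=> x _; rewrite -EFinM lee_fin.
      apply: (@le_trans _ _ (G x)).
        by rewrite ler_piMl// /chi indicE; case: (_ \in _).
      rewrite /G; case: ifPn => [_|]; first by rewrite mulr_ge0// powR_ge0.
      rewrite -ltNge => lH.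
      have Hx0 : 0 < H x by exact: lt_trans lH.
      rewrite -[in leLHS](powRr1 (H0 x)) -[in leLHS](subrK p 1) addrC.
      rewrite powRD; last by rewrite (gt_eqF Hx0) implybT.
      rewrite mulrC ler_wpM2r ?powR_ge0// -opprB !powRN lef_pV2 ?posrE ?powR_gt0//.
      by apply: ge0_ler_powR; rewrite ?nnegrE ?subr_ge0 ?ltW.
  apply: (@le_trans _ _ ((((2 * u) ^+ n)^-1)%:E * ((l `^ (1 - p))%:E * 1)))%E.
    by rewrite !lee_pmul2l// ?lte_fin ?invr_gt0 ?powR_gt0.
  rewrite mule1 -EFinM lee_fin.
  apply: (@le_trans _ _ ((u ^+ n)^-1 * l `^ (1 - p))).
    rewrite ler_wpM2r ?powR_ge0// lef_pV2 ?posrE ?exprn_gt0// ?mulr_gt0//.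
    by rewrite lerXn2r ?nnegrE ?mulr_ge0 ?(ltW u0)// ler_peMl ?ler1n// ltW.
  rewrite -powR_invn ?(ltW u0)// lE -powRrM -powRD; last by rewrite (gt_eqF u0) implybT.
  suff -> : - n%:R + - (n%:R / p) * (1 - p) = - (n%:R / p) by [].
  by field; rewrite gt_eqF.
apply: (@le_trans _ _ (\int[mu n]_z ((2 `^ a)%:E * ((avgc F u z `^ a)%:E + (avgc G u z `^ a)%:E)))%E).
  apply: ge0_le_integral => //.
  - by move=> z _; rewrite lee_fin powR_ge0.
  - apply/measurable_EFinP; apply: measurable_powR_comp.
    by apply: measurable_avgc => //; exact: measurable_cst.
  - apply/measurable_EFinP; apply: measurable_funM; first exact: measurable_cst.
    exact: (measurable_funD mavFa mavGa).
  - move=> z _; rewrite -EFinD -EFinM lee_fin split.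
    by apply: powRD_le => //; apply: avgc_ge0 => //; exact: ltW.
rewrite ge0_integralZl//; last 2 first.
- by apply/measurable_EFinP; exact: (measurable_funD mavFa mavGa).
- by move=> z _; rewrite -EFinD lee_fin addr_ge0// powR_ge0.
rewrite lee_pmul2l// ?lte_fin ?powR_gt0//.
rewrite ge0_integralD//; last 4 first.
- by move=> z _; rewrite lee_fin powR_ge0.
- by apply/measurable_EFinP; exact: mavFa.
- by move=> z _; rewrite lee_fin powR_ge0.
- by apply/measurable_EFinP; exact: mavGa.
apply: leeD.
  have mFa : measurable_fun setT (fun x => F x `^ a).
    exact: measurable_powR_comp.
  have FaM x : F x `^ a <= M `^ a.
    by apply: ge0_ler_powR; rewrite ?nnegrE// ltW.
  apply: (@le_trans _ _ (\int[mu n]_z (avgc (fun x => F x `^ a) u z)%:E)%E).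
    apply: ge0_le_integral => //.
    - by move=> z _; rewrite lee_fin powR_ge0.
    - by apply/measurable_EFinP; exact: mavFa.
    - apply/measurable_EFinP; apply: measurable_avgc => //.
      by move=> x; exact: powR_ge0.
    - move=> z _; rewrite lee_fin; apply: (avgc_jensen z u0 _ mF F0 FM).
      exact: lt_trans pa.
  rewrite (@integral_avgc (fun x => F x `^ a) _ u u0 mFa (fun x => powR_ge0 _ _) FaM).
  rewrite le_eqVlt; apply/orP; left; apply/eqP; apply: eq_integral => x _.
  by congr EFin; rewrite /F; case: ifP => // _; rewrite powR0// gt_eqF.
rewrite -(integral_avgc u0 mG G0 GM) -ge0_integralZl//; last 3 first.
- by apply/measurable_EFinP; exact: mavG.
- by move=> z _; rewrite lee_fin avgc_ge0// ltW.
- by rewrite lee_fin powR_ge0.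
apply: ge0_le_integral => //.
- by move=> z _; rewrite lee_fin powR_ge0.
- by apply/measurable_EFinP; exact: mavGa.
- by apply/measurable_EFinP; apply: (measurable_funM _ mavG); exact: measurable_cst.
- move=> z _; rewrite -EFinM lee_fin.
  have A0 : 0 <= avgc G u z by apply: avgc_ge0 => //; exact: ltW.
  rewrite -(mulr_powRB1 A0 a0) mulrC ler_wpM2r//.
  apply: ge0_ler_powR; rewrite ?nnegrE ?(ltW l0)//.
  by rewrite subr_ge0 ltW// (lt_trans p1).
Qed.

End fixed_scale.

Lemma measurable_fun_mem d (T : measurableType d) (D : set T) :
  measurable D -> measurable_fun setT (fun x => x \in D).
Proof.
move=> mD; apply: (measurable_fun_bool true); rewrite setTI.
by rewrite (_ : _ @^-1` _ = D)//; apply/seteqP; split => x /=; [move/set_mem|move/mem_set].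
Qed.

(* Set to 0 for [u <= 0], so that integrals over the whole line run over [`]0, +oo[`]. *)
Definition wpow (c u : R) : R := if 0 < u then u `^ c else 0.

Lemma wpow_ge0 c u : 0 <= wpow c u.
Proof. by rewrite /wpow; case: ifP => // _; exact: powR_ge0. Qed.

Lemma measurable_wpow d (T : measurableType d) (f : T -> R) c :
  measurable_fun setT f -> measurable_fun setT (fun t => wpow c (f t)).
Proof.
move=> mf; apply: measurable_fun_ifT; last exact: measurable_cst.
  by apply: measurable_fun_ltr => //; exact: measurable_cst.
exact: measurable_powR_comp.
Qed.

Lemma powR_anti (x y c : R) : 0 < x -> x <= y -> 0 <= c -> y `^ (- c) <= x `^ (- c).
Proof.
move=> x0 xy c0; have y0 : 0 < y by exact: lt_le_trans xy.
rewrite !powRN lef_pV2 ?posrE ?powR_gt0//.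
by apply: ge0_ler_powR; rewrite ?nnegrE// ltW.
Qed.

Lemma integral_wpow_itv (c h : R) (P : set R) : measurable P -> P `<=` `]0, +oo[ -> 0 <= h ->
  (\int[leb]_u (if u \in P then wpow c u * h else 0)%:E =
   h%:E * \int[leb]_(u in P) (u `^ c)%:E)%E.
Proof.
move=> mP P0 h0.
have mf : measurable_fun P (fun u : R => (u `^ c)%:E).
  by apply/measurable_EFinP; exact: measurable_fun_powR.
rewrite -ge0_integralZl//; last first.
  by move=> u _; rewrite lee_fin powR_ge0.
rewrite [RHS]integral_mkcond; apply: eq_integral => u _.
rewrite patchE; case: ifPn => // /set_mem uP.
have := P0 _ uP; rewrite /= in_itv/= andbT => u0.
by rewrite /wpow u0 -EFinM mulrC.
Qed.

Section scale_integrals.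
Variables (p a : R).
Hypotheses (n0 : (0 < n)%N) (p1 : 1 < p) (pa : p < a).
Let p0 : 0 < p. Proof. exact: lt_trans p1. Qed.
Let a0 : 0 < a. Proof. exact: lt_trans pa. Qed.
Let nR : 0 < n%:R :> R. Proof. by rewrite ltr0n. Qed.
(** [al] is positive because p < a, [be] because 1 < p: they give convergence at small and at large
    scales respectively. They are tied by al - (n/p)(a - 1) = - be. *)
Let al : R := n%:R * (a / p - 1).
Let be : R := n%:R * (1 - p^-1).
Let al0 : 0 < al.
Proof. by rewrite mulr_gt0// subr_gt0 ltr_pdivlMr// mul1r. Qed.
Let be0 : 0 < be.
Proof. by rewrite mulr_gt0// subr_gt0 invf_lt1. Qed.

(** For h > 0 the condition restricts u to at most h^(-p/n), and the integral of u^(al-1) up to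
    there is h^(p-a)/al. *)
Lemma scale_integral_small (h : R) : 0 <= h ->
  (\int[leb]_u (wpow (al - 1) u * (if h <= u `^ (- (n%:R / p)) then h `^ a else 0))%:E
   <= (al^-1 * h `^ p)%:E)%E.
Proof.
rewrite le_eqVlt => /predU1P[<-|h0].
  rewrite !powR0 ?gt_eqF// mulr0; under eq_integral do rewrite if_same mulr0.
  by rewrite integral0.
pose X := h `^ (- (p / n%:R)).
have X0 : 0 < X by exact: powR_gt0.
have mP : measurable (`]0, X] : set R) by exact: measurable_itv.
apply: (@le_trans _ _ (\int[leb]_u (if u \in (`]0, X]%classic : set R) then wpow (al - 1) u * h `^ a else 0)%:E))%E.
  apply: ge0_le_integral => //.
  - by move=> u _; rewrite lee_fin mulr_ge0 ?wpow_ge0//; case: ifP => // _; exact: powR_ge0.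
  - apply/measurable_EFinP; apply: measurable_funM; first exact: measurable_wpow.
    apply: measurable_fun_ifT; [|exact: measurable_cst|exact: measurable_cst].
    by apply: measurable_fun_ler; [exact: measurable_cst|exact: measurable_fun_powR].
  - apply/measurable_EFinP; apply: measurable_fun_ifT => //; last by apply: measurable_funM => //; exact: measurable_wpow.
    exact: measurable_fun_mem.
  - move=> u _; rewrite lee_fin; case: (boolP (u \in (`]0, X]%classic : set R))) => [_|/negP uX].
      by rewrite ler_wpM2l ?wpow_ge0//; case: ifP => // _; exact: powR_ge0.
    rewrite /wpow; case: ifPn => [u0|]; last by rewrite mul0r.
    case: ifPn => [hu|]; last by rewrite mulr0.
    exfalso; apply: uX; rewrite inE/= in_itv/= u0/=.
    have : (u `^ (- (n%:R / p))) `^ (- (p / n%:R)) <= X.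
      by apply: powR_anti => //; rewrite divr_ge0// ltW.
    rewrite -powRrM mulrNN (_ : n%:R / p * (p / n%:R) = 1) ?powRr1 ?(ltW u0)//.
    by field; rewrite !gt_eqF.
rewrite integral_wpow_itv//; last 2 first.
- by move=> u /=; rewrite !in_itv/= => /andP[->].
- exact: powR_ge0.
apply: (@le_trans _ _ ((h `^ a)%:E * (X `^ al / al)%:E))%E.
  by rewrite lee_pmul2l ?lte_fin ?powR_gt0//; exact: integral_powR0_le.
rewrite -EFinM lee_fin /X -powRrM mulrA mulrC -powRD; last by rewrite (gt_eqF h0) implybT.
suff -> : a + - (p / n%:R) * al = p by [].
by rewrite /al; field; rewrite !gt_eqF.
Qed.

(** The complementary range: beyond h^(-p/n) the integral of u^(-be-1) is h^(p-1)/be. *)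
Lemma scale_integral_large (h : R) : 0 <= h ->
  (\int[leb]_u (wpow (- be - 1) u * (if h <= u `^ (- (n%:R / p)) then 0 else h))%:E
   <= (be^-1 * h `^ p)%:E)%E.
Proof.
rewrite le_eqVlt => /predU1P[<-|h0].
  rewrite powR0 ?gt_eqF// mulr0; under eq_integral do rewrite if_same mulr0.
  by rewrite integral0.
pose X := h `^ (- (p / n%:R)).
have X0 : 0 < X by exact: powR_gt0.
have mP : measurable (`]X, +oo[ : set R) by exact: measurable_itv.
apply: (@le_trans _ _ (\int[leb]_u (if u \in (`]X, +oo[%classic : set R) then wpow (- be - 1) u * h else 0)%:E))%E.
  apply: ge0_le_integral => //.
  - by move=> u _; rewrite lee_fin mulr_ge0 ?wpow_ge0//; case: ifP => // _; exact: ltW.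
  - apply/measurable_EFinP; apply: measurable_funM; first exact: measurable_wpow.
    apply: measurable_fun_ifT; [|exact: measurable_cst|exact: measurable_cst].
    by apply: measurable_fun_ler; [exact: measurable_cst|exact: measurable_fun_powR].
  - apply/measurable_EFinP; apply: measurable_fun_ifT => //; last by apply: measurable_funM => //; exact: measurable_wpow.
    exact: measurable_fun_mem.
  - move=> u _; rewrite lee_fin; case: (boolP (u \in (`]X, +oo[%classic : set R))) => [_|/negP uX].
      by rewrite ler_wpM2l ?wpow_ge0//; case: ifP => // _; exact: ltW.
    rewrite /wpow; case: ifPn => [u0|]; last by rewrite mul0r.
    case: ifPn => [hu|/negP hu]; first by rewrite mulr0.
    exfalso; apply: hu.
    have uX' : u <= X.
      by rewrite leNgt; apply/negP => Xu; apply: uX; rewrite inE/= in_itv/= Xu.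
    have : X `^ (- (n%:R / p)) <= u `^ (- (n%:R / p)).
      by apply: powR_anti => //; rewrite divr_ge0// ltW.
    rewrite /X -powRrM mulrNN (_ : p / n%:R * (n%:R / p) = 1) ?powRr1 ?(ltW h0)//.
    by field; rewrite !gt_eqF.
rewrite integral_wpow_itv//; last 2 first.
- by move=> u /=; rewrite !in_itv/= !andbT; exact: lt_trans.
- exact: ltW.
rewrite integral_powRy// -EFinM lee_fin /X -powRrM mulrA mulrC.
rewrite -[in leLHS](powRr1 (ltW h0)) -powRrM mul1r -powRD; last by rewrite (gt_eqF h0) implybT.
suff -> : 1 + - (p / n%:R) * - be = p by [].
by rewrite /be; field; rewrite !gt_eqF.
Qed.

(** Interpolation in the manner of Marcinkiewicz, with the scale as the variable that moves the cut.
    After the estimate at a fixed scale, Tonelli puts the integral over scales inside, where at each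
    point x it is one of the two integrals just computed, a multiple of H(x)^p. *)
Lemma scale_sum_le (H : V -> R) (M : R) :
  measurable_fun setT H -> (forall x, 0 <= H x) -> (forall x, H x <= M) ->
  (\int[mu n]_x (H x `^ p)%:E <= 1)%E ->
  (\int[leb]_u \int[mu n]_z (wpow (n%:R * (a / p - 1) - 1) u * avgc H u z `^ a)%:E
   <= (2 `^ a * (al^-1 + be^-1))%:E)%E.
Proof.
move=> mH H0 HM H1; rewrite -/al.
pose l (u : R) := u `^ (- (n%:R / p)).
pose S u x := if H x <= l u then H x `^ a else 0.
pose L u x := if H x <= l u then 0 else H x.
have S0 u x : 0 <= S u x by rewrite /S; case: ifP => // _; exact: powR_ge0.
have L0 u x : 0 <= L u x by rewrite /L; case: ifP.
have mcond : measurable_fun [set: measurableTypeR R * V] (fun q => H q.2 <= l q.1).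
  apply: measurable_fun_ler; first exact: measurableT_comp.
  by apply: measurable_powR_comp; exact: measurable_fst.
have mS : measurable_fun [set: measurableTypeR R * V] (fun q => S q.1 q.2).
  apply: measurable_fun_ifT => //; apply: measurable_powR_comp; exact: measurableT_comp.
have mL : measurable_fun [set: measurableTypeR R * V] (fun q => L q.1 q.2).
  apply: measurable_fun_ifT => //; exact: measurableT_comp.
have mw c : measurable_fun [set: measurableTypeR R * V] (fun q => wpow c q.1).
  by apply: measurable_wpow; exact: measurable_fst.
have mS1 u : measurable_fun [set: V] (S u).
  apply: measurable_fun_ifT => //; last exact: measurable_powR_comp.
  by apply: measurable_fun_ler => //; exact: measurable_cst.
have mL1 u : measurable_fun [set: V] (L u).
  apply: measurable_fun_ifT => //.
  by apply: measurable_fun_ler => //; exact: measurable_cst.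
pose FS (q : measurableTypeR R * V) := (wpow (al - 1) q.1 * S q.1 q.2)%:E.
pose FL (q : measurableTypeR R * V) := (wpow (- be - 1) q.1 * L q.1 q.2)%:E.
have mFS : measurable_fun setT FS by apply/measurable_EFinP; exact: measurable_funM.
have mFL : measurable_fun setT FL by apply/measurable_EFinP; exact: measurable_funM.
have FS0 q : (0 <= FS q)%E by rewrite lee_fin mulr_ge0// wpow_ge0.
have FL0 q : (0 <= FL q)%E by rewrite lee_fin mulr_ge0// wpow_ge0.
have H1p k : 0 < k -> (\int[mu n]_x (k^-1 * H x `^ p)%:E <= (k^-1)%:E)%E.
  move=> k0; under eq_integral do rewrite EFinM.
  rewrite ge0_integralZl//; last 3 first.
  - by apply/measurable_EFinP; exact: measurable_powR_comp.
  - by move=> x _; rewrite lee_fin powR_ge0.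
  - by rewrite lee_fin invr_ge0 ltW.
  by rewrite -[leRHS]mule1 lee_pmul2l// lte_fin invr_gt0.
have mpow k : measurable_fun setT (fun x => (k^-1 * H x `^ p)%:E).
  apply/measurable_EFinP; apply: measurable_funM; first exact: measurable_cst.
  exact: measurable_powR_comp.
have hS : (\int[leb]_u \int[mu n]_x FS (u, x) <= (al^-1)%:E)%E.
  rewrite (@fubini_tonelli _ _ _ _ _ leb (mu n) FS)//.
  apply: le_trans (H1p _ al0); apply: ge0_le_integral => //.
  - by move=> x _; exact: integral_ge0.
  - exact: (@measurable_fun_fubini_tonelli_G _ _ (measurableTypeR R) _ R leb FS).
  - move=> x _; apply: le_trans (scale_integral_small (H0 x)).
    by rewrite le_eqVlt; apply/orP; left; apply/eqP; exact: eq_integral.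
have hL : (\int[leb]_u \int[mu n]_x FL (u, x) <= (be^-1)%:E)%E.
  rewrite (@fubini_tonelli _ _ _ _ _ leb (mu n) FL)//.
  apply: le_trans (H1p _ be0); apply: ge0_le_integral => //.
  - by move=> x _; exact: integral_ge0.
  - exact: (@measurable_fun_fubini_tonelli_G _ _ (measurableTypeR R) _ R leb FL).
  - move=> x _; apply: le_trans (scale_integral_large (H0 x)).
    by rewrite le_eqVlt; apply/orP; left; apply/eqP; exact: eq_integral.
have mFSi := @measurable_fun_fubini_tonelli_F _ _ (measurableTypeR R) _ R (mu n) FS mFS FS0.
have mFLi := @measurable_fun_fubini_tonelli_F _ _ (measurableTypeR R) _ R (mu n) FL mFL FL0.
apply: (@le_trans _ _ (\int[leb]_u ((2 `^ a)%:E * (\int[mu n]_x FS (u, x) + \int[mu n]_x FL (u, x)))))%E.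
  apply: ge0_le_integral => //.
  - by move=> u _; apply: integral_ge0 => z _; rewrite lee_fin mulr_ge0 ?wpow_ge0 ?powR_ge0.
  - apply: (@measurable_fun_fubini_tonelli_F _ _ (measurableTypeR R) _ R (mu n)
      (fun q : measurableTypeR R * V => (wpow (al - 1) q.1 * avgc H q.1 q.2 `^ a)%:E)).
      apply/measurable_EFinP; apply: measurable_funM => //.
      by apply: measurable_powR_comp; apply: measurable_avgc.
    by move=> q; rewrite lee_fin mulr_ge0 ?wpow_ge0 ?powR_ge0.
  - by apply: measurable_funeM; exact: emeasurable_funD.
  - move=> u _.
    have [u0|u0] := ltP 0 u; last first.
      rewrite integral0_eq; last by move=> z _; rewrite /wpow ltNge u0/= mul0r.
      by rewrite mule_ge0 ?lee_fin ?powR_ge0// adde_ge0// integral_ge0.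
    have w0 : 0 < wpow (al - 1) u by rewrite /wpow u0 powR_gt0.
    have mav : measurable_fun setT (fun z => (avgc H u z `^ a)%:E).
      apply/measurable_EFinP; apply: measurable_powR_comp.
      by apply: measurable_avgc => //; exact: measurable_cst.
    under eq_integral do rewrite EFinM.
    rewrite ge0_integralZl//; last 2 first.
    - by move=> z _; rewrite lee_fin powR_ge0.
    - by rewrite lee_fin ltW.
    have := integral_powR_avgc_le p1 pa mH H0 HM H1 u0 erefl.
    rewrite -(lee_pmul2l (x := (wpow (al - 1) u)%:E))// ?lte_fin// => /le_trans; apply.
    rewrite muleCA lee_pmul2l ?lte_fin ?powR_gt0//.
    rewrite ge0_muleDr; last 2 first.
    - by apply: integral_ge0 => x _; rewrite lee_fin; exact: (S0 u).
    - rewrite mule_ge0 ?lee_fin ?powR_ge0//.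
      by apply: integral_ge0 => x _; rewrite lee_fin; exact: (L0 u).
    rewrite muleA -EFinM.
    (* The factor l^(a-1) in front of the high part converts the weight suited to the low part into
       the one suited to the high part. *)
    have -> : wpow (al - 1) u * (u `^ (- (n%:R / p))) `^ (a - 1) = wpow (- be - 1) u.
      rewrite /wpow u0 -powRrM -powRD; last by rewrite (gt_eqF u0) implybT.
      congr (_ `^ _); rewrite /al /be; field; rewrite !gt_eqF//.
    have EFS : (\int[mu n]_x FS (u, x) = (wpow (al - 1) u)%:E * \int[mu n]_x (S u x)%:E)%E.
      rewrite -[RHS]ge0_integralZl//.
      - by apply/measurable_EFinP; exact: mS1.
      - by move=> x _; rewrite lee_fin.
      - by rewrite lee_fin wpow_ge0.
    have EFL : (\int[mu n]_x FL (u, x) = (wpow (- be - 1) u)%:E * \int[mu n]_x (L u x)%:E)%E.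
      rewrite -[RHS]ge0_integralZl//.
      - by apply/measurable_EFinP; exact: mL1.
      - by move=> x _; rewrite lee_fin.
      - by rewrite lee_fin wpow_ge0.
    by rewrite EFS EFL.
rewrite ge0_integralZl//; last 2 first.
- exact: emeasurable_funD.
- by move=> u _; rewrite adde_ge0// integral_ge0.
rewrite EFinM lee_pmul2l ?lte_fin ?powR_gt0//.
rewrite ge0_integralD//; first by rewrite EFinD leeD.
- by move=> u _; exact: integral_ge0.
- by move=> u _; exact: integral_ge0.
Qed.

End scale_integrals.
End scale_sum.

(** * Bounded measurable functions and their integrals over cubes *)

Section bounded_measurable.
Context {R : realType} {d : measure_display} {T : measurableType d}.

Definition bm (h : T -> R) := measurable_fun setT h /\ exists M, forall x, `|h x| <= M.

Lemma bm_cst c : bm (fun=> c).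
Proof. by split; [exact: measurable_cst|exists `|c|]. Qed.

Lemma bmD f g : bm f -> bm g -> bm (fun x => f x + g x).
Proof.
move=> [mf [M fM]] [mg [N gN]]; split; first exact: measurable_funD.
by exists (M + N) => x; rewrite (le_trans (ler_normD _ _))// lerD.
Qed.

Lemma bmM f g : bm f -> bm g -> bm (fun x => f x * g x).
Proof.
move=> [mf [M fM]] [mg [N gN]]; split; first exact: measurable_funM.
by exists (M * N) => x; rewrite normrM ler_pM.
Qed.

Lemma bmN f : bm f -> bm (fun x => - f x).
Proof.
move=> [mf [M fM]]; split; first exact: measurable_funN.
by exists M => x; rewrite normrN.
Qed.

Lemma bmB f g : bm f -> bm g -> bm (fun x => f x - g x).
Proof. by move=> bf bg; apply: bmD => //; exact: bmN. Qed.

Lemma bm_norm f : bm f -> bm (fun x => `|f x|).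
Proof.
move=> [mf [M fM]]; split; first exact: measurableT_comp.
by exists M => x; rewrite normr_id.
Qed.

Lemma bm_powR f t : 0 <= t -> bm f -> bm (fun x => `|f x| `^ t).
Proof.
move=> t0 [mf [M fM]]; split.
  by apply: measurable_powR_comp; exact: measurableT_comp.
exists (M `^ t) => x; rewrite ger0_norm ?powR_ge0//.
by apply: ge0_ler_powR; rewrite ?nnegrE//; exact: le_trans (fM x).
Qed.

End bounded_measurable.

Section cube_integral.
Context {R : realType} (n : nat).
Local Notation V := 'rV[R]_n.

Definition cI (z : V) (u : R) (h : V -> R) : R := \int[mu n]_x (chi z u x * h x).

Lemma integrable_chi z (u : R) h : 0 <= u -> bm h ->
  (mu n).-integrable setT (EFin \o (fun x => chi z u x * h x)).
Proof.
move=> u0 [mh [M hM]].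
have M0 : 0 <= M by apply: le_trans (hM 0).
have mc := measurable_chi_fst z u.
apply/integrableP; split.
  by apply/measurable_EFinP; exact: measurable_funM.
apply: (@le_lt_trans _ _ (\int[mu n]_x (chi z u x * `|h x|)%:E)%E).
  rewrite le_eqVlt; apply/orP; left; apply/eqP; apply: eq_integral => x _.
  by rewrite /= normrM (ger0_norm (chi_ge0 _ _ _)).
apply: (le_lt_trans (chi_integral_le z u0 _ _ hM)) (ltry _) => //.
exact: measurableT_comp.
Qed.

Lemma cID z u f g : 0 <= u -> bm f -> bm g ->
  cI z u (fun x => f x + g x) = cI z u f + cI z u g.
Proof.
move=> u0 bf bg; rewrite /cI -RintegralD//; try exact: integrable_chi.
by apply: eq_Rintegral => x _; rewrite mulrDr.
Qed.

Lemma cIZ z u k f : 0 <= u -> bm f -> cI z u (fun x => k * f x) = k * cI z u f.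
Proof.
move=> u0 bf; rewrite /cI -RintegralZl//; last exact: integrable_chi.
by apply: eq_Rintegral => x _; rewrite mulrCA.
Qed.

Lemma cI_cst z u c : 0 <= u -> cI z u (fun=> c) = c * (2 * u) ^+ n.
Proof.
move=> u0; have -> : (fun _ : V => c) = (fun x => c * 1) by apply/funext => x; rewrite mulr1.
rewrite cIZ//; last exact: bm_cst.
congr (_ * _); rewrite /cI /Rintegral.
by under eq_integral do rewrite mulr1; rewrite integral_chi.
Qed.

Lemma cI_le z u f g : 0 <= u -> bm f -> bm g ->
  (forall x, cube z u x -> f x <= g x) -> cI z u f <= cI z u g.
Proof.
move=> u0 bf bg fg; apply: le_Rintegral => //; try exact: integrable_chi.
move=> x _; rewrite /chi indicE; case: (boolP (x \in _)) => [/set_mem xz|_]; last by rewrite !mul0r.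
by rewrite !mul1r fg.
Qed.

Lemma cI_ge0 z u f : (forall x, 0 <= f x) -> 0 <= cI z u f.
Proof. exact: Rintegral_chi_ge0. Qed.

Lemma cI_norm z u f : 0 <= u -> bm f -> `|cI z u f| <= cI z u (fun x => `|f x|).
Proof.
move=> u0 bf; apply: le_trans (le_normr_Rintegral _ _) _ => //; first exact: integrable_chi.
rewrite le_eqVlt; apply/orP; left; apply/eqP; apply: eq_Rintegral => x _.
by rewrite normrM (ger0_norm (chi_ge0 _ _ _)).
Qed.

Definition child (z : V) (u : R) (e : {ffun 'I_n -> bool}) : V :=
  \row_i (z ord0 i + (if e i then u / 2 else - (u / 2))).

(** In each coordinate a half-open interval is the disjoint union of its halves; distributing the
    product over these sums gives one term for each choice of signs. *)
Lemma chi_split z u x : 0 <= u ->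
  chi z u x = \sum_(e : {ffun 'I_n -> bool}) chi (child z u e) (u / 2) x.
Proof.
move=> u0; rewrite chiE.
under eq_bigr => i _.
  have -> : (if (z ord0 i - u <= x ord0 i) && (x ord0 i < z ord0 i + u) then 1 else 0 : R) =
    \sum_(c : bool) (if (z ord0 i + (if c then u / 2 else - (u / 2)) - u / 2 <= x ord0 i) &&
      (x ord0 i < z ord0 i + (if c then u / 2 else - (u / 2)) + u / 2) then 1 else 0).
    rewrite big_bool/=.
    have [h1|h1] := leP (z ord0 i - u) (x ord0 i); have [h2|h2] := ltP (x ord0 i) (z ord0 i + u);
    have [h3|h3] := leP (z ord0 i) (x ord0 i).
    - rewrite /= addrK h3 /= (_ : (x ord0 i < z ord0 i + u / 2 + u / 2) = true); last by apply/idP; lra.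
      rewrite (_ : (x ord0 i < z ord0 i - u / 2 + u / 2) = false) ?andbF ?addr0//.
      by apply/negbTE; rewrite -leNgt; lra.
    - rewrite /= addrK leNgt h3 /= (_ : (z ord0 i - u / 2 - u / 2 <= x ord0 i) = true); last by apply/idP; lra.
      rewrite (_ : (x ord0 i < z ord0 i - u / 2 + u / 2) = true) ?add0r//.
      by apply/idP; lra.
    - rewrite /= (_ : (x ord0 i < z ord0 i + u / 2 + u / 2) = false) ?andbF; last by apply/negbTE; rewrite -leNgt; lra.
      rewrite (_ : (x ord0 i < z ord0 i - u / 2 + u / 2) = false) ?andbF ?addr0//.
      by apply/negbTE; rewrite -leNgt; lra.
    - by exfalso; move: h1 h2 h3; lra.
    - by exfalso; move: h1 h2 h3; lra.
    - rewrite /= addrK leNgt h3 /= (_ : (z ord0 i - u / 2 - u / 2 <= x ord0 i) = false) ?add0r//.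
      by apply/negbTE; rewrite -ltNge; lra.
    - by exfalso; move: h1 h2 h3; lra.
    - by exfalso; move: h1 h2 h3; lra.
  over.
rewrite bigA_distr_bigA; apply: eq_bigr => e _; rewrite chiE.
by apply: eq_bigr => i _; rewrite mxE.
Qed.

Lemma cI_split z u h : 0 <= u -> bm h ->
  cI z u h = \sum_(e : {ffun 'I_n -> bool}) cI (child z u e) (u / 2) h.
Proof.
move=> u0 bh; have u20 : 0 <= u / 2 by rewrite divr_ge0.
apply: EFin_inj; rewrite -sumEFin.
have E z' v : 0 <= v -> ((cI z' v h)%:E = \int[mu n]_x (chi z' v x * h x)%:E)%E.
  by move=> v0; rewrite fineK//; apply: integrable_fin_num => //; exact: integrable_chi.
rewrite E//; under [RHS]eq_bigr do rewrite E//.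
rewrite -integral_sum//; last by move=> e; exact: integrable_chi.
by apply: eq_integral => x _; rewrite chi_split// mulr_suml sumEFin.
Qed.

End cube_integral.

(** * The John-Nirenberg inequality *)

Section john_nirenberg.
Context {R : realType} (n : nat).
Local Notation V := 'rV[R]_n.
Variables (b : V -> R) (be t dl : R).
Implicit Types (z : V) (u c : R) (e : {ffun 'I_n -> bool}).
Hypotheses (bb : bm b) (be0 : 0 < be) (t0 : 0 < t) (dl0 : 0 < dl).
Local Notation vol u := ((2 * u) ^+ n).

Definition mean (h : V -> R) (z : V) (u : R) : R := ((2 * u) ^+ n)^-1 * cI z u h.

Hypothesis bmo_cube : forall z u, 0 < u -> cI z u (fun x => `|b x - mean b z u|) <= be * vol u.
Hypothesis osc_small : forall z u x y, 0 < u -> u <= dl -> cube z u x -> cube z u y ->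
  `|b x - b y| <= be.

(** [A] is the stopping threshold. On a cube that has just been stopped the mean is within [D] of c,
    as one halving moves it by at most 2^n be. [X] is the bound to be proved and [Y] what it becomes
    after recentring at c. With this [A], be Y / A = (X + D^t)/2, and X = 3 D^t is the fixed point
    of X = D^t + (X + D^t)/2. *)
Let A : R := 2 `^ (t + 1) * be.
Let A0 : 0 < A. Proof. by rewrite mulr_gt0// powR_gt0. Qed.
Let D : R := A + 2 ^+ n * be.
Let D0 : 0 < D. Proof. by rewrite addr_gt0// mulr_gt0// exprn_gt0. Qed.
Let X : R := 3 * D `^ t.
Let Y : R := 2 `^ t * (X + D `^ t).

Let vol0 u : 0 < u -> 0 < vol u :> R.
Proof. by move=> u0; rewrite exprn_gt0// mulr_gt0. Qed.

Let bbc c : bm (fun x => b x - c).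
Proof. by apply: bmB => //; exact: bm_cst. Qed.

Lemma cI_meanE (h : V -> R) z u : 0 < u -> cI z u h = mean h z u * vol u.
Proof. by move=> u0; rewrite /mean mulrAC mulVf ?mul1r// gt_eqF// vol0. Qed.

Lemma cI_sub_cst z u c : 0 < u -> cI z u (fun x => b x - c) = (mean b z u - c) * vol u.
Proof.
move=> u0; rewrite cID ?(ltW u0)//; last exact: bm_cst.
by rewrite cI_cst ?(ltW u0)// cI_meanE// mulrBl mulNr.
Qed.

Lemma mean_dist_le z u c : 0 < u ->
  `|mean b z u - c| * vol u <= cI z u (fun x => `|b x - c|).
Proof.
move=> u0; have := cI_norm z (ltW u0) (bbc c).
by rewrite cI_sub_cst// normrM (gtr0_norm (vol0 u0)).
Qed.

Lemma cI_powR_shift z u c c' : 0 < u ->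
  cI z u (fun x => `|b x - c| `^ t) <=
  2 `^ t * (cI z u (fun x => `|b x - c'| `^ t) + `|c' - c| `^ t * vol u).
Proof.
move=> u0; have u0' := ltW u0.
rewrite -(cI_cst z (`|c' - c| `^ t) u0') -cID//; last 2 first.
- by apply: bm_powR => //; exact: ltW.
- exact: bm_cst.
rewrite -cIZ//; last first.
  by apply: bmD; [apply: bm_powR => //; exact: ltW|exact: bm_cst].
apply: cI_le => //.
- by apply: bm_powR => //; exact: ltW.
- apply: bmM; first exact: bm_cst.
  by apply: bmD; [apply: bm_powR => //; exact: ltW|exact: bm_cst].
move=> x _; apply: le_trans (powRD_le _ _ t0) => //.
apply: ge0_ler_powR; rewrite ?nnegrE ?addr_ge0 ?(ltW t0)//.
by rewrite -[b x - c](subrKA c'); exact: ler_normD.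
Qed.

(** A child has 2^(-n) of the volume of its parent, so averaging the parent's oscillation over the
    child alone costs a factor 2^n. *)
Lemma mean_child z u e : 0 < u -> `|mean b (child z u e) (u / 2) - mean b z u| <= 2 ^+ n * be.
Proof.
move=> u0; have u20 : 0 < u / 2 by rewrite divr_gt0.
rewrite -(ler_pM2r (vol0 u20)).
apply: (le_trans (mean_dist_le _ _ u20)).
have -> : 2 ^+ n * be * vol (u / 2) = be * vol u.
  by rewrite mulrAC -exprMn mulrC; congr (_ * _ ^+ n); field.
apply: le_trans (bmo_cube z u0).
rewrite [leRHS]cI_split ?(ltW u0)//; last exact: bm_norm.
rewrite (bigD1 e)//= lerDl; apply: sumr_ge0 => e' _.
by apply: cI_ge0 => x.
Qed.

(** At scales up to [dl] the function stays within [be] of its mean everywhere on the cube, so the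
    bound is pointwise. *)
Lemma cI_small z u c : 0 < u -> u <= dl -> `|mean b z u - c| <= A ->
  cI z u (fun x => `|b x - c| `^ t) <= (A + be) `^ t * vol u.
Proof.
move=> u0 ud hA; have u0' := ltW u0.
rewrite -(cI_cst z _ u0'); apply: cI_le => //; first 2 last.
- move=> x xz; apply: ge0_ler_powR; rewrite ?nnegrE ?addr_ge0 ?(ltW t0) ?(ltW A0) ?(ltW be0)//.
  have : `|b x - mean b z u| <= be.
    rewrite distrC -(ler_pM2r (vol0 u0)).
    apply: (le_trans (mean_dist_le _ _ u0)).
    rewrite -(cI_cst z _ u0'); apply: cI_le => //.
    + exact: bm_norm.
    + exact: bm_cst.
    + by move=> y yz; exact: osc_small yz xz.
  have := ler_normD (b x - mean b z u) (mean b z u - c).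
  rewrite subrKA; lra.
- by apply: bm_powR => //; exact: ltW.
- exact: bm_cst.
Qed.

(** The induction is on the number of doublings above the scale [dl]; the constant [X] is the same
    for every [N]. *)
Let G (N : nat) := forall z u, 0 < u -> u <= 2 ^+ N * dl ->
  cI z u (fun x => `|b x - mean b z u| `^ t) <= X * vol u.

Let X_ge : (A + be) `^ t <= D `^ t.
Proof.
apply: ge0_ler_powR; rewrite ?nnegrE ?(ltW t0) ?(ltW D0) ?addr_ge0 ?(ltW A0) ?(ltW be0)//.
by rewrite lerD2l ler_peMl ?(ltW be0)// exprn_ege1// ler1n.
Qed.

Let G0 : G 0.
Proof.
move=> z u u0; rewrite expr0 mul1r => ud.
apply: (le_trans (cI_small u0 ud _)); first by rewrite subrr normr0 ltW.
rewrite ler_wpM2r ?(ltW (vol0 _))//; apply: (le_trans X_ge).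
by rewrite /X ler_peMl ?powR_ge0// ler1n.
Qed.

(* A Calderon-Zygmund stopping time: halve the cube until its mean is [A]-far from [c],
   and use [G N] on the cubes so selected, whose total volume Chebyshev bounds. The base
   case is the scale [dl], below which [b] hardly oscillates. *)
Let stopping N m : G N -> (m <= N.+1)%N -> forall z u c, 0 < u -> u <= 2 ^+ m * dl ->
  `|mean b z u - c| <= A ->
  cI z u (fun x => `|b x - c| `^ t) <=
  (A + be) `^ t * vol u + Y / A * cI z u (fun x => `|b x - c|).
Proof.
move=> GN; elim: m => [|m IH] mN z u c u0 um hA.
  rewrite expr0 mul1r in um.
  apply: (le_trans (cI_small u0 um hA)); rewrite lerDl mulr_ge0//.
    by rewrite divr_ge0 ?(ltW A0)// mulr_ge0 ?addr_ge0 ?powR_ge0// mulr_ge0 ?powR_ge0.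
  by apply: cI_ge0 => x.
have u0' := ltW u0; have u20 : 0 < u / 2 by rewrite divr_gt0.
have um2 : u / 2 <= 2 ^+ m * dl.
  by rewrite ler_pdivrMr// mulrAC -exprSr.
(* Children of the initial cube are already in the range of [G N]; this is where [m <= N.+1] is
   used. *)
have uN : u / 2 <= 2 ^+ N * dl.
  by apply: (le_trans um2); rewrite ler_pM2r// ler_eXn2l ?ltr1n.
rewrite (cI_split _ u0'); last by apply: bm_powR => //; exact: ltW.
rewrite (cI_split _ u0'); last exact: bm_norm.
have -> : (A + be) `^ t * vol u = \sum_(e : {ffun 'I_n -> bool}) (A + be) `^ t * vol (u / 2).
  rewrite -(cI_cst z _ u0') (cI_split _ u0'); last exact: bm_cst.
  by apply: eq_bigr => e _; rewrite cI_cst// ltW.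
rewrite mulr_sumr -big_split/=; apply: ler_sum => e _.
have [hc|hc] := leP `|mean b (child z u e) (u / 2) - c| A.
  by apply: IH => //; exact: ltnW.
apply: (@le_trans _ _ (Y * vol (u / 2))).
  apply: (le_trans (cI_powR_shift _ c (mean b (child z u e) (u / 2)) u20)).
  rewrite /Y -mulrA ler_pM2l ?powR_gt0// [leRHS]mulrDl; apply: lerD.
    exact: GN.
  rewrite ler_pM2r ?vol0//; apply: ge0_ler_powR; rewrite ?nnegrE ?(ltW t0) ?(ltW D0)//.
  have h1 := mean_child z e u0.
  have := ler_normD (mean b (child z u e) (u / 2) - mean b z u) (mean b z u - c).
  by rewrite subrKA /D; lra.
rewrite -[leLHS]add0r; apply: lerD; first by rewrite mulr_ge0 ?powR_ge0// ltW// vol0.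
rewrite -mulrA ler_wpM2l//.
  by rewrite mulr_ge0 ?addr_ge0 ?powR_ge0// mulr_ge0 ?powR_ge0.
rewrite ler_pdivlMl//; apply: le_trans (mean_dist_le _ c u20).
by rewrite ler_pM2r ?vol0// ltW.
Qed.

Let G_all N : G N.
Proof.
elim: N => [|N GN]; first exact: G0.
move=> z u u0 uN.
apply: (le_trans (stopping GN (leqnn _) u0 uN _)); first by rewrite subrr normr0 ltW.
apply: (@le_trans _ _ ((D `^ t + Y / A * be) * vol u)).
  rewrite [leRHS]mulrDl; apply: lerD; first by rewrite ler_pM2r ?vol0.
  rewrite -[leRHS]mulrA ler_wpM2l ?bmo_cube//.
  by rewrite divr_ge0 ?(ltW A0)// mulr_ge0 ?addr_ge0 ?powR_ge0// mulr_ge0 ?powR_ge0.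
rewrite ler_pM2r ?vol0//.
have -> : Y / A * be = (X + D `^ t) / 2.
  rewrite /Y /A powRD ?pnatr_eq0 ?implybT// powRr1//.
  by field; rewrite !gt_eqF// powR_gt0.
by rewrite /X; have := powR_ge0 D t; lra.
Qed.

(** [X] is homogeneous of degree t in [be]. The scale [dl] only decides how many doublings reach u,
    so it is absent from the bound. *)
Lemma john_nirenberg z u : 0 < u ->
  cI z u (fun x => `|b x - mean b z u| `^ t) <=
  3 * (2 `^ (t + 1) + 2 ^+ n) `^ t * be `^ t * vol u.
Proof.
move=> u0.
have -> : 3 * (2 `^ (t + 1) + 2 ^+ n) `^ t * be `^ t = X.
  by rewrite /X /D /A -mulrDl powRM ?(ltW be0) ?addr_ge0 ?powR_ge0// mulrA.
have [N uN] : exists N : nat, u <= 2 ^+ N * dl.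
  exists (Num.truncn (u / dl)).+1; rewrite -ler_pdivrMr//.
  apply: (le_trans (ltW (truncnS_gt _))).
  rewrite -natrX ler_nat; exact/ltnW/ltn_expl.
exact: G_all uN.
Qed.

End john_nirenberg.

Ltac measurable_proj := first
  [ exact: measurable_fst | exact: measurable_snd
  | exact: (measurableT_comp measurable_fst measurable_fst)
  | exact: (measurableT_comp measurable_snd measurable_fst)
  | exact: measurable_id | exact: measurable_cst ].

(** * The bilinear form *)

Section tonelli3.
Context {R : realType} {d1 d2 d3 : measure_display} {T1 : measurableType d1}
  {T2 : measurableType d2} {T3 : measurableType d3}.
Variables (m1 : {sigma_finite_measure set T1 -> \bar R})
  (m2 : {sigma_finite_measure set T2 -> \bar R})
  (m3 : {sigma_finite_measure set T3 -> \bar R}).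
Local Open Scope ereal_scope.

Lemma measurable_integral_param d (T : measurableType d) (f : T -> T2 -> \bar R) :
  measurable_fun setT (fun p : T * T2 => f p.1 p.2) -> (forall x y, 0 <= f x y) ->
  measurable_fun setT (fun x => \int[m2]_y f x y).
Proof.
move=> mf f0.
exact: (@measurable_fun_fubini_tonelli_F _ _ _ _ R m2 (fun p => f p.1 p.2)).
Qed.

Lemma tonelli2 (f : T1 -> T2 -> \bar R) :
  measurable_fun setT (fun p : T1 * T2 => f p.1 p.2) -> (forall x y, 0 <= f x y) ->
  \int[m1]_x \int[m2]_y f x y = \int[m2]_y \int[m1]_x f x y.
Proof.
move=> mf f0.
exact: (@fubini_tonelli _ _ _ _ R m1 m2 (fun p => f p.1 p.2)).
Qed.

Lemma measurable_pair_comp d (T : measurableType d) d' (T' : measurableType d') d'' (T'' : measurableType d'')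
   (f : T * T' -> \bar R) (g : T'' -> T) (h : T'' -> T') :
  measurable_fun setT f -> measurable_fun setT g -> measurable_fun setT h ->
  measurable_fun setT (fun x => f (g x, h x)).
Proof.
move=> mf mg mh; apply: (measurableT_comp (f := f) (g := fun x => (g x, h x))) => //.
exact/measurable_fun_pairP.
Qed.

End tonelli3.

Section tonelli3_lebesgue.
Context {R : realType} {d1 d2 d3 : measure_display} {T1 : measurableType d1}
  {T2 : measurableType d2} {T3 : measurableType d3}.
Variables (m1 : {sigma_finite_measure set T1 -> \bar R})
  (m2 : {sigma_finite_measure set T2 -> \bar R})
  (m3 : {sigma_finite_measure set T3 -> \bar R}).
Local Open Scope ereal_scope.

Lemma tonelli3 (f : T1 -> T2 -> T3 -> \bar R) :
  measurable_fun setT (fun p : T1 * T2 * T3 => f p.1.1 p.1.2 p.2) ->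
  (forall x y z, 0 <= f x y z) ->
  \int[m1]_x \int[m2]_y \int[m3]_z f x y z = \int[m3]_z \int[m1]_x \int[m2]_y f x y z.
Proof.
move=> mf f0.
have mf2 : measurable_fun setT (fun p : T1 * T3 * T2 => f p.1.1 p.2 p.1.2).
  apply: (@measurable_pair_comp R _ (T1 * T2)%type _ T3 _ _ (fun p => f p.1.1 p.1.2 p.2)
    (fun p : T1 * T3 * T2 => (p.1.1, p.2)) (fun p => p.1.2)) => //.
    apply/measurable_fun_pairP; split => //.
      exact: (measurableT_comp measurable_fst measurable_fst).
    exact: measurable_snd.
  exact: (measurableT_comp measurable_snd measurable_fst).
transitivity (\int[m1]_x \int[m3]_z \int[m2]_y f x y z).
  apply: eq_integral => x _; apply: tonelli2 => //.
  apply: (@measurable_pair_comp R _ (T1 * T2)%type _ T3 _ _ (fun p => f p.1.1 p.1.2 p.2)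
    (fun p : T2 * T3 => (x, p.1)) (fun p => p.2)) => //.
    by apply/measurable_fun_pairP; split; [exact: measurable_cst|exact: measurable_fst].
  exact: measurable_snd.
rewrite (@tonelli2 _ _ _ _ _ m1 m3 (fun x z => \int[m2]_y f x y z))//.
  exact: (@measurable_integral_param _ _ _ m2 _ _ (fun (p : T1 * T3) y => f p.1 y p.2)).
by move=> x z; exact: integral_ge0.
Qed.

End tonelli3_lebesgue.

Section form_bound.
Context {R : realType} (n : nat).
Local Notation leb := (@lebesgue_measure R).
Local Notation V := 'rV[R]_n.

(** The indicator of the open ball of radius u in the maximum norm. For s < n and x nonzero,
    integrating it against u^(s-n-1) over u > 0 gives |x|^(s-n)/(n-s) in that norm: the Riesz kernel
    as a superposition of cubes. *)
Definition near0 (u : R) (x : V) : R :=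
  \prod_(i < n) (if `|x ord0 i| < u then 1 else 0).

Lemma near0_ge0 u x : 0 <= near0 u x.
Proof. by apply: prodr_ge0 => i _; case: ifP. Qed.

Lemma near0P u x : (near0 u x = 1 /\ forall i, `|x ord0 i| < u) \/ near0 u x = 0.
Proof.
have [h|/existsNP[i hi]] := pselect (forall i, `|x ord0 i| < u).
  by left; split => //; apply: big1 => i _; rewrite h.
by right; apply/eqP/prodf_eq0; exists i => //; rewrite ifN//; exact/negP.
Qed.

Lemma measurable_near0 d (T : measurableType d) (u : T -> R) (x : T -> V) :
  measurable_fun setT u -> measurable_fun setT x ->
  measurable_fun setT (fun t => near0 (u t) (x t)).
Proof.
move=> mu_ /measurable_rVP mx.
apply: (@measurable_prod _ T R setT _ (index_enum 'I_n) (fun i t =>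
  (if `|x t ord0 i| < u t then 1 else 0))) => i _.
apply: measurable_fun_ifT => //.
by apply: measurable_fun_ltr => //; exact: measurableT_comp.
Qed.

(** When x and y are closer than u in the maximum norm, every z in the cube of half-side u/2 around
    their midpoint is the centre of a cube of half-side u containing both. That set of centres has
    volume u^n. *)
Lemma near0_le_chi (u : R) (x y : V) : 0 < u ->
  ((near0 u (x - y))%:E <= (u ^- n)%:E * \int[mu n]_z (chi z u x * chi z u y)%:E)%E.
Proof.
move=> u0.
have [[-> h]|->] := near0P u (x - y); last first.
  rewrite mule_ge0 ?lee_fin ?invr_ge0 ?exprn_ge0 ?(ltW u0)//.
  by apply: integral_ge0 => z _; rewrite lee_fin mulr_ge0// chi_ge0.
suff H : ((u ^+ n)%:E <= \int[mu n]_z (chi z u x * chi z u y)%:E)%E.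
  apply: (@le_trans _ _ ((u ^- n)%:E * (u ^+ n)%:E)%E).
    by rewrite -EFinM mulVf// gt_eqF// exprn_gt0.
  by rewrite lee_pmul2l// lte_fin invr_gt0 exprn_gt0.
pose c : V := 2^-1 *: (x + y).
apply: (@le_trans _ _ (\int[mu n]_z (chi c (u / 2) z)%:E)%E).
  rewrite integral_chi ?divr_ge0 ?(ltW u0)// lee_fin.
  by rewrite (_ : 2 * (u / 2) = u)//; field.
apply: ge0_le_integral => //.
- by move=> z _; rewrite lee_fin chi_ge0.
- by apply/measurable_EFinP; exact: measurable_chi_fst.
- apply/measurable_EFinP; apply: measurable_funM.
    by apply: measurable_chi => //; exact: measurable_cst.
  by apply: measurable_chi => //; exact: measurable_cst.
move=> z _; rewrite lee_fin.
rewrite {1}/chi indicE; case: (boolP (z \in _)) => [/set_mem zc|_]; last first.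
  by rewrite mulr_ge0// chi_ge0.
have hz i : `|x ord0 i - z ord0 i| < u /\ `|y ord0 i - z ord0 i| < u.
  have := zc i; have := h i; rewrite /c !mxE !ltr_norml => /andP[h1 h2] /andP[h3 h4].
  by split; apply/andP; split; lra.
rewrite /chi !indicE !mem_set ?mulr1// => i; have := hz i; rewrite !ltr_norml => -[/andP[h1 h2] /andP[h3 h4]];
  by apply/andP; split; lra.
Qed.

Section averages.
Variables (b : V -> R) (be dl r : R).
Hypotheses (bb : bm b) (be0 : 0 < be) (dl0 : 0 < dl) (r1 : 1 < r).
Hypothesis bmo_cube : forall (z : V) (u : R), 0 < u ->
  cI z u (fun x => `|b x - mean b z u|) <= be * (2 * u) ^+ n.
Hypothesis osc_small : forall (z : V) (u : R) (x y : V), 0 < u -> u <= dl -> cube z u x -> cube z u y ->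
  `|b x - b y| <= be.
Let t : R := r / (r - 1).
Let r0 : 0 < r. Proof. exact: lt_trans r1. Qed.
Let t0 : 0 < t. Proof. by rewrite divr_gt0// subr_gt0. Qed.
Let tr : t^-1 + r^-1 = 1.
Proof. by rewrite /t invf_div; field; rewrite gt_eqF. Qed.
(** The root of order t of the John-Nirenberg constant, t being conjugate to r. *)
Let J : R := (3 * (2 `^ (t + 1) + 2 ^+ n) `^ t) `^ t^-1.

Variable F : V -> R.
Hypotheses (bF : bm F) (F0 : forall x, 0 <= F x).
Let Fr x := F x `^ r.
Definition ravg (F : V -> R) (r : R) (z : V) (u : R) : R := (avgc (fun x => F x `^ r) u z) `^ r^-1.

Let bm_bound (f : V -> R) : bm f -> (forall x, 0 <= f x) -> exists M, forall x, f x <= M.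
Proof. by move=> [_ [M fM]] f0; exists M => x; apply: le_trans (fM x); exact: ler_norm. Qed.

Lemma bm_powR_ge0 (f : V -> R) k : 0 <= k -> bm f -> (forall x, 0 <= f x) -> bm (fun x => f x `^ k).
Proof.
move=> k0 bf f0; have := bm_powR k0 bf.
by under [X in bm X -> _]eq_fun do rewrite ger0_norm//.
Qed.

Lemma cI_le_ravg (z : V) (u : R) : 0 < u -> cI z u F <= (2 * u) ^+ n * ravg F r z u.
Proof.
move=> u0; have [M FM] := bm_bound bF F0.
have := avgc_jensen z u0 r1 bF.1 F0 FM.
have vol0 : 0 < (2 * u) ^+ n by rewrite exprn_gt0// mulr_gt0.
have a0 : 0 <= avgc F u z by apply: avgc_ge0 => //; exact: ltW.
move=> h; rewrite -ler_pdivrMl//; change (avgc F u z <= ravg F r z u).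
rewrite -[leLHS](powRr1 a0) -[in leLHS](mulfV (lt0r_neq0 r0)) powRrM.
apply: ge0_ler_powR => //; rewrite ?nnegrE ?powR_ge0 ?invr_ge0 ?(ltW r0)//.
by apply: avgc_ge0; [exact: ltW|move=> x; exact: powR_ge0].
Qed.

(** Hoelder on the cube: John-Nirenberg gives J be vol^(1/t) for the oscillation, F contributes
    vol^(1/r) times its r-average, and the volumes multiply to vol. *)
Lemma cI_osc_le_ravg (z : V) (u : R) : 0 < u ->
  cI z u (fun x => `|b x - mean b z u| * F x) <= J * be * (2 * u) ^+ n * ravg F r z u.
Proof.
move=> u0; have u0' := ltW u0.
set m := mean b z u; set vol := (2 * u) ^+ n.
have vol0 : 0 < vol by rewrite exprn_gt0// mulr_gt0.
have bbm : bm (fun x => b x - m) by apply: bmB => //; exact: bm_cst.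
have bbn := bm_norm bbm.
have bbt := bm_powR (ltW t0) bbm.
have bFr := bm_powR_ge0 (ltW r0) bF F0.
have mc := measurable_chi_fst z u.
have chi01 x k : k != 0 -> (chi z u x) `^ k = chi z u x.
  by move=> k0; rewrite /chi indicE; case: (_ \in _); rewrite ?powR1// powR0.
have chi2 x : chi z u x * chi z u x = chi z u x.
  by rewrite /chi indicE; case: (_ \in _); rewrite ?mulr1 ?mulr0.
have EI h : bm h -> ((cI z u h)%:E = \int[mu n]_x (chi z u x * h x)%:E)%E.
  by move=> bh; rewrite fineK//; apply: integrable_fin_num => //; exact: integrable_chi.
have := @ge0_hoelder R _ _ (mu n) (fun x => chi z u x * `|b x - m|) (fun x => chi z u x * F x) t r
  (measurable_funM mc bbn.1) (measurable_funM mc bF.1).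
have E1 : (\int[mu n]_x ((chi z u x * `|b x - m|) * (chi z u x * F x))%:E =
    (cI z u (fun x => `|b x - m| * F x))%:E)%E.
  rewrite EI; last exact: bmM.
  by apply: eq_integral => x _; rewrite mulrACA chi2.
have E2 : (\int[mu n]_x ((chi z u x * `|b x - m|) `^ t)%:E = (cI z u (fun x => `|b x - m| `^ t))%:E)%E.
  rewrite EI//; apply: eq_integral => x _.
  by rewrite powRM ?chi_ge0// chi01// gt_eqF.
have E3 : (\int[mu n]_x ((chi z u x * F x) `^ r)%:E = (cI z u Fr)%:E)%E.
  rewrite EI//; apply: eq_integral => x _.
  by rewrite powRM ?chi_ge0// chi01// gt_eqF.
rewrite E1 E2 E3.
(* The names [j] and [k] keep unification from unfolding [cI]. *)
have [j jE] : exists j, j = cI z u (fun x => `|b x - m| `^ t) by exact: (ex_intro _ _ erefl).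
have [k kE] : exists k, k = cI z u Fr by exact: (ex_intro _ _ erefl).
rewrite -jE -kE 2!poweR_EFin -EFinM lee_fin jE kE {j k jE kE} => H.
apply: le_trans (H _ _ t0 r0 tr) _ => [x|x|]; rewrite ?mulr_ge0 ?chi_ge0//.
have -> : cI z u Fr = vol * avgc Fr u z.
  by rewrite /avgc mulrA divff ?mul1r// gt_eqF.
have av0 : 0 <= avgc Fr u z by apply: avgc_ge0 => // x; exact: powR_ge0.
rewrite powRM ?(ltW vol0)// -/(ravg F r z u) mulrA ler_wpM2r ?powR_ge0//.
have h := john_nirenberg bb be0 t0 dl0 bmo_cube osc_small z u0.
apply: (@le_trans _ _ ((3 * (2 `^ (t + 1) + 2 ^+ n) `^ t * be `^ t * vol) `^ t^-1 * vol `^ r^-1)).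
  rewrite ler_wpM2r ?powR_ge0//; apply: ge0_ler_powR => //.
  - by rewrite invr_ge0 ltW.
  - by rewrite nnegrE; apply: cI_ge0 => x; exact: powR_ge0.
  - by rewrite nnegrE !mulr_ge0 ?powR_ge0// ltW.
rewrite powRM ?(ltW vol0) ?mulr_ge0 ?powR_ge0// powRM ?mulr_ge0 ?powR_ge0//.
rewrite -/J -powRrM mulfV ?gt_eqF// powRr1 ?(ltW be0)//.
rewrite -mulrA -powRD; last by rewrite (gt_eqF vol0) implybT.
by rewrite tr powRr1 ?(ltW vol0).
Qed.

End averages.

(** Passing through the mean m, |b x - b y| <= |b x - m| + |b y - m| separates the variables. Each
    of the two terms is an integral with oscillation times one without, hence the factor 2. *)
Lemma cI_double_le (b F G : V -> R) (be dl r : R) (z : V) (u : R) :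
  bm b -> 0 < be -> 0 < dl -> 1 < r ->
  (forall (z : V) (u : R), 0 < u ->
    cI z u (fun x => `|b x - mean b z u|) <= be * (2 * u) ^+ n) ->
  (forall (z : V) (u : R) (x y : V), 0 < u -> u <= dl -> cube z u x -> cube z u y ->
    `|b x - b y| <= be) ->
  bm F -> (forall x, 0 <= F x) -> bm G -> (forall x, 0 <= G x) -> 0 < u ->
  (\int[mu n]_x \int[mu n]_y (chi z u x * chi z u y * (`|b x - b y| * F y * G x))%:E <=
   (2 * (3 * (2 `^ (r / (r - 1) + 1) + 2 ^+ n) `^ (r / (r - 1))) `^ (r / (r - 1))^-1 * be *
     (2 * u) ^+ n * (2 * u) ^+ n * (ravg F r z u * ravg G r z u))%:E)%E.
Proof.
move=> bb be0 dl0 r1 hb ho bF F0 bG G0 u0; have u0' := ltW u0.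
set J := (_ `^ _^-1); set m := mean b z u; set vol := (2 * u) ^+ n.
have vol0 : 0 < vol by rewrite exprn_gt0// mulr_gt0.
have bbn : bm (fun x => `|b x - m|) by apply: bm_norm; apply: bmB => //; exact: bm_cst.
have mc := measurable_chi_fst z u.
have EI h : bm h -> ((cI z u h)%:E = \int[mu n]_x (chi z u x * h x)%:E)%E.
  by move=> bh; rewrite fineK//; apply: integrable_fin_num => //; exact: integrable_chi.
pose A := cI z u F; pose B := cI z u (fun y => `|b y - m| * F y).
have A0 : 0 <= A by exact: cI_ge0.
have B0 : 0 <= B by apply: cI_ge0 => x; rewrite mulr_ge0.
have inner x : (\int[mu n]_y (chi z u x * chi z u y * (`|b x - b y| * F y * G x))%:E <=
    (chi z u x * (A * (`|b x - m| * G x) + B * G x))%:E)%E.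
  have -> : (chi z u x * (A * (`|b x - m| * G x) + B * G x))%:E =
      ((chi z u x * G x)%:E * (cI z u (fun y => `|b x - m| * F y + `|b y - m| * F y))%:E)%E.
    rewrite cID//; last 2 first.
    - by apply: bmM => //; exact: bm_cst.
    - exact: bmM.
    rewrite cIZ// -/A -/B -EFinM; congr EFin; ring.
  rewrite EI; last first.
    by apply: bmD; [apply: bmM => //; exact: bm_cst|exact: bmM].
  have mi : measurable_fun setT (fun y => (chi z u y * (`|b x - m| * F y + `|b y - m| * F y))%:E).
    apply/measurable_EFinP; apply: measurable_funM => //.
    apply: (proj1 (@bmD _ _ _ (fun y => `|b x - m| * F y) (fun y => `|b y - m| * F y) _ _)).
      by apply: bmM => //; exact: bm_cst.
    exact: bmM.
  rewrite -ge0_integralZl//; last 2 first.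
  - by move=> y _; rewrite lee_fin mulr_ge0 ?chi_ge0// addr_ge0// mulr_ge0.
  - by rewrite lee_fin mulr_ge0 ?chi_ge0.
  apply: ge0_le_integral => //.
  - by move=> y _; rewrite lee_fin !mulr_ge0 ?chi_ge0.
  - apply/measurable_EFinP; apply: measurable_funM.
      by apply: measurable_funM => //; exact: measurable_cst.
    have bxy : bm (fun y => `|b x - b y|) by apply: bm_norm; apply: bmB => //; exact: bm_cst.
    by apply: measurable_funM; [exact: (measurable_funM bxy.1 bF.1)|exact: measurable_cst].
  - by apply: measurable_funeM.
  - move=> y _; rewrite -EFinM lee_fin.
    rewrite [X in X <= _](_ : _ = chi z u x * G x * (chi z u y * (`|b x - b y| * F y))); last by ring.
    rewrite ler_wpM2l ?mulr_ge0 ?chi_ge0// ler_wpM2l ?chi_ge0// -mulrDl ler_wpM2r//.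
    by rewrite (distrC (b y)); exact: ler_distD.
have bAB : bm (fun x => A * (`|b x - m| * G x) + B * G x).
  by apply: bmD; apply: bmM; [exact: bm_cst|exact: bmM|exact: bm_cst|].
apply: (@le_trans _ _ (cI z u (fun x => A * (`|b x - m| * G x) + B * G x))%:E).
  rewrite EI//; apply: ge0_le_integral => //.
  - by move=> x _; apply: integral_ge0 => y _; rewrite lee_fin !mulr_ge0 ?chi_ge0.
  - apply: (@measurable_integral_param _ _ _ (mu n) _ _
      (fun x y => (chi z u x * chi z u y * (`|b x - b y| * F y * G x))%:E)).
      apply/measurable_EFinP; apply: measurable_funM.
        by apply: measurable_funM; exact: measurableT_comp.
      have mb := bb.1; have mF := bF.1; have mG := bG.1.
      apply: measurable_funM; last exact: measurableT_comp.
      apply: measurable_funM; last exact: measurableT_comp.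
      by apply: measurableT_comp => //; apply: measurable_funB; exact: measurableT_comp.
    by move=> x y; rewrite lee_fin !mulr_ge0 ?chi_ge0.
  - by apply/measurable_EFinP; apply: measurable_funM => //; exact: bAB.1.
rewrite lee_fin cID//; last 2 first.
- by apply: bmM; [exact: bm_cst|exact: bmM].
- by apply: bmM => //; exact: bm_cst.
rewrite !cIZ//; last exact: bmM.
have hA : A <= vol * ravg F r z u by exact: cI_le_ravg.
have hB : B <= J * be * vol * ravg F r z u by exact: (cI_osc_le_ravg bb be0 dl0 r1 hb ho).
have hG1 : cI z u G <= vol * ravg G r z u by exact: cI_le_ravg.
have hG2 : cI z u (fun x => `|b x - m| * G x) <= J * be * vol * ravg G r z u.
  exact: (cI_osc_le_ravg bb be0 dl0 r1 hb ho).
apply: (@le_trans _ _ (vol * ravg F r z u * (J * be * vol * ravg G r z u) +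
   J * be * vol * ravg F r z u * (vol * ravg G r z u))).
  apply: (lerD (ler_pM A0 _ hA hG2) (ler_pM B0 _ hB hG1)).
    by apply: cI_ge0 => x; rewrite mulr_ge0.
  exact: cI_ge0.
have E (j v x y e : R) :
    v * x * (j * e * v * y) + j * e * v * x * (v * y) = 2 * j * e * v * v * (x * y) by ring.
by rewrite E.
Qed.

(** The exponent 0 is excluded because of u <= 0, where the left side would be 0 to the power 0,
    that is 1. *)
Lemma wpow_powR c a (u : R) : a != 0 -> (wpow c u) `^ a = wpow (c * a) u.
Proof. by move=> a0; rewrite /wpow; case: ifP => _; [rewrite powRrM|rewrite powR0]. Qed.

(** An r-average is the root of order r of an average of F^r, so [scale_sum_le] is used for F^r with
    the exponents p/r and a/r; r < p is what it needs. *)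
Lemma ravg_sum_le (p a r : R) (F : V -> R) : (0 < n)%N ->
  1 < r -> r < p -> p < a -> bm F -> (forall x, 0 <= F x) ->
  (\int[mu n]_x (F x `^ p)%:E <= 1)%E ->
  (\int[leb \x mu n]_q ((wpow ((n%:R * (a / p - 1) - 1) / a) q.1 * ravg F r q.2 q.1) `^ a)%:E <=
   (2 `^ (a / r) * ((n%:R * (a / p - 1))^-1 + (n%:R * (1 - r / p))^-1))%:E)%E.
Proof.
move=> n0 r1 rp pa bF F0 Fp.
have r0 : 0 < r by exact: lt_trans r1.
have p0 : 0 < p by exact: lt_trans rp.
have a0 : 0 < a by exact: lt_trans pa.
have bFr := bm_powR_ge0 (ltW r0) bF F0.
have mr : measurable_fun setT (fun q : measurableTypeR R * V => ravg F r q.2 q.1).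
  apply: measurable_powR_comp; apply: measurable_avgc => //.
  - exact: bFr.1.
  - by move=> x; exact: powR_ge0.
rewrite (@fubini_tonelli1 _ _ _ _ R leb (mu n) (fun q : measurableTypeR R * V =>
  ((wpow ((n%:R * (a / p - 1) - 1) / a) q.1 * ravg F r q.2 q.1) `^ a)%:E)); last 2 first.
- apply/measurable_EFinP; apply: measurable_powR_comp; apply: measurable_funM => //.
  by apply: measurable_wpow; exact: measurable_fst.
- by move=> q; rewrite lee_fin powR_ge0.
have [M FM] : exists M, forall x, F x `^ r <= M.
  by have [_ [M hM]] := bFr; exists M => x; apply: le_trans (hM x); exact: ler_norm.
have := @scale_sum_le R n (p / r) (a / r) n0 _ _ (fun x => F x `^ r) M bFr.1 (fun x => powR_ge0 _ _) FM.
rewrite (_ : a / r / (p / r) = a / p); last by field; rewrite !gt_eqF.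
rewrite (_ : (p / r)^-1 = r / p); last by field; rewrite !gt_eqF.
move=> H; apply: le_trans (H _ _ _); last 3 first.
- by rewrite ltr_pdivlMr// mul1r.
- by rewrite ltr_pM2r// invr_gt0.
- under eq_integral do rewrite -powRrM mulrCA mulfV ?gt_eqF// mulr1.
  exact: Fp.
rewrite le_eqVlt; apply/orP; left; apply/eqP; rewrite /fubini_F.
apply: eq_integral => u _; apply: eq_integral => z _; congr EFin.
rewrite powRM ?wpow_ge0 ?powR_ge0// wpow_powR ?gt_eqF// divfK ?gt_eqF//.
by rewrite /= /ravg -powRrM [r^-1 * a]mulrC.
Qed.

End form_bound.

Lemma ge0_hoelder_iterated {R : realType} {d1 d2} {T1 : measurableType d1} {T2 : measurableType d2}
  (m1 : {sigma_finite_measure set T1 -> \bar R}) (m2 : {sigma_finite_measure set T2 -> \bar R})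
  (f g : T1 * T2 -> R) (p q : R) :
  measurable_fun setT f -> measurable_fun setT g ->
  (forall x, 0 <= f x) -> (forall x, 0 <= g x) ->
  0 < p -> 0 < q -> p^-1 + q^-1 = 1 ->
  (\int[m1]_x \int[m2]_y (f (x, y) * g (x, y))%:E <=
   (\int[m1 \x m2]_z (f z `^ p)%:E) `^ p^-1 * (\int[m1 \x m2]_z (g z `^ q)%:E) `^ q^-1)%E.
Proof.
move=> mf mg f0 g0 p0 q0 pq.
rewrite -(@fubini_tonelli1 _ _ _ _ R m1 m2 (fun z => (f z * g z)%:E)).
- exact: ge0_hoelder.
- by apply/measurable_EFinP; exact: measurable_funM.
- by move=> z; rewrite lee_fin mulr_ge0.
Qed.

(** * The bound for the form, with normalised functions *)

Section form_bound_scaling.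
Context {R : realType} (n : nat).
Local Notation leb := (@lebesgue_measure R).
Local Notation V := 'rV[R]_n.

Lemma form_bound (s p1 p2 : R) : (0 < n)%N -> 0 < s -> 1 < p1 -> 1 < p2 ->
  p1^-1 + p2^-1 = 1 + s / n%:R ->
  exists C : R, 0 < C /\ forall (b F G : V -> R) (be dl : R),
    bm b -> 0 < be -> 0 < dl ->
    (forall (z : V) (u : R), 0 < u ->
      cI z u (fun x => `|b x - mean b z u|) <= be * (2 * u) ^+ n) ->
    (forall (z : V) (u : R) (x y : V), 0 < u -> u <= dl -> cube z u x -> cube z u y ->
      `|b x - b y| <= be) ->
    bm F -> (forall x, 0 <= F x) -> bm G -> (forall x, 0 <= G x) ->
    (\int[mu n]_x (F x `^ p1)%:E <= 1)%E -> (\int[mu n]_x (G x `^ p2)%:E <= 1)%E ->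
    (\int[mu n]_x \int[mu n]_y \int[leb]_u
       (wpow (s - n%:R - 1) u * near0 u (x - y) * (`|b x - b y| * F y * G x))%:E <= (C * be)%:E)%E.
Proof.
move=> n0 s0 p11 p21 pp.
have nR : 0 < n%:R :> R by rewrite ltr0n.
have p10 : 0 < p1 by exact: lt_trans p11.
have p20 : 0 < p2 by exact: lt_trans p21.
(* The reciprocals of [p1] and [p2] add up to k, so multiplying both exponents by k makes them
   conjugate; since k > 1, each also grows, as [ravg_sum_le] requires. *)
pose k := 1 + s / n%:R.
have k1 : 1 < k by rewrite /k ltrDl divr_gt0.
have k0 : 0 < k by exact: lt_trans k1.
pose a1 := p1 * k; pose a2 := p2 * k.
have a10 : 0 < a1 by rewrite mulr_gt0.
have a20 : 0 < a2 by rewrite mulr_gt0.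
have pa1 : p1 < a1 by rewrite /a1 ltr_pMr.
have pa2 : p2 < a2 by rewrite /a2 ltr_pMr.
have aa : a1^-1 + a2^-1 = 1.
  by rewrite /a1 /a2 !invfM -mulrDl pp -/k mulfV// gt_eqF.
(* Any exponent strictly between 1 and both [p1] and [p2] serves; its conjugate is the power in
   which John-Nirenberg is used. *)
pose r := (1 + Num.min p1 p2) / 2.
have m1 : 1 < Num.min p1 p2 by rewrite lt_min p11.
have r1 : 1 < r by rewrite /r; lra.
have rm : r < Num.min p1 p2 by rewrite /r; lra.
have [rp1 rp2] : r < p1 /\ r < p2 by move: rm; rewrite lt_min => /andP.
have r0 : 0 < r by exact: lt_trans r1.
pose J := (3 * (2 `^ (r / (r - 1) + 1) + 2 ^+ n) `^ (r / (r - 1))) `^ (r / (r - 1))^-1.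
pose Cr (p a : R) := 2 `^ (a / r) * ((n%:R * (a / p - 1))^-1 + (n%:R * (1 - r / p))^-1).
have Cr0 p a : r < p -> p < a -> 0 < Cr p a.
  move=> rp pa; have p0 : 0 < p by exact: lt_trans rp.
  rewrite mulr_gt0 ?powR_gt0// addr_gt0 ?invr_gt0 ?mulr_gt0 ?subr_gt0//.
    by rewrite ltr_pdivlMr// mul1r.
  by rewrite ltr_pdivrMr// mul1r.
pose C2 := Cr p1 a1 `^ a1^-1 * Cr p2 a2 `^ a2^-1.
have C20 : 0 < C2 by rewrite mulr_gt0// powR_gt0// Cr0.
have J0 : 0 < J by rewrite powR_gt0// mulr_gt0// powR_gt0// addr_gt0 ?powR_gt0// exprn_gt0.
(* The factor 2 J is that of the double integral over one cube; 4^n is what the two volumes (2 u)^n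
   leave besides powers of u. *)
pose C3 := 2 * J * 4 ^+ n.
have C30 : 0 < C3 by rewrite !mulr_gt0// exprn_gt0.
exists (C3 * C2); split; first by rewrite mulr_gt0.
move=> b F G be dl bb be0 dl0 hb ho bF F0 bG G0 Fp Gp.
have CB : 0 <= C3 * be by apply: mulr_ge0; exact: ltW.
pose P (x y : V) := `|b x - b y| * F y * G x.
have P0 x y : 0 <= P x y by rewrite !mulr_ge0.
have mb := bb.1; have mF := bF.1; have mG := bG.1.
have mP d (T : measurableType d) (f g : T -> V) : measurable_fun setT f -> measurable_fun setT g ->
    measurable_fun setT (fun w => P (f w) (g w)).
  move=> mf mg.
  have mbf : measurable_fun setT (fun w => b (f w)) by exact: (measurableT_comp mb mf).
  have mbg : measurable_fun setT (fun w => b (g w)) by exact: (measurableT_comp mb mg).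
  apply: measurable_funM; last exact: (measurableT_comp mG mf).
  apply: measurable_funM; last exact: (measurableT_comp mF mg).
  by apply: measurableT_comp => //; exact: measurable_funB.
pose Q (x y : V) (u : R) := (wpow (s - n%:R - 1) u * near0 u (x - y) * P x y)%:E.
have Q0 x y u : (0 <= Q x y u)%E by rewrite lee_fin !mulr_ge0 ?wpow_ge0 ?near0_ge0.
have mQ d (T : measurableType d) (f g : T -> V) (h : T -> measurableTypeR R) :
    measurable_fun setT f -> measurable_fun setT g -> measurable_fun setT h ->
    measurable_fun setT (fun w => Q (f w) (g w) (h w)).
  move=> mf mg mh; apply/measurable_EFinP; apply: measurable_funM; last exact: mP.
  apply: measurable_funM; first exact: measurable_wpow.
  by apply: measurable_near0 => //; exact: measurable_rVB.
rewrite (tonelli3 (mu n) (mu n) leb (f := Q)) => //; last by apply: mQ; measurable_proj.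
have -> : C3 * C2 * be = C3 * be * C2 by ring.
(* The power of u: s - n - 1 from the kernel, - n from averaging over centres, and 2 n from the two
   volumes, in total s - 1. *)
pose S (u : R) (z : V) := wpow (s - 1) u * (ravg F r z u * ravg G r z u).
have S0 u z : 0 <= S u z by rewrite mulr_ge0 ?wpow_ge0// mulr_ge0 ?powR_ge0.
have mrav H : bm H -> (forall x, 0 <= H x) ->
    measurable_fun setT (fun q : measurableTypeR R * V => ravg H r q.2 q.1).
  move=> bH H0; apply: measurable_powR_comp; apply: measurable_avgc => //.
  - exact: (bm_powR_ge0 (ltW r0) bH H0).1.
  - by move=> x; exact: powR_ge0.
have mS : measurable_fun setT (fun q : measurableTypeR R * V => S q.1 q.2).
  apply: measurable_funM; first by apply: measurable_wpow; exact: measurable_fst.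
  by apply: measurable_funM; exact: mrav.
have step2 u : (\int[mu n]_x \int[mu n]_y Q x y u <= (C3 * be)%:E * \int[mu n]_z (S u z)%:E)%E.
  have [u0|u0] := ltP 0 u; last first.
    rewrite integral0_eq; last first.
      move=> x _; rewrite integral0_eq// => y _.
      by rewrite /Q /wpow ltNge u0/= !mul0r.
    apply: mule_ge0; rewrite ?lee_fin//.
    by apply: integral_ge0 => z _; rewrite lee_fin.
  have [w wE] : exists w, w = wpow (s - n%:R - 1) u * u ^- n by exists (wpow (s - n%:R - 1) u * u ^- n).
  have w0 : 0 <= w by rewrite wE mulr_ge0 ?wpow_ge0// invr_ge0 exprn_ge0// ltW.
  pose L (x y z : V) := (w * (chi z u x * chi z u y * P x y))%:E.
  have L0 x y z : (0 <= L x y z)%E by rewrite lee_fin !mulr_ge0 ?chi_ge0.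
  have mL d (T : measurableType d) (f g h : T -> V) :
      measurable_fun setT f -> measurable_fun setT g -> measurable_fun setT h ->
      measurable_fun setT (fun x => L (f x) (g x) (h x)).
    move=> mf mg mh; apply/measurable_EFinP; apply: measurable_funM => //.
    apply: measurable_funM; last exact: mP.
    by apply: measurable_funM; apply: measurable_chi.
  apply: (@le_trans _ _ (\int[mu n]_x \int[mu n]_y \int[mu n]_z L x y z)%E).
    apply: ge0_le_integral => //.
    - by move=> x _; exact: integral_ge0.
    - apply: (@measurable_integral_param _ _ _ (mu n) _ V (fun x y : V => Q x y u)) => //.
      by apply: mQ; measurable_proj.
    - apply: (@measurable_integral_param _ _ _ (mu n) _ V (fun x y : V => \int[mu n]_z L x y z)%E).
        apply: (@measurable_integral_param _ _ _ (mu n) _ _ (fun (q : V * V) z => L q.1 q.2 z)) => //.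
        by apply: mL; measurable_proj.
      by move=> x y; exact: integral_ge0.
    move=> x _; apply: ge0_le_integral => //.
    - by apply: mQ; measurable_proj.
    - apply: (@measurable_integral_param _ _ _ (mu n) _ V (fun y z : V => L x y z)) => //.
      by apply: mL; measurable_proj.
    move=> y _; rewrite /L.
    have -> : (\int[mu n]_z (w * (chi z u x * chi z u y * P x y))%:E =
        (w * P x y)%:E * \int[mu n]_z (chi z u x * chi z u y)%:E)%E.
      rewrite -ge0_integralZl//.
      - by apply: eq_integral => z _; rewrite -EFinM; congr EFin; ring.
      - apply/measurable_EFinP; apply: measurable_funM; apply: measurable_chi => //; exact: measurable_cst.
      - by move=> z _; rewrite lee_fin mulr_ge0 ?chi_ge0.
      - by rewrite lee_fin mulr_ge0.
    have -> : Q x y u = ((wpow (s - n%:R - 1) u * P x y)%:E * (near0 u (x - y))%:E)%E.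
      by rewrite -EFinM; congr EFin; rewrite mulrAC.
    have -> : ((w * P x y)%:E = (wpow (s - n%:R - 1) u * P x y)%:E * (u ^- n)%:E)%E.
      by rewrite -EFinM; congr EFin; rewrite wE mulrAC.
    rewrite -muleA lee_wpmul2l ?lee_fin ?mulr_ge0 ?wpow_ge0//.
    exact: near0_le_chi.
  rewrite tonelli3 => //; last by apply: mL; measurable_proj.
  have mSu : measurable_fun setT (fun z => (S u z)%:E).
    apply/measurable_EFinP; apply: measurable_funM => //.
    apply: measurable_funM; apply: measurable_powR_comp; apply: measurable_avgc => //.
    - exact: (bm_powR_ge0 (ltW r0) bF F0).1.
    - by move=> x; exact: powR_ge0.
    - exact: (bm_powR_ge0 (ltW r0) bG G0).1.
    - by move=> x; exact: powR_ge0.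
  rewrite -ge0_integralZl//; last by move=> z _; rewrite lee_fin.
  apply: ge0_le_integral => //.
  - by move=> z _; apply: integral_ge0 => x _; exact: integral_ge0.
  - apply: (@measurable_integral_param _ _ _ (mu n) _ V (fun z x : V => \int[mu n]_y L x y z)%E).
      apply: (@measurable_integral_param _ _ _ (mu n) _ _ (fun (q : V * V) y => L q.2 y q.1)) => //.
      by apply: mL; measurable_proj.
    by move=> z x; exact: integral_ge0.
  - exact: measurable_funeM.
  move=> z _; rewrite /L.
  have mcP d (T : measurableType d) (f g : T -> V) : measurable_fun setT f -> measurable_fun setT g ->
      measurable_fun setT (fun w => (chi z u (f w) * chi z u (g w) * P (f w) (g w))%:E).
    move=> mf mg; apply/measurable_EFinP; apply: measurable_funM; last exact: mP.
    by apply: measurable_funM; apply: measurable_chi => //; exact: measurable_cst.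
  have -> : (\int[mu n]_x \int[mu n]_y (w * (chi z u x * chi z u y * P x y))%:E =
      w%:E * \int[mu n]_x \int[mu n]_y (chi z u x * chi z u y * P x y)%:E)%E.
    rewrite -ge0_integralZl//.
    - apply: eq_integral => x _; rewrite -ge0_integralZl//.
      + by apply: mcP; measurable_proj.
      + by move=> y _; rewrite lee_fin !mulr_ge0 ?chi_ge0.
    - apply: (@measurable_integral_param _ _ _ (mu n) _ V (fun x y : V => (chi z u x * chi z u y * P x y)%:E)).
        by apply: mcP; measurable_proj.
      by move=> x y; rewrite lee_fin !mulr_ge0 ?chi_ge0.
    - by move=> x _; apply: integral_ge0 => y _; rewrite lee_fin !mulr_ge0 ?chi_ge0.
  apply: (@le_trans _ _ (w%:E * (2 * J * be * (2 * u) ^+ n * (2 * u) ^+ n * (ravg F r z u * ravg G r z u))%:E))%E.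
    rewrite lee_wpmul2l ?lee_fin//.
    exact: (cI_double_le z bb be0 dl0 r1 hb ho bF F0 bG G0 u0).
  rewrite -!EFinM lee_fin /S /C3 le_eqVlt; apply/orP; left; apply/eqP.
  have -> : wpow (s - 1) u = w * (u ^+ n * u ^+ n).
    rewrite wE -mulrA mulKf ?expf_neq0 ?gt_eqF// /wpow u0 -powR_mulrn ?(ltW u0)//.
    rewrite -powRD; last by rewrite (gt_eqF u0) implybT.
    by congr (_ `^ _); ring.
  have -> : 4 ^+ n = 2 ^+ n * 2 ^+ n :> R by rewrite -exprMn; congr (_ ^+ _); ring.
  have E (w' j t a e x y : R) : w' * (2 * j * e * (t * a) * (t * a) * (x * y)) =
      2 * j * (t * t) * e * (w' * (a * a) * (x * y)) by ring.
  by rewrite !exprMn E.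
apply: (@le_trans _ _ (\int[leb]_u ((C3 * be)%:E * \int[mu n]_z (S u z)%:E))%E).
  apply: ge0_le_integral => //.
  - by move=> u _; apply: integral_ge0 => x _; exact: integral_ge0.
  - apply: (@measurable_integral_param _ _ _ (mu n) _ (measurableTypeR R) (fun u x => \int[mu n]_y Q x y u)%E).
      apply: (@measurable_integral_param _ _ _ (mu n) _ (measurableTypeR R * V)%type (fun q y => Q q.2 y q.1)) => //.
      by apply: mQ; measurable_proj.
    by move=> u x; exact: integral_ge0.
  - apply: measurable_funeM.
    apply: (@measurable_integral_param _ _ _ (mu n) _ (measurableTypeR R) (fun u z => (S u z)%:E)).
      exact/measurable_EFinP.
    by move=> u z; rewrite lee_fin.
rewrite ge0_integralZl//; last 2 first.
- apply: (@measurable_integral_param _ _ _ (mu n) _ (measurableTypeR R) (fun u z => (S u z)%:E)).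
    exact/measurable_EFinP.
  by move=> u z; rewrite lee_fin.
- by move=> u _; apply: integral_ge0 => z _; rewrite lee_fin.
rewrite [leRHS]EFinM lee_pmul2l ?lte_fin ?mulr_gt0//.
pose f (q : measurableTypeR R * V) := wpow ((n%:R * (a1 / p1 - 1) - 1) / a1) q.1 * ravg F r q.2 q.1.
pose g (q : measurableTypeR R * V) := wpow ((n%:R * (a2 / p2 - 1) - 1) / a2) q.1 * ravg G r q.2 q.1.
have mf : measurable_fun setT f.
  apply: measurable_funM; first by apply: measurable_wpow; exact: measurable_fst.
  exact: mrav.
have mg : measurable_fun setT g.
  apply: measurable_funM; first by apply: measurable_wpow; exact: measurable_fst.
  exact: mrav.
have f0 q : 0 <= f q by rewrite mulr_ge0 ?wpow_ge0 ?powR_ge0.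
have g0 q : 0 <= g q by rewrite mulr_ge0 ?wpow_ge0 ?powR_ge0.
(* The weight u^(s-1) splits into the two weights that [ravg_sum_le] demands: the exponents add up
   to n (1/p1 + 1/p2) - (n + 1)(1/a1 + 1/a2) = s - 1. *)
have SE u z : S u z = f (u, z) * g (u, z).
  rewrite /f /g /S mulrACA; congr (_ * _); rewrite /wpow /=; case: ifPn => [u0|]; last by rewrite mul0r.
  rewrite -powRD; last by rewrite (gt_eqF u0) implybT.
  congr (_ `^ _).
  have E1 : (n%:R * (a1 / p1 - 1) - 1) / a1 = n%:R / p1 - (n%:R + 1) / a1 by field; rewrite !gt_eqF.
  have E2 : (n%:R * (a2 / p2 - 1) - 1) / a2 = n%:R / p2 - (n%:R + 1) / a2 by field; rewrite !gt_eqF.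
  rewrite E1 E2.
  have -> : n%:R / p1 - (n%:R + 1) / a1 + (n%:R / p2 - (n%:R + 1) / a2) =
     n%:R * (p1^-1 + p2^-1) - (n%:R + 1) * (a1^-1 + a2^-1) by ring.
  by rewrite aa pp; field; rewrite gt_eqF.
under eq_integral => u _ do under eq_integral => z _ do rewrite SE.
apply: (le_trans (ge0_hoelder_iterated leb (mu n) mf mg f0 g0 a10 a20 aa)).
rewrite /C2 EFinM -!poweR_EFin; apply: lee_pmul; rewrite ?poweR_ge0//.
  apply: gt0_ler_poweR; rewrite ?in_itv/= ?leey ?andbT ?invr_ge0 ?(ltW a10)//.
  - by apply: integral_ge0 => q _; rewrite lee_fin powR_ge0.
  - by rewrite lee_fin ltW// Cr0.
  - exact: (ravg_sum_le n0 r1 rp1 pa1 bF F0 Fp).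
apply: gt0_ler_poweR; rewrite ?in_itv/= ?leey ?andbT ?invr_ge0 ?(ltW a20)//.
- by apply: integral_ge0 => q _; rewrite lee_fin powR_ge0.
- by rewrite lee_fin ltW// Cr0.
- exact: (ravg_sum_le n0 r1 rp2 pa2 bG G0 Gp).
Qed.

End form_bound_scaling.

(** * Partial derivatives and decay *)

Section real_integrals.
Context {R : realType}.

Lemma measurable_curry1 {d1 d2 d3} {T1 : measurableType d1} {T2 : measurableType d2}
  {T3 : measurableType d3} (h : T1 -> T2 -> T3) x :
  measurable_fun setT (fun z : T1 * T2 => h z.1 z.2) -> measurable_fun setT (h x).
Proof. by move=> mh; exact: (measurableT_comp mh (measurable_pair1 x)). Qed.

Lemma measurable_curry2 {d1 d2 d3} {T1 : measurableType d1} {T2 : measurableType d2}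
  {T3 : measurableType d3} (h : T1 -> T2 -> T3) y :
  measurable_fun setT (fun z : T1 * T2 => h z.1 z.2) -> measurable_fun setT (h^~ y).
Proof. by move=> mh; exact: (measurableT_comp mh (measurable_pair2 y)). Qed.

(** Slices are asked to be integrable at every point, so that the real-valued inner integrals lose
    nothing when extended integrals are cut down by [fine]. *)
Lemma Rintegral_Fubini {d1 d2} {T1 : measurableType d1} {T2 : measurableType d2}
  (m1 : {sigma_finite_measure set T1 -> \bar R}) (m2 : {sigma_finite_measure set T2 -> \bar R})
  (h : T1 -> T2 -> R) :
  (m1 \x m2)%E.-integrable setT (fun z => (h z.1 z.2)%:E) ->
  (forall x, m2.-integrable setT (fun y => (h x y)%:E)) ->
  (forall y, m1.-integrable setT (fun x => (h x y)%:E)) ->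
  \int[m1]_x \int[m2]_y h x y = \int[m2]_y \int[m1]_x h x y.
Proof.
move=> ih i2 i1.
have E := @Fubini _ _ _ _ R m1 m2 _ ih.
rewrite /Rintegral; congr fine.
transitivity (\int[m1]_x \int[m2]_y (h x y)%:E)%E.
  by apply: eq_integral => x _; rewrite fineK//; apply: (integrable_fin_num measurableT).
rewrite [LHS]E; apply: eq_integral => y _.
by rewrite fineK//; apply: (integrable_fin_num measurableT).
Qed.

Lemma integrable_prod_le {d1 d2} {T1 : measurableType d1} {T2 : measurableType d2}
  (m1 : {sigma_finite_measure set T1 -> \bar R}) (m2 : {sigma_finite_measure set T2 -> \bar R})
  (h : T1 -> T2 -> R) (g1 : T1 -> R) (g2 : T2 -> R) :
  measurable_fun setT (fun z : T1 * T2 => h z.1 z.2) ->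
  m1.-integrable setT (EFin \o g1) -> m2.-integrable setT (EFin \o g2) ->
  (forall x y, `|h x y| <= `|g1 x| * `|g2 y|) ->
  (m1 \x m2)%E.-integrable setT (fun z => (h z.1 z.2)%:E).
Proof.
move=> mh /integrableP[mg1 g1oo] /integrableP[mg2 g2oo] hg.
have mh' : measurable_fun setT (fun z : T1 * T2 => (h z.1 z.2)%:E) by exact/measurable_EFinP.
apply/(integrable12ltyP m1 m2 mh').
have m1g : measurable_fun setT (fun x => `|(g1 x)%:E|)%E by exact: measurableT_comp.
have m2g : measurable_fun setT (fun x => `|(g2 x)%:E|)%E by exact: measurableT_comp.
apply: (@le_lt_trans _ _ (\int[m1]_x (`|(g1 x)%:E| * \int[m2]_y `|(g2 y)%:E|))%E).
  apply: ge0_le_integral => //.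
  - by move=> x _; exact: integral_ge0.
  - apply: (@measurable_integral_param _ _ _ m2 _ T1 (fun x y => `|(h x y)%:E|)%E) => //.
    exact: measurableT_comp.
  - apply: emeasurable_funM => //; exact: measurable_cst.
  move=> x _; rewrite -ge0_integralZl//.
  apply: ge0_le_integral => //.
  - apply: measurableT_comp => //; apply/measurable_EFinP.
    exact: measurable_curry1.
  - exact: measurable_funeM.
  - by move=> y _ /=; rewrite lee_fin.
rewrite ge0_integralZr//; last exact: integral_ge0.
have g1f : (\int[m1]_x `|(g1 x)%:E| \is a fin_num)%E by rewrite ge0_fin_numE// integral_ge0.
by apply: lte_mul_pinfty => //; exact: integral_ge0.
Qed.

Lemma Rintegral_affine n (a : R) (c : 'rV[R]_n) (f : 'rV[R]_n -> R) :
  a != 0 -> (mu n).-integrable setT (EFin \o f) ->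
  \int[mu n]_x f (a *: x + c) = `|a|^-1 ^+ n * \int[mu n]_x f x.
Proof.
move=> a0 fi; rewrite /Rintegral (@integral_affine _ n a c (EFin \o f))// fineM//.
exact: (integrable_fin_num measurableT).
Qed.

Lemma Rintegral_shift n (c : 'rV[R]_n) (f : 'rV[R]_n -> R) :
  (mu n).-integrable setT (EFin \o f) -> \int[mu n]_x f (x + c) = \int[mu n]_x f x.
Proof.
move=> fi; have := @Rintegral_affine n 1 c f (oner_neq0 _) fi.
rewrite normr1 invr1 expr1n mul1r => <-.
by apply: eq_Rintegral => x _; rewrite scale1r.
Qed.

Lemma Rintegral_reflect n (c : 'rV[R]_n) (f : 'rV[R]_n -> R) :
  (mu n).-integrable setT (EFin \o f) -> \int[mu n]_x f (c - x) = \int[mu n]_x f x.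
Proof.
move=> fi; have N1 : -1 != 0 :> R by rewrite oppr_eq0 oner_neq0.
have := @Rintegral_affine n (-1) c f N1 fi.
rewrite normrN1 invr1 expr1n mul1r => <-.
by apply: eq_Rintegral => x _; rewrite scaleN1r addrC.
Qed.

Lemma Rintegral_dominated_cvg {d} {T : measurableType d} (m : {measure set T -> \bar R})
  (fk : nat -> T -> R) (f g : T -> R) :
  (forall k, measurable_fun setT (fk k)) -> measurable_fun setT f ->
  m.-integrable setT (EFin \o g) ->
  (forall x, fk k x @[k --> \oo] --> f x) ->
  (forall k x, `|fk k x| <= g x) ->
  (\int[m]_x fk k x) @[k --> \oo] --> \int[m]_x f x.
Proof.
move=> mfk mf gi fkf fkg.
have [|||||fi _ C] := @dominated_convergence _ T R m setT measurableT (fun k x => (fk k x)%:E)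
  (EFin \o f) (EFin \o g).
- by move=> k; apply/measurable_EFinP.
- exact/measurable_EFinP.
- by apply: aeW => x _; apply: cvg_EFin; [exact: nearW|exact: fkf].
- exact: gi.
- by apply: aeW => x k _ /=; rewrite lee_fin.
apply: fine_cvg; rewrite fineK//.
exact: (integrable_fin_num measurableT).
Qed.

Section dominated.
Context {n : nat}.
Local Notation V := 'rV[R]_n.
Implicit Types (f g : V -> R) (C : R).

Lemma dominated_le f g C : measurable_fun setT g -> dominated f ->
  (forall x, `|g x| <= C * `|f x|) -> dominated g.
Proof.
move=> mg [mf [D fD]] gC; split=> //; exists (`|C| * D) => x.
apply: (le_trans (gC x)); apply: (@le_trans _ _ (`|C| * `|f x|)).
  by rewrite ler_wpM2r// ler_norm.
by rewrite -mulrA ler_wpM2l.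
Qed.

Lemma dominatedM f g : measurable_fun setT g -> (exists C, forall x, `|g x| <= C) ->
  dominated f -> dominated (fun x => f x * g x).
Proof.
move=> mg [C gC] df; apply: (@dominated_le f _ C) => //.
  by apply: measurable_funM => //; exact: df.1.
by move=> x; rewrite normrM mulrC ler_wpM2r.
Qed.

Lemma dominatedD f g : dominated f -> dominated g -> dominated (fun x => f x + g x).
Proof.
move=> [mf [C fC]] [mg [D gD]]; split; first exact: measurable_funD.
exists (C + D) => x; rewrite mulrDl; apply: (le_trans (ler_normD _ _)).
exact: lerD.
Qed.

Lemma dominatedZ (c : R) f : dominated f -> dominated (fun x => c * f x).
Proof.
move=> df; apply: (@dominated_le f _ `|c|) => //.
  by apply: measurable_funM => //; exact: df.1.
by move=> x; rewrite normrM.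
Qed.

Lemma dominatedB f g : dominated f -> dominated g -> dominated (fun x => f x - g x).
Proof.
move=> df dg; have := dominatedD df (dominatedZ (-1) dg).
by congr dominated; apply/funext => x; rewrite mulN1r.
Qed.

Lemma normr_Rintegral_le f C : measurable_fun setT f -> (forall x, `|f x| <= C * decay x) ->
  `|\int[mu n]_x f x| <= C * pi ^+ n.
Proof.
move=> mf fC.
have fi : (mu n).-integrable setT (EFin \o f) by apply: dominated_integrable; split => //; exists C.
apply: (le_trans (le_normr_Rintegral measurableT fi)).
have -> : C * pi ^+ n = \int[mu n]_x (C * decay x).
  rewrite RintegralZl//; last exact: integrable_decay.
  by rewrite /Rintegral integral_decay.
apply: le_Rintegral => //.
- exact: (@integrable_abse _ _ _ _ _ (EFin \o f)).
- by apply: dominated_integrable; apply: dominatedZ; split; [exact: measurable_decay|exists 1 => x; rewrite mul1r ger0_norm// ltW// decay_gt0].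
Qed.

(** Measurability of partial integrals is at hand for nonnegative integrands. Adding the majorant C
    [decay] makes h nonnegative, and its integral, a constant, is subtracted again. *)
Lemma measurable_Rintegral_param d (T : measurableType d) (h : T -> V -> R) C :
  measurable_fun setT (fun z : T * V => h z.1 z.2) ->
  (forall q x, `|h q x| <= C * decay x) ->
  measurable_fun setT (fun q => \int[mu n]_x h q x).
Proof.
move=> mh hC.
have dC : dominated (fun x : V => C * decay x).
  by apply: dominatedZ; split; [exact: measurable_decay|exists 1 => x; rewrite mul1r ger0_norm// ltW// decay_gt0].
have mhq q : measurable_fun setT (h q).
  exact: measurable_curry1.
have -> : (fun q => \int[mu n]_x h q x) =
    (fun q => fine (\int[mu n]_x (h q x + C * decay x)%:E)%E - \int[mu n]_x (C * decay x)).
  apply/funext => q; rewrite -[fine _]/(\int[mu n]_x (h q x + C * decay x)) RintegralD//.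
  - by rewrite addrK.
  - by apply: dominated_integrable; split => //; exists C.
  - exact: dominated_integrable.
apply: measurable_funB => //.
apply: measurableT_comp => //.
apply: (@measurable_integral_param _ _ _ (mu n) _ T (fun q x => (h q x + C * decay x)%:E)).
  apply/measurable_EFinP; apply: measurable_funD => //.
  by apply: (measurableT_comp dC.1).
by move=> q x; rewrite lee_fin -lerBlDr sub0r; have /ler_normlP[] := hC q x; rewrite lerNl.
Qed.

(** A majorant of product form yields joint integrability and that of all slices at once; every
    exchange of this kind below rests on it. *)
Lemma Rintegral_swap d (T : measurableType d) (m : {sigma_finite_measure set T -> \bar R})
  (h : V -> T -> R) (g1 : T -> R) C :
  measurable_fun setT (fun z : V * T => h z.1 z.2) ->
  m.-integrable setT (EFin \o g1) ->
  (forall x y, `|h x y| <= C * decay x * `|g1 y|) ->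
  \int[mu n]_x \int[m]_y h x y = \int[m]_y \int[mu n]_x h x y.
Proof.
move=> mh ig hC.
have dC : dominated (fun x : V => C * decay x).
  by apply: dominatedZ; split; [exact: measurable_decay|exists 1 => x; rewrite mul1r ger0_norm// ltW// decay_gt0].
apply: Rintegral_Fubini.
- apply: (@integrable_prod_le _ _ _ _ (mu n) m h (fun x => C * decay x) g1) => //.
    exact: dominated_integrable.
  by move=> x y; apply: (le_trans (hC x y)); rewrite ler_wpM2r// ler_norm.
- move=> x; apply: (@le_integrable _ _ _ _ _ measurableT _ (fun y => (C * decay x)%:E * (g1 y)%:E)%E).
  + apply/measurable_EFinP.
    exact: measurable_curry1.
  + move=> y _ /=; rewrite lee_fin; apply: (le_trans (hC x y)).
    by rewrite normrM ler_wpM2r// ler_norm.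
  + exact: integrableZl.
- move=> y; apply: dominated_integrable; split.
    exact: (measurable_curry2 y mh).
  by exists (C * `|g1 y|) => x; rewrite mulrAC.
Qed.

End dominated.
End real_integrals.

(** * Derivatives along lines *)

Section lines.
Context {R : realType} {V : normedModType R}.

Lemma is_derive_line (f : V -> R) (x v : V) (t : R) (d : R) :
  is_derive (x + t *: v) v f d -> is_derive t 1 (fun t => f (x + t *: v)) d.
Proof.
have E : (fun h : R => h^-1 *: (f (x + (h *: (1 : R) + t) *: v) - f (x + t *: v))) =
         (fun h : R => h^-1 *: (f (h *: v + (x + t *: v)) - f (x + t *: v))).
  apply/funext => h; congr (_ *: (f _ - _)).
  by rewrite scaler1 scalerDl addrCA.
by move=> [H1 H2]; split; [rewrite /derivable E|rewrite /derive E].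
Qed.

Lemma is_derive_line0 (f : V -> R) (x v : V) (d : R) :
  is_derive (0 : R) 1 (fun t => f (x + t *: v)) d -> is_derive x v f d.
Proof.
have E : (fun h : R => h^-1 *: (f (x + (h *: (1 : R) + 0) *: v) - f (x + (0 : R) *: v))) =
         (fun h : R => h^-1 *: (f (h *: v + x) - f x)).
  apply/funext => h; congr (_ *: (f _ - f _)); last by rewrite scale0r addr0.
  by rewrite scaler1 addr0 addrC.
by move=> [H1 H2]; split; [move: H1; rewrite /derivable E|move: H2; rewrite /derive E].
Qed.

Lemma mvt_line (f : V -> R) (v : V) (x : V) (t : R) :
  (forall y, derivable f y v) -> 0 <= t ->
  exists c : R, 0 <= c <= t /\ f (x + t *: v) - f x = 'D_v f (x + c *: v) * t.
Proof.
move=> df t0.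
have D (c : R) : is_derive c 1 (fun t => f (x + t *: v)) ('D_v f (x + c *: v)).
  by apply: is_derive_line; exact/derivableP.
have [|c ct] := @MVT_segment R (fun t => f (x + t *: v)) (fun c => 'D_v f (x + c *: v)) 0 t t0 (fun c _ => D c).
  by apply: derivable_within_continuous => c _; have [] := D c.
rewrite scale0r addr0 subr0 => E; exists c; split => //.
Qed.

End lines.

Section partials.
Context {R : realType} {n : nat}.
Local Notation V := 'rV[R]_n.
Local Notation e_ i := (delta_mx 0 i : V).
Implicit Types (f g h : V -> R) (i : 'I_n).

(** Only coordinate i changes. With t its value, 3(1 + (t+c)^2) - (1 + t^2) = (2t + 3c)^2/2 + 2 -
    3c^2/2, which is positive for |c| <= 1. *)
Lemma decay_shift i (c : R) (x : V) : `|c| <= 1 -> decay (x + c *: e_ i) <= 3 * decay x.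
Proof.
move=> c1; rewrite /decay (bigD1 i)//= [in leRHS](bigD1 i)//= mulrA.
have E : \prod_(j < n | j != i) (oneDsqr ((x + c *: e_ i) ord0 j))^-1 =
         \prod_(j < n | j != i) (oneDsqr (x ord0 j))^-1.
  by apply: eq_bigr => j ji; rewrite !mxE (negbTE ji) andbF mulr0 addr0.
rewrite E ler_wpM2r//; first by apply: prodr_ge0 => j _; rewrite invr_ge0 ltW// oneDsqr_gt0.
rewrite !mxE !eqxx mulr1 ler_pdivlMr ?oneDsqr_gt0// mulrC ler_pdivrMr ?oneDsqr_gt0//.
rewrite /oneDsqr; have c2 : c ^+ 2 <= 1 by rewrite -real_normK ?num_real// expr_le1.
have := sqr_ge0 (2 * x ord0 i + 3 * c); have := sqr_ge0 (x ord0 i); nra.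
Qed.

(* The difference quotients integrate to 0 by translation invariance;
   pass to the limit by dominated convergence. *)
Lemma integral_partial0 i h (C : R) :
  (forall x, derivable h x (e_ i)) -> dominated h -> measurable_fun setT (partial i h) ->
  (forall x, `|partial i h x| <= C * decay x) ->
  \int[mu n]_x partial i h x = 0.
Proof.
move=> dh hd mp pC.
pose dq (k : nat) (x : V) := k.+1%:R * (h (x + k.+1%:R^-1 *: e_ i) - h x).
have ih := dominated_integrable hd.
have hs c : (mu n).-integrable setT (EFin \o (fun x => h (x + c))).
  have := @integrable_affine _ n 1 c (EFin \o h) (oner_neq0 _) ih.
  by apply: eq_integrable => // x _ /=; rewrite scale1r.
have I0 k : \int[mu n]_x dq k x = 0.
  rewrite /dq RintegralZl//; last first.
    by have := integrableB measurableT (hs (k.+1%:R^-1 *: e_ i)) ih; apply: eq_integrable.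
  by rewrite RintegralB// Rintegral_shift// subrr mulr0.
have C0 : 0 <= C.
  have := le_trans (normr_ge0 _) (pC 0); rewrite pmulr_lge0// decay_gt0//.
have : \int[mu n]_x dq k x @[k --> \oo] --> \int[mu n]_x partial i h x.
  apply: (@Rintegral_dominated_cvg _ _ _ _ _ _ (fun x => 3 * C * decay x)) => //.
  - move=> k; apply: measurable_funM => //; apply: measurable_funB; last exact: hd.1.
    by have /integrableP[/measurable_EFinP] := hs (k.+1%:R^-1 *: e_ i).
  - apply: dominated_integrable; apply: dominatedZ; split; first exact: measurable_decay.
    by exists 1 => x; rewrite mul1r ger0_norm// ltW// decay_gt0.
  - move=> x; have /cvg_ex[/= l Hl] := dh x.
    have -> : partial i h x = l by exact/cvg_lim.
    move/cvgr_dnbhsP : Hl => /(_ (fun k => k.+1%:R^-1)).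
    have -> : (fun k => k.+1%:R^-1^-1 *: (h (k.+1%:R^-1 *: e_ i + x) - h x)) = dq^~ x.
      by apply/funext => k; rewrite /dq invrK [_ *: _ + x]addrC.
    apply; split; first by move=> k; rewrite invr_eq0 pnatr_eq0.
    by apply/cvgrPdist_lt => e e0; near=> k; rewrite sub0r normrN ger0_norm ?invr_ge0//; near: k; exact: near_infty_natSinv_lt (PosNum e0).
  move=> k x; rewrite /dq.
  have r0 : 0 <= k.+1%:R^-1 :> R by rewrite invr_ge0.
  have [c [/andP[c0 ck] ->]] := mvt_line x dh r0.
  rewrite mulrCA mulfV ?pnatr_eq0// mulr1.
  apply: (le_trans (pC _)); rewrite -mulrA [leRHS]mulrCA; apply: ler_wpM2l => //.
  apply: decay_shift; rewrite ger0_norm//; apply: (le_trans ck).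
  by rewrite invf_le1 ?ltr0n// ler1n.
under eq_cvg do rewrite I0.
by move=> H; apply/esym; apply: (cvg_unique _ (@cvg_cst _ 0 _ _ _) H).
Unshelve. all: by end_near. Qed.

Lemma smooth_derivable f : smooth f -> forall i x, derivable f x (e_ i).
Proof. by move=> fs i x; exact: (fs [::]).2. Qed.

Lemma smooth_continuous f : smooth f -> continuous f.
Proof. by move=> fs; exact: (fs [::]).1. Qed.

Lemma iter_partial_rcons (l : seq 'I_n) i f :
  iter_partial (rcons l i) f = iter_partial l (partial i f).
Proof. by rewrite /iter_partial -cats1 foldr_cat. Qed.

Lemma smooth_partial i f : smooth f -> smooth (partial i f).
Proof. by move=> fs l; rewrite -iter_partial_rcons; exact: fs. Qed.

Lemma iter_partialB (l : seq 'I_n) f g : smooth f -> smooth g ->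
  iter_partial l (fun x => f x - g x) = (fun x => iter_partial l f x - iter_partial l g x).
Proof.
move=> fs gs; elim: l => // i l IH; rewrite [LHS]/= -/(iter_partial l _) IH.
apply/funext => x; apply: (@deriveB _ _ _ (iter_partial l f) (iter_partial l g)).
  exact: (fs l).2.
exact: (gs l).2.
Qed.

Lemma smoothB f g : smooth f -> smooth g -> smooth (fun x => f x - g x).
Proof.
move=> fs gs l; rewrite iter_partialB//; split.
  by move=> x; exact: (cvgB ((fs l).1 x) ((gs l).1 x)).
move=> i x; apply: (@derivableB _ _ _ (iter_partial l f) (iter_partial l g)).
  exact: (fs l).2.
exact: (gs l).2.
Qed.

(** For products the induction runs on the order: one derivative of f g is a sum of two products of
    smooth functions, and only finite-order regularity of these is known at that stage. *)
Definition smooth_upto k f := forall l : seq 'I_n, (size l <= k)%N ->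
  continuous (iter_partial l f) /\
  forall i (x : V), derivable (iter_partial l f) x (e_ i).

Lemma iter_partialD (l : seq 'I_n) f g : smooth_upto (size l) f -> smooth_upto (size l) g ->
  iter_partial l (fun x => f x + g x) = (fun x => iter_partial l f x + iter_partial l g x).
Proof.
elim: l => // i l IH fs gs; rewrite [LHS]/= -/(iter_partial l _) IH; last 2 first.
  by move=> m ml; apply: fs; rewrite (leq_trans ml)/=.
  by move=> m ml; apply: gs; rewrite (leq_trans ml)/=.
apply/funext => x; apply: (@deriveD _ _ _ (iter_partial l f) (iter_partial l g)).
  by apply: (fs l _).2; rewrite /=.
by apply: (gs l _).2; rewrite /=.
Qed.

Lemma smooth_uptoM k f g : smooth f -> smooth g -> smooth_upto k (fun x => f x * g x).
Proof.
elim: k f g => [|k IH] f g fs gs l.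
  rewrite leqn0 size_eq0 => /eqP ->; split.
    by move=> x; exact: (cvgM ((fs [::]).1 x) ((gs [::]).1 x)).
  by move=> i x; apply: (@derivableM _ _ f g); exact: smooth_derivable.
(* The last index of the list is the derivative applied first, so the list is taken apart from its
   end. *)
case/lastP: l => [_|l i].
  by apply: (IH f g).
rewrite size_rcons ltnS => lk.
have E : partial i (fun x => f x * g x) = (fun x => f x * partial i g x + g x * partial i f x).
  apply/funext => x; apply: (@deriveM _ _ f g); exact: smooth_derivable.
rewrite iter_partial_rcons E.
have H1 := IH f _ fs (smooth_partial i gs).
have H2 := IH g _ gs (smooth_partial i fs).
rewrite iter_partialD; last 2 first.
  by move=> m ml; apply: H1; exact: leq_trans lk.
  by move=> m ml; apply: H2; exact: leq_trans lk.
split.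
  by move=> x; exact: (cvgD ((H1 l lk).1 x) ((H2 l lk).1 x)).
move=> j x; apply: (@derivableD _ _ _ (iter_partial l _) (iter_partial l _)).
  exact: (H1 l lk).2.
exact: (H2 l lk).2.
Qed.

Lemma smoothM f g : smooth f -> smooth g -> smooth (fun x => f x * g x).
Proof. by move=> fs gs l; exact: (smooth_uptoM fs gs (leqnn (size l))). Qed.

Lemma compact_support_sub f g : compact_support f -> (forall x, f x = 0 -> g x = 0) ->
  compact_support g.
Proof.
move=> fc fg; apply: (subclosed_compact _ fc); first exact: closed_closure.
by apply: closure_subset => x /=; apply: contra_neq; exact: fg.
Qed.

(** Off the closed support f vanishes on a whole neighbourhood, hence so does its derivative at the
    point. *)
Lemma compact_support_partial i f : compact_support f -> compact_support (partial i f).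
Proof.
move=> fc; apply: (subclosed_compact _ fc); first exact: closed_closure.
move/closure_id : (@closed_closure _ [set x | f x != 0]) => ->.
apply: closure_subset => x /= px; apply: contrapT => nx; move/eqP : px; apply.
have : nbhs x (~` closure [set x | f x != 0]).
  by apply: open_nbhs_nbhs; split => //; apply: closed_openC; exact: closed_closure.
move=> nb; rewrite /partial.
have E : {near x, f =1 cst 0}.
  apply: filterS nb => y /= ny; apply/eqP; apply: contra_notT ny => fy.
  exact: subset_closure.
by rewrite (near_eq_derive _ E) derive_cst.
Qed.

Lemma Cc_infty_partial i f : Cc_infty f -> Cc_infty (partial i f).
Proof. by move=> [fs fc]; split; [exact: smooth_partial|exact: compact_support_partial]. Qed.

Lemma compact_supportB f g : compact_support f -> compact_support g ->
  compact_support (fun x => f x - g x).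
Proof.
move=> fc gc; have fgc := compactU fc gc.
apply: (subclosed_compact _ fgc); first exact: closed_closure.
rewrite -closureU; apply: closure_subset => x /=.
have [->|] := eqVneq (f x) 0; last by left.
by have [->|] := eqVneq (g x) 0; [rewrite subrr eqxx|right].
Qed.

Lemma Cc_inftyB f g : Cc_infty f -> Cc_infty g -> Cc_infty (fun x => f x - g x).
Proof.
by move=> [fs fc] [gs gc]; split; [exact: smoothB|exact: compact_supportB].
Qed.

Lemma Cc_inftyM f g : Cc_infty f -> Cc_infty g -> Cc_infty (fun x => f x * g x).
Proof.
move=> [fs fc] [gs gc]; split; first exact: smoothM.
by apply: (compact_support_sub fc) => x ->; rewrite mul0r.
Qed.

Lemma Cc_infty_measurable f : Cc_infty f -> measurable_fun setT f.
Proof. by move=> [fs _]; apply: continuous_measurable_rV; exact: smooth_continuous. Qed.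

Lemma continuous_bounded_on (K : set V) f : compact K -> continuous f ->
  exists2 M : R, 0 <= M & forall x, K x -> `|f x| <= M.
Proof.
move=> cK cf.
have /compact_bounded[M [_ Mf]] : compact (f @` K).
  by apply: continuous_compact => //; apply: continuous_subspaceT.
exists (`|M| + 1); first by rewrite addr_ge0.
move=> x Kx; apply: (Mf (`|M| + 1)); last by exists x.
by rewrite (le_lt_trans (ler_norm M))// ltrDl.
Qed.

Lemma Cc_infty_dominated f : Cc_infty f -> dominated f.
Proof.
move=> Cf; have [fs fc] := Cf; split; first exact: Cc_infty_measurable.
have [M M0 fM] := continuous_bounded_on fc (smooth_continuous fs).
have [B B0 hB] : exists2 B : R, 0 <= B & forall x, closure [set x | f x != 0] x -> forall i, `|x ord0 i| <= B.
  have /choice[B hB] : forall i, exists B : R, 0 <= B /\ forall x, closure [set x | f x != 0] x -> `|x ord0 i| <= B.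
    move=> i; have [B B0 hB] := @continuous_bounded_on _ (fun x : V => x ord0 i) fc (@coord_continuous _ _ _ ord0 i).
    by exists B.
  exists (\sum_i B i); first by apply: sumr_ge0 => i _; exact: (hB i).1.
  move=> x xS i; apply: (le_trans ((hB i).2 x xS)).
  by rewrite (bigD1 i)//= lerDl; apply: sumr_ge0 => j _; exact: (hB j).1.
(* On the support every coordinate is at most B in absolute value, so [decay] is at least (1 +
   B^2)^(-n) there. *)
exists (M * (1 + B ^+ 2) ^+ n) => x.
have [xS|xS] := pselect (closure [set x | f x != 0] x); last first.
  have -> : f x = 0 by apply/eqP; apply: contra_notT xS => fx; exact: subset_closure.
  by rewrite normr0 mulr_ge0 ?(ltW (decay_gt0 _))// mulr_ge0// exprn_ge0// addr_ge0// sqr_ge0.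
apply: (le_trans (fM _ xS)); rewrite -mulrA ler_peMr//.
have -> : (1 + B ^+ 2) ^+ n = \prod_(i < n) (1 + B ^+ 2) by rewrite prodr_const card_ord.
rewrite /decay -big_split/=; elim/big_rec: _ => // i y _ y1; apply: mulr_ege1 => //.
rewrite ler_pdivlMr ?oneDsqr_gt0// mul1r /oneDsqr lerD2l -[leLHS]real_normK ?num_real//.
by rewrite lerXn2r ?nnegrE//; exact: hB.
Qed.

Lemma Cc_infty_bounded f : Cc_infty f -> exists2 M : R, 0 <= M & forall x, `|f x| <= M.
Proof.
move=> /Cc_infty_dominated[_ [C fC]]; exists `|C| => // x.
apply: (le_trans (fC x)); apply: (@le_trans _ _ (`|C| * decay x)).
  by rewrite ler_wpM2r ?ler_norm// ltW// decay_gt0.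
rewrite ler_piMr// /decay prodr_ile1// => i _; rewrite invr_ge0 ltW ?oneDsqr_gt0//=.
by rewrite invf_le1 ?oneDsqr_gt0// /oneDsqr lerDl sqr_ge0.
Qed.

(** The mean value theorem, one coordinate at a time. It serves to produce the scale [dl] from which
    John-Nirenberg starts. *)
Lemma Cc_infty_lipschitz f : Cc_infty f ->
  exists2 M : R, 0 <= M & forall x y, `|f x - f y| <= M * \sum_(i < n) `|x ord0 i - y ord0 i|.
Proof.
move=> Cf; have fs := Cf.1.
have [M M0 hM] : exists2 M : R, 0 <= M & forall i x, `|partial i f x| <= M.
  have /choice[M hM] : forall i, exists M : R, 0 <= M /\ forall x, `|partial i f x| <= M.
    by move=> i; have [M M0 hM] := Cc_infty_bounded (Cc_infty_partial i Cf); exists M.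
  exists (\sum_i M i); first by apply: sumr_ge0 => i _; exact: (hM i).1.
  move=> i x; apply: (le_trans ((hM i).2 x)).
  rewrite (bigD1 i)//= lerDl; apply: sumr_ge0 => j _; exact: (hM j).1.
have step i x (t : R) : `|f (x + t *: e_ i) - f x| <= M * `|t|.
  have [t0|t0] := leP 0 t.
    have [c [_ ->]] := mvt_line x (@smooth_derivable f fs i) t0.
    by rewrite normrM ler_wpM2r// (hM i).
  (* [mvt_line] only moves forward, so for negative t the segment is run from its other end. *)
  have t0' : 0 <= - t by rewrite oppr_ge0 ltW.
  have [c [_ E]] := mvt_line (x + t *: e_ i) (@smooth_derivable f fs i) t0'.
  have -> : f (x + t *: e_ i) - f x = - (f (x + t *: e_ i + - t *: e_ i) - f (x + t *: e_ i)).
    by rewrite scaleNr addrK opprB.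
  by rewrite E normrN normrM normrN ler_wpM2r// (hM i).
have steps (l : seq 'I_n) (d : 'I_n -> R) x :
    `|f (x + \sum_(i <- l) d i *: e_ i) - f x| <= M * \sum_(i <- l) `|d i|.
  elim: l x => [|i l IH] x; first by rewrite !big_nil addr0 subrr normr0 mulr0.
  rewrite !big_cons mulrDr addrA.
  rewrite -(subrKA (f (x + d i *: e_ i))) (le_trans (ler_normD _ _))// [leRHS]addrC lerD//.
exists M => // x y; have := steps (index_enum 'I_n) (fun i => x ord0 i - y ord0 i) y.
suff -> : y + \sum_i (x ord0 i - y ord0 i) *: e_ i = x by [].
have -> : \sum_i (x ord0 i - y ord0 i) *: e_ i = x - y.
  rewrite [RHS]row_sum_delta; apply: eq_bigr => i _; rewrite !mxE.
  by congr (_ *: _).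
by rewrite addrC subrK.
Qed.

End partials.

Section dot.
Context {R : realType} {n : nat}.
Implicit Types (x y z : 'rV[R]_n) (i : 'I_n).

Lemma dotRC x y : dotR x y = dotR y x.
Proof. by apply: eq_bigr => i _; rewrite mulrC. Qed.

Lemma dotRDl x y z : dotR (x + y) z = dotR x z + dotR y z.
Proof. by rewrite /dotR -big_split; apply: eq_bigr => i _; rewrite mxE mulrDl. Qed.

Lemma dotRZl c x z : dotR (c *: x) z = c * dotR x z.
Proof. by rewrite /dotR mulr_sumr; apply: eq_bigr => i _; rewrite mxE mulrA. Qed.

Lemma dotRNl x z : dotR (- x) z = - dotR x z.
Proof. by rewrite -scaleN1r dotRZl mulN1r. Qed.

Lemma dotRBl x y z : dotR (x - y) z = dotR x z - dotR y z.
Proof. by rewrite dotRDl dotRNl. Qed.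

Lemma dotRZr c x z : dotR x (c *: z) = c * dotR x z.
Proof. by rewrite dotRC dotRZl dotRC. Qed.

Lemma dotRNr x z : dotR x (- z) = - dotR x z.
Proof. by rewrite dotRC dotRNl dotRC. Qed.

Lemma dotR_delta i x : dotR (delta_mx 0 i) x = x ord0 i.
Proof.
rewrite /dotR (bigD1 i)//= mxE !eqxx mul1r big1 ?addr0// => j ji.
by rewrite mxE (negbTE ji) andbF mul0r.
Qed.

Lemma dotR_ge0 x : 0 <= dotR x x.
Proof. by apply: sumr_ge0 => i _; rewrite -expr2 sqr_ge0. Qed.

Lemma dotR_line i x y (t : R) : dotR (x + t *: delta_mx 0 i) y = dotR x y + t * y ord0 i.
Proof. by rewrite dotRDl dotRZl dotR_delta. Qed.

Lemma dotR_line_sqr i x (t : R) :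
  dotR (x + t *: delta_mx 0 i) (x + t *: delta_mx 0 i) = dotR x x + t * (2 * x ord0 i + t).
Proof.
rewrite dotR_line dotRC dotR_line !mxE !eqxx mulr1; ring.
Qed.

Lemma decay_le1 x : decay x <= 1.
Proof.
rewrite /decay prodr_ile1// => i _; rewrite invr_ge0 ltW ?oneDsqr_gt0//=.
by rewrite invf_le1 ?oneDsqr_gt0// /oneDsqr lerDl sqr_ge0.
Qed.

Lemma coord_decay_le1 i x : `|x ord0 i| * decay x <= 1.
Proof.
rewrite /decay (bigD1 i)//= mulrA; apply: mulr_ile1.
- by rewrite mulr_ge0// invr_ge0 ltW// oneDsqr_gt0.
- by apply: prodr_ge0 => j _; rewrite invr_ge0 ltW// oneDsqr_gt0.
- rewrite ler_pdivrMr ?oneDsqr_gt0// mul1r /oneDsqr -(@real_normK _ (x ord0 i)) ?num_real//.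
  by have := sqr_ge0 (`|x ord0 i| - 1); have := sqr_ge0 (`|x ord0 i|); nra.
- apply: prodr_ile1 => j _; rewrite invr_ge0 ltW ?oneDsqr_gt0//=.
  by rewrite invf_le1 ?oneDsqr_gt0// /oneDsqr lerDl sqr_ge0.
Qed.

End dot.

Section is_derive_aux.
Context {R : realType}.
Implicit Types (f g : R -> R).

Lemma is_derive_affine (a b t : R) : is_derive t 1 (fun t : R => a + t * b) b.
Proof.
have := is_deriveD (is_derive_cst a t 1) (is_deriveM (is_derive_id t 1) (is_derive_cst b t 1)).
move/is_derive_eq; apply; rewrite scaler0 !add0r; exact: mulr1.
Qed.

Lemma is_derive_sin_affine (a b t : R) :
  is_derive t 1 (fun t : R => sin (a + t * b)) (cos (a + t * b) * b).
Proof. exact: (@is_derive1_comp _ (@sin R) (fun t => a + t * b) _ _ _ (is_derive_sin _) (is_derive_affine a b t)). Qed.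

Lemma is_derive_cos_affine (a b t : R) :
  is_derive t 1 (fun t : R => cos (a + t * b)) (- sin (a + t * b) * b).
Proof. exact: (@is_derive1_comp _ (@cos R) (fun t => a + t * b) _ _ _ (is_derive_cos _) (is_derive_affine a b t)). Qed.

Lemma is_derive_expR_quadratic (A a b t : R) :
  is_derive t 1 (fun t : R => expR (A * (a + t * (b + t)))) (expR (A * (a + t * (b + t))) * (A * (b + 2 * t))).
Proof.
have q : is_derive t 1 (fun t : R => A * (a + t * (b + t))) (A * (b + 2 * t)).
  have := is_deriveM (is_derive_cst A t 1) (is_deriveD (is_derive_cst a t 1)
    (is_deriveM (is_derive_id t 1) (is_deriveD (is_derive_cst b t 1) (is_derive_id t 1)))).
  by move/is_derive_eq; apply; rewrite /GRing.scale/= !fctE; ring.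
exact: (@is_derive1_comp _ (@expR R) (fun t => A * (a + t * (b + t))) _ _ _ (is_derive_expR _) q).
Qed.

End is_derive_aux.

(** * Fourier transforms *)

Section gaussian.
Context {R : realType} {n : nat}.
Local Notation leb := (@lebesgue_measure R).
Local Notation V := 'rV[R]_n.
Local Notation e_ i := (delta_mx 0 i : V).
Variable A : R.
Hypothesis A0 : 0 < A.

Definition gauss (x : V) : R := expR (- A * dotR x x).

Lemma gauss_gt0 x : 0 < gauss x.
Proof. exact: expR_gt0. Qed.

Lemma gaussE x : gauss x = \prod_(i < n) expR (- A * x ord0 i ^+ 2).
Proof. by rewrite /gauss /dotR mulr_sumr expR_sum. Qed.

Lemma measurable_gauss : measurable_fun setT gauss.
Proof.
apply: measurableT_comp => //; apply: measurable_funM => //.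
by apply: measurable_dotR; exact: measurable_id.
Qed.

(** Two copies of [decay], so that one is left after the other has absorbed a coordinate in
    [dominated_coord_gauss]. In each coordinate half of the exponent pays for one copy, through
    exp(A t^2/2) >= 1 + A t^2/2. *)
Lemma gauss_le_decay : exists2 C : R, 0 <= C & forall x, gauss x <= C * (decay x * decay x).
Proof.
have c0 : 0 <= 1 + 2 / A by rewrite addr_ge0// divr_ge0// ltW.
exists (((1 + 2 / A) ^+ 2) ^+ n); first by rewrite !exprn_ge0.
move=> x; rewrite gaussE.
have -> : ((1 + 2 / A) ^+ 2) ^+ n = \prod_(i < n) (1 + 2 / A) ^+ 2 by rewrite prodr_const card_ord.
rewrite /decay -!big_split/=; apply: ler_prod => i _; rewrite expR_ge0/=.
set t := x ord0 i.
have -> : - A * t ^+ 2 = - (A * t ^+ 2 / 2) + - (A * t ^+ 2 / 2) by field.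
rewrite expRD -expr2 -[X in _ <= _ * X]expr2 -exprMn lerXn2r ?nnegrE ?expR_ge0//.
  by rewrite mulr_ge0// invr_ge0 ltW// oneDsqr_gt0.
rewrite ler_pdivlMr ?oneDsqr_gt0// expRN mulrC ler_pdivrMr ?expR_gt0//.
have E := expR_ge1Dx (A * t ^+ 2 / 2).
apply: (@le_trans _ _ ((1 + 2 / A) * (1 + A * t ^+ 2 / 2))); last by rewrite ler_wpM2l.
have -> : (1 + 2 / A) * (1 + A * t ^+ 2 / 2) = 1 + t ^+ 2 + (A * t ^+ 2 / 2 + 2 / A).
  by field; rewrite gt_eqF.
rewrite [leLHS]/(1 + t ^+ 2) lerDl; apply: addr_ge0; apply: divr_ge0 => //; last exact: ltW.
by apply: mulr_ge0; [exact: ltW|exact: sqr_ge0].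
Qed.

Lemma dominated_gauss : dominated gauss.
Proof.
have [C C0 hC] := gauss_le_decay; split; first exact: measurable_gauss.
exists C => x; rewrite ger0_norm ?(ltW (gauss_gt0 _))//; apply: (le_trans (hC x)).
by rewrite ler_wpM2l// ler_piMl ?decay_le1// ltW// decay_gt0.
Qed.

Lemma dominated_coord_gauss i : dominated (fun x => x ord0 i * gauss x).
Proof.
have [C C0 hC] := gauss_le_decay; split.
  by apply: measurable_funM; [exact: measurable_coord|exact: measurable_gauss].
exists C => x; rewrite normrM (ger0_norm (ltW (gauss_gt0 _))).
apply: (@le_trans _ _ (`|x ord0 i| * (C * (decay x * decay x)))); first by rewrite ler_wpM2l.
have -> : `|x ord0 i| * (C * (decay x * decay x)) = C * ((`|x ord0 i| * decay x) * decay x) by ring.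
by rewrite ler_wpM2l// ler_piMl ?coord_decay_le1// ltW// decay_gt0.
Qed.

Variables (eta : V) (th : R).

Let arg (t : R) (x : V) := t * dotR x eta + th.

Let measurable_arg t : measurable_fun setT (arg t).
Proof.
apply: measurable_funD => //; apply: measurable_funM => //.
by apply: measurable_dotR => //; exact: measurable_id.
Qed.

Lemma gauss_sin_partial i (t : R) (x : V) :
  is_derive x (e_ i) (fun x => gauss x * sin (arg t x))
   (- (2 * A) * (x ord0 i * gauss x * sin (arg t x)) + t * eta ord0 i * (gauss x * cos (arg t x))).
Proof.
apply: is_derive_line0.
have E : (fun c : R => gauss (x + c *: e_ i) * sin (arg t (x + c *: e_ i))) =
    (fun c : R => expR (- A * (dotR x x + c * (2 * x ord0 i + c)))) *
    (fun c : R => sin (arg t x + c * (t * eta ord0 i))).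
  apply/funext => c; rewrite /gauss /arg dotR_line_sqr dotR_line; congr (_ * sin _); ring.
rewrite E.
have := is_deriveM (is_derive_expR_quadratic (- A) (dotR x x) (2 * x ord0 i) 0)
  (is_derive_sin_affine (arg t x) (t * eta ord0 i) 0).
move/is_derive_eq; apply; rewrite /GRing.scale/= /gauss !mul0r !addr0.
ring.
Qed.

Lemma dominatedMsin (f a : V -> R) : measurable_fun setT a -> dominated f ->
  dominated (fun x => f x * sin (a x)).
Proof.
move=> ma df; apply: dominatedM => //.
  by apply: measurableT_comp => //; apply: continuous_measurable_fun; exact: continuous_sin.
by exists 1 => x; exact: sin_max.
Qed.

Lemma dominatedMcos (f a : V -> R) : measurable_fun setT a -> dominated f ->
  dominated (fun x => f x * cos (a x)).
Proof.
move=> ma df; apply: dominatedM => //.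
  by apply: measurableT_comp => //; apply: continuous_measurable_fun; exact: continuous_cos.
by exists 1 => x; exact: cos_max.
Qed.

(** The transform along the ray t [eta]. It solves a linear differential equation of first order in
    t, which determines its value at 1 from that at 0. *)
Let Phi (t : R) := \int[mu n]_x (gauss x * cos (arg t x)).

(** Integration by parts: the partial derivative of [gauss] times the sine integrates to 0. *)
Lemma integral_coord_gauss_sin i t :
  2 * A * \int[mu n]_x (x ord0 i * gauss x * sin (arg t x)) = t * eta ord0 i * Phi t.
Proof.
have d1 := dominatedMsin (measurable_arg t) (dominated_coord_gauss i).
have d2 := dominatedMcos (measurable_arg t) dominated_gauss.
have pE : partial i (fun x => gauss x * sin (arg t x)) = (fun x =>
   - (2 * A) * (x ord0 i * gauss x * sin (arg t x)) + t * eta ord0 i * (gauss x * cos (arg t x))).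
  by apply/funext => x; rewrite /partial; have /@derive_val -> := gauss_sin_partial i t x.
have [mp [C hC]] : dominated (partial i (fun x => gauss x * sin (arg t x))).
  by rewrite pE; apply: dominatedD; exact: dominatedZ.
have := @integral_partial0 _ n i (fun x => gauss x * sin (arg t x)) C
  (fun x => @ex_derive _ _ _ _ _ _ _ (gauss_sin_partial i t x)) (dominatedMsin (measurable_arg t) dominated_gauss) mp hC.
rewrite pE RintegralD//; last 2 first.
- exact: dominated_integrable (dominatedZ _ d1).
- exact: dominated_integrable (dominatedZ _ d2).
rewrite !RintegralZl//; try exact: dominated_integrable.
by move/eqP; rewrite mulNr addrC subr_eq0 eq_sym => /eqP.
Qed.

(** Differentiation under the integral, with a majorant that does not depend on t, brings down one
    factor x_i per coordinate; [integral_coord_gauss_sin] then turns each term back into [Phi]. *)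
Lemma is_derive_Phi (t : R) : is_derive t 1 Phi (- (t * dotR eta eta / (2 * A)) * Phi t).
Proof.
pose G (x : V) := \sum_(i < n) `|eta ord0 i * (x ord0 i * gauss x)|.
have dG : dominated G.
  have mG i : measurable_fun setT (fun x : V => `|eta ord0 i * (x ord0 i * gauss x)|).
    by apply: measurableT_comp => //; exact: (dominatedZ _ (dominated_coord_gauss i)).1.
  have /choice[C hC] := fun i => (dominatedZ (eta ord0 i) (dominated_coord_gauss i)).2.
  split; first exact: measurable_sum.
  exists (\sum_i C i) => x; rewrite ger0_norm ?sumr_ge0// mulr_suml; apply: ler_sum => i _.
  exact: hC.
have D1 (s : R) x : is_derive s 1 (fun s => gauss x * cos (arg s x)) (- (dotR x eta * (gauss x * sin (arg s x)))).
  have -> : (fun s => gauss x * cos (arg s x)) = cst (gauss x) * (fun s => cos (th + s * dotR x eta)).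
    by apply/funext => s'; rewrite /arg addrC.
  have := is_deriveM (is_derive_cst (gauss x) s 1) (is_derive_cos_affine th (dotR x eta) s).
  move/is_derive_eq; apply; rewrite /GRing.scale/= /arg [s * _ + th]addrC; ring.
pose f s (x : V) := gauss x * cos (arg s x).
have fi s : (mu n).-integrable setT (EFin \o f s).
  exact: dominated_integrable (dominatedMcos (measurable_arg s) dominated_gauss).
have pf s x : partial1of2 f s x = - (dotR x eta * (gauss x * sin (arg s x))).
  by rewrite partial1of2E; have /@derive_val -> := D1 s x.
have tI : `]t - 1, t + 1[%classic t by rewrite /= in_itv/= ltrBlDr ltrDl ltr01.
have derf s x : derivable (f^~ x) s 1 by have [] := D1 s x.
have fG s x : `|partial1of2 f s x| <= G x.
  rewrite pf normrN !normrM /dotR /G.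
  apply: (@le_trans _ _ (`|\sum_(i < n) x ord0 i * eta ord0 i| * `|gauss x|)).
    by rewrite ler_wpM2l// ler_piMr// sin_max.
  rewrite -normrM mulr_suml; apply: (le_trans (ler_norm_sum _ _ _)).
  by apply: ler_sum => i _; rewrite -mulrA mulrCA.
have G0 x : 0 <= G x by exact: sumr_ge0.
have DP := @derivable_under_integral R _ V (mu n) f setT measurableT t _ _ tI (fun s _ => fi s)
  (fun s x _ _ => derf s x) G G0 (dominated_integrable dG) (fun s x _ _ => fG s x).
have VP := @differentiation_under_integral R _ V (mu n) f setT measurableT t _ _ tI (fun s _ => fi s)
  (fun s x _ _ => derf s x) G G0 (dominated_integrable dG) (fun s x _ _ => fG s x).
have -> : - (t * dotR eta eta / (2 * A)) * Phi t = 'D_1 Phi t; last exact: derivableP.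
rewrite -derive1E VP; under eq_Rintegral do rewrite pf.
have A2 : 2 * A != 0 by rewrite mulf_neq0// gt_eqF.
have d1 i := dominatedMsin (measurable_arg t) (dominated_coord_gauss i).
have E x : - (dotR x eta * (gauss x * sin (arg t x))) =
    \sum_(i < n) (- eta ord0 i) * (x ord0 i * gauss x * sin (arg t x)).
  rewrite /dotR mulr_suml -sumrN; apply: eq_bigr => i _; ring.
under eq_Rintegral do rewrite E.
have -> : \int[mu n]_x (\sum_(i < n) (- eta ord0 i) * (x ord0 i * gauss x * sin (arg t x))) =
  \sum_(i < n) (- eta ord0 i) * \int[mu n]_x (x ord0 i * gauss x * sin (arg t x)).
  rewrite /Rintegral; under eq_integral do rewrite -sumEFin.
  rewrite integral_sum//; last by move=> i; exact: dominated_integrable (dominatedZ _ (d1 i)).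
  rewrite (eq_bigr (fun i => (- eta ord0 i * \int[mu n]_x (x ord0 i * gauss x * sin (arg t x)))%:E)) ?sumEFin//.
  move=> i _; rewrite -RintegralZl//; last exact: dominated_integrable.
  by rewrite fineK//; apply: (integrable_fin_num measurableT); exact: dominated_integrable (dominatedZ _ (d1 i)).
rewrite {1}/dotR mulr_sumr !mulr_suml -sumrN mulr_suml; apply: eq_bigr => i _.
apply: (mulfI A2).
rewrite [RHS]mulrCA integral_coord_gauss_sin; field.
by rewrite gt_eqF.
Qed.

Lemma gauss_fourier_aux : Phi 1 = expR (- (dotR eta eta / (4 * A))) * Phi 0.
Proof.
pose B := dotR eta eta / (4 * A).
(* The integrating factor exp(B t^2), spelled so that [is_derive_expR_quadratic] applies; the
   product has derivative 0. *)
pose Psi (t : R) := expR (B * (0 + t * (0 + t))) * Phi t.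
have D (t : R) : is_derive t 1 Psi 0.
  have := is_deriveM (is_derive_expR_quadratic B 0 0 t) (is_derive_Phi t).
  move/is_derive_eq; apply; rewrite /GRing.scale/= /B !add0r; field.
  by rewrite gt_eqF.
have := @is_derive_0_is_cst _ Psi 1 0 D.
rewrite /Psi !add0r !mul0r !mulr0 expR0 !mul1r mulr1 => <-.
by rewrite mulrA -expRD -/B addNr expR0 mul1r.
Qed.

Lemma gauss_fourier : \int[mu n]_x (gauss x * cos (dotR x eta + th)) =
  expR (- (dotR eta eta / (4 * A))) * cos th * \int[mu n]_x gauss x.
Proof.
have := gauss_fourier_aux; rewrite /Phi /arg.
under eq_Rintegral do rewrite mul1r.
move=> ->; rewrite -mulrA; congr (_ * _).
under eq_Rintegral do rewrite mul0r add0r.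
rewrite RintegralZr//; last exact: dominated_integrable dominated_gauss.
by rewrite mulrC.
Qed.

Lemma integral_gauss1 : (\int[leb]_t (expR (- A * t ^+ 2))%:E = (Num.sqrt pi / Num.sqrt A)%:E)%E.
Proof.
have sA : 0 < Num.sqrt A by rewrite sqrtr_gt0.
have mg : measurable_fun setT (fun t : R => (gauss_fun t)%:E).
  by apply/measurable_EFinP; exact: measurable_gauss_fun.
have := @ge0_integral_affine1 R (Num.sqrt A) 0 (fun t => (gauss_fun t)%:E) (lt0r_neq0 sA) mg.
rewrite integralT_gauss -EFinM gtr0_norm// mulrC => <- //.
  apply: eq_integral => t _; rewrite /gauss_fun addr0 exprMn sqr_sqrtr ?(ltW A0)//.
  by rewrite mulNr.
by move=> t; rewrite lee_fin gauss_fun_ge0.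
Qed.

Lemma integral_gauss : \int[mu n]_x gauss x = (Num.sqrt pi / Num.sqrt A) ^+ n.
Proof.
rewrite /Rintegral; under eq_integral do rewrite gaussE.
rewrite (@integral_prod_coord _ n (fun _ t => expR (- A * t ^+ 2)) (fun=> Num.sqrt pi / Num.sqrt A)).
- by rewrite /= prodr_const card_ord.
- by move=> i; apply: measurableT_comp => //; apply: measurable_funM => //.
- by move=> i t; exact: expR_ge0.
- by move=> i; exact: integral_gauss1.
Qed.

End gaussian.

Section phase.
Context {R : realType} d (T : measurableType d).

Lemma measurable_cos_comp (a : T -> R) : measurable_fun setT a ->
  measurable_fun setT (fun t => cos (a t)).
Proof.
move=> ma; apply: measurableT_comp => //.
by apply: continuous_measurable_fun; exact: continuous_cos.
Qed.

Lemma measurable_phase n (f g : T -> 'rV[R]_n) (a : T -> R) :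
  measurable_fun setT f -> measurable_fun setT g -> measurable_fun setT a ->
  measurable_fun setT (fun t => cos (2 * pi * dotR (f t) (g t) + a t)).
Proof.
move=> mf mg ma; apply: measurable_cos_comp; apply: measurable_funD => //.
by apply: measurable_funM => //; exact: measurable_dotR.
Qed.

End phase.

Section fourier.
Context {R : realType} {n : nat}.
Local Notation leb := (@lebesgue_measure R).
Local Notation V := 'rV[R]_n.
Local Notation e_ i := (delta_mx 0 i : V).
Implicit Types (f g : V -> R) (th rho : R) (x y z xi : V).

(* The phase [th] treats the cosine and sine transforms together. *)
Definition wcos f th xi : R := \int[mu n]_y (f y * cos (2 * pi * dotR y xi + th)).

Lemma dominated_phase f th xi : dominated f ->
  dominated (fun y => f y * cos (2 * pi * dotR y xi + th)).
Proof.
move=> df; apply: (dominatedMcos (a := fun y => 2 * pi * dotR y xi + th)) => //.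
apply: measurable_funD => //; apply: measurable_funM => //.
by apply: measurable_dotR => //; exact: measurable_id.
Qed.

Lemma measurable_wcos f d (T : measurableType d) (a : T -> R) (g : T -> V) : dominated f ->
  measurable_fun setT a -> measurable_fun setT g ->
  measurable_fun setT (fun t => wcos f (a t) (g t)).
Proof.
move=> [mf [C fC]] ma mg.
apply: (@measurable_Rintegral_param _ _ _ T (fun t y => f y * cos (2 * pi * dotR y (g t) + a t)) C).
  apply: measurable_funM; first exact: (measurableT_comp mf).
  apply: measurable_phase; first exact: measurable_snd.
    exact: (measurableT_comp mg).
  exact: (measurableT_comp ma).
move=> t y; rewrite normrM; apply: le_trans (fC y).
by rewrite ler_piMr// cos_max.
Qed.

Lemma gauss_sigma_fourier (sigma : R) xi th : 0 < sigma ->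
  \int[mu n]_x (gauss (pi / sigma ^+ 2) x * cos (2 * pi * dotR x xi + th)) =
  sigma ^+ n * expR (- pi * sigma ^+ 2 * dotR xi xi) * cos th.
Proof.
move=> s0; have A0 : 0 < pi / sigma ^+ 2 by rewrite divr_gt0 ?pi_gt0// exprn_gt0.
under eq_Rintegral do rewrite -dotRZr.
rewrite gauss_fourier// integral_gauss//.
have -> : Num.sqrt pi / Num.sqrt (pi / sigma ^+ 2) = sigma.
  rewrite sqrtrM ?pi_ge0// sqrtrV ?exprn_ge0 ?(ltW s0)// sqrtr_sqr gtr0_norm//.
  by rewrite invfM invrK mulrA mulfV ?mul1r// gt_eqF// sqrtr_gt0 pi_gt0.
have -> : - (dotR ((2 * pi) *: xi) ((2 * pi) *: xi) / (4 * (pi / sigma ^+ 2))) =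
    - pi * sigma ^+ 2 * dotR xi xi.
  have p0 : pi != 0 :> R by rewrite gt_eqF// pi_gt0.
  have s0' : sigma != 0 by rewrite gt_eqF.
  have G (P t v : R) : P != 0 -> t != 0 ->
      - (2 * P * (2 * P * v) / (4 * (P / t ^+ 2))) = - P * t ^+ 2 * v.
    by move=> P0 t0; field; rewrite t0.
  by rewrite dotRZl dotRZr G.
by ring.
Qed.

(** For rho > 0, the Gaussian of mass 1 whose Fourier transform is exp(- pi rho^2 |xi|^2). *)
Definition gamma rho x : R := rho ^- n * gauss (pi / rho ^+ 2) x.

Lemma gamma_ge0 rho x : 0 <= rho -> 0 <= gamma rho x.
Proof. by move=> r0; rewrite mulr_ge0 ?invr_ge0 ?exprn_ge0// ltW ?gauss_gt0. Qed.

Lemma dominated_gamma rho : 0 < rho -> dominated (gamma rho).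
Proof.
move=> r0; apply: dominatedZ; apply: dominated_gauss.
by rewrite divr_gt0 ?pi_gt0// exprn_gt0.
Qed.

Lemma gammaN rho x : gamma rho (- x) = gamma rho x.
Proof. by rewrite /gamma /gauss dotRNl dotRNr opprK. Qed.

Lemma gamma_fourier rho xi th : 0 < rho ->
  \int[mu n]_x (gamma rho x * cos (2 * pi * dotR x xi + th)) =
  expR (- pi * rho ^+ 2 * dotR xi xi) * cos th.
Proof.
move=> r0.
transitivity (\int[mu n]_x (rho ^- n * (gauss (pi / rho ^+ 2) x * cos (2 * pi * dotR x xi + th)))).
  by apply: eq_Rintegral => x _; rewrite mulrA.
rewrite RintegralZl//; last first.
  apply: dominated_integrable; apply: dominated_phase; apply: dominated_gauss.
  by rewrite divr_gt0 ?pi_gt0// exprn_gt0.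
by rewrite gauss_sigma_fourier// -!mulrA mulKf// expf_neq0// gt_eqF.
Qed.

Lemma wcos_le f th xi C : measurable_fun setT f -> (forall x, `|f x| <= C * decay x) ->
  `|wcos f th xi| <= C * pi ^+ n.
Proof.
move=> mf fC; apply: normr_Rintegral_le.
  by apply: (dominated_phase th xi _).1; split => //; exists C.
by move=> x; rewrite normrM; apply: le_trans (fC x); rewrite ler_piMr// cos_max.
Qed.

(** Integration by parts; in terms of the phase, a derivative is a shift by a quarter turn. Two of
    them therefore change the sign, which is used in [wcos_helm]. *)
Lemma wcos_partial f i th xi : Cc_infty f ->
  wcos (partial i f) th xi = 2 * pi * xi ord0 i * wcos f (th - pi / 2) xi.
Proof.
move=> Cf; have df := Cc_infty_dominated Cf.
have dpf := Cc_infty_dominated (Cc_infty_partial i Cf).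
pose h y := f y * cos (2 * pi * dotR y xi + th).
have D y : is_derive y (e_ i) h (partial i f y * cos (2 * pi * dotR y xi + th) +
    (- (2 * pi * xi ord0 i)) * (f y * cos (2 * pi * dotR y xi + (th - pi / 2)))).
  apply: is_derive_line0.
  have E : (fun c : R => h (y + c *: e_ i)) = (fun c : R => f (y + c *: e_ i)) *
     (fun c => cos ((2 * pi * dotR y xi + th) + c * (2 * pi * xi ord0 i))).
    by apply/funext => c; rewrite /h dotR_line; congr (_ * cos _); ring.
  rewrite E.
  have D1 : is_derive (0 : R) 1 (fun c : R => f (y + c *: e_ i)) (partial i f y).
    apply: is_derive_line; rewrite scale0r addr0; apply/derivableP.
    exact: (@smooth_derivable _ _ f Cf.1 i).
  have := is_deriveM D1 (is_derive_cos_affine (2 * pi * dotR y xi + th) (2 * pi * xi ord0 i) 0).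
  move/is_derive_eq; apply; rewrite scale0r !addr0 mul0r addr0 addrA cosBpihalf /GRing.scale/=.
  ring.
have d1 := dominated_phase th xi dpf.
have d2 := dominated_phase (th - pi / 2) xi df.
have pE : partial i h = (fun y => partial i f y * cos (2 * pi * dotR y xi + th) +
    (- (2 * pi * xi ord0 i)) * (f y * cos (2 * pi * dotR y xi + (th - pi / 2)))).
  by apply/funext => y; rewrite /partial; have /@derive_val -> := D y.
have [mp [C hC]] : dominated (partial i h).
  by rewrite pE; apply: dominatedD => //; exact: dominatedZ.
have := @integral_partial0 _ n i h C (fun x => @ex_derive _ _ _ _ _ _ _ (D x)) (dominated_phase th xi df) mp hC.
rewrite pE RintegralD//; last 2 first.
- exact: dominated_integrable.
- exact: dominated_integrable (dominatedZ _ d2).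
rewrite RintegralZl//; last exact: dominated_integrable.
by move/eqP; rewrite mulNr subr_eq0 => /eqP.
Qed.

(* The transform of [f - partial_i^2 f] is that of [f] times [1 + (2 pi xi_i)^2]:
   this is the source of decay in [xi]. *)
Definition helm i f : V -> R := fun x => f x - partial i (partial i f) x.

Lemma Cc_infty_helm i f : Cc_infty f -> Cc_infty (helm i f).
Proof.
by move=> Cf; apply: Cc_inftyB => //; apply: Cc_infty_partial; exact: Cc_infty_partial.
Qed.

Lemma wcos_helm f i th xi : Cc_infty f ->
  wcos (helm i f) th xi = (1 + (2 * pi * xi ord0 i) ^+ 2) * wcos f th xi.
Proof.
move=> Cf; have Cp := Cc_infty_partial i Cf; have Cpp := Cc_infty_partial i Cp.
have E : wcos (helm i f) th xi = wcos f th xi - wcos (partial i (partial i f)) th xi.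
  rewrite /wcos -RintegralB//.
  - by apply: eq_Rintegral => y _; rewrite mulrBl.
  - by apply: dominated_integrable; apply: dominated_phase; exact: Cc_infty_dominated.
  - by apply: dominated_integrable; apply: dominated_phase; exact: Cc_infty_dominated.
have N : wcos f (th - pi / 2 - pi / 2) xi = - wcos f th xi.
  rewrite -[RHS]mulN1r /wcos -RintegralZl//; last first.
    by apply: dominated_integrable; apply: dominated_phase; exact: Cc_infty_dominated.
  apply: eq_Rintegral => y _; rewrite !addrA cosBpihalf.
  by rewrite sinBpihalf mulrN mulN1r.
rewrite E !wcos_partial// N; ring.
Qed.

(** The factor produced by applying [helm] once in every coordinate. It dominates both the
    reciprocal of [decay] and the symbol (2 pi |xi|)^s. *)
Definition bigD xi : R := \prod_(i < n) (1 + (2 * pi * xi ord0 i) ^+ 2).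

Lemma bigD_ge1 xi : 1 <= bigD xi.
Proof.
rewrite /bigD; elim/big_rec: _ => // i y _ y1; apply: mulr_ege1 => //.
by rewrite lerDl sqr_ge0.
Qed.

Lemma bigD_gt0 xi : 0 < bigD xi.
Proof. exact: lt_le_trans (bigD_ge1 xi). Qed.

Lemma bigD_decay xi : 1 <= bigD xi * decay xi.
Proof.
rewrite /bigD /decay -big_split/=; elim/big_rec: _ => // i y _ y1; apply: mulr_ege1 => //.
rewrite ler_pdivlMr ?oneDsqr_gt0// mul1r /oneDsqr lerD2l exprMn ler_peMl ?sqr_ge0//.
rewrite exprn_ege1//; have := @pi_ge2 R; lra.
Qed.

Lemma bigD_ge xi : 1 + (2 * pi) ^+ 2 * dotR xi xi <= bigD xi.
Proof.
rewrite /bigD /dotR mulr_sumr.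
elim: (index_enum _) => [|i l IH]; first by rewrite !big_nil addr0.
rewrite !big_cons.
set S := \sum_(_ <- l) _ in IH *; set P := \prod_(_ <- l) _ in IH *.
have S0 : 0 <= S by apply: sumr_ge0 => j _; rewrite mulr_ge0 ?sqr_ge0// -expr2 sqr_ge0.
have -> : (2 * pi) ^+ 2 * (xi 0 i * xi 0 i) = (2 * pi * xi ord0 i) ^+ 2 by rewrite [in RHS]exprMn expr2.
have a0 := sqr_ge0 (2 * pi * xi ord0 i).
apply: (@le_trans _ _ ((1 + (2 * pi * xi ord0 i) ^+ 2) * (1 + S))); last first.
  by rewrite ler_wpM2l// addr_ge0.
set a := _ ^+ 2 in a0 *.
have -> : (1 + a) * (1 + S) = 1 + (a + S) + a * S by ring.
by rewrite lerDl mulr_ge0.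
Qed.

Lemma wcos_helms f (l : seq 'I_n) th xi : Cc_infty f ->
  Cc_infty (foldr helm f l) /\
  wcos (foldr helm f l) th xi = \prod_(i <- l) (1 + (2 * pi * xi ord0 i) ^+ 2) * wcos f th xi.
Proof.
move=> Cf; elim: l => [|i l [IH1 IH2]]; first by rewrite big_nil mul1r.
by split; [exact: Cc_infty_helm|rewrite /= wcos_helm// IH2 big_cons mulrA].
Qed.

Lemma wcos_bigD f : Cc_infty f ->
  exists2 C : R, 0 <= C & forall th xi, bigD xi * bigD xi * `|wcos f th xi| <= C.
Proof.
(* Every coordinate twice: in [wcos_decay] one factor [bigD] becomes [decay] and the other absorbs
   [symb]. *)
move=> Cf; pose l := index_enum 'I_n ++ index_enum 'I_n.
have [Ch _] := @wcos_helms f l 0 0 Cf.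
have [mh [C hC]] := Cc_infty_dominated Ch.
exists (`|C| * pi ^+ n); first by rewrite mulr_ge0// exprn_ge0// pi_ge0.
move=> th xi; have [_ E] := @wcos_helms f l th xi Cf.
have := @wcos_le _ th xi `|C| mh.
rewrite E normrM ger0_norm; last first.
  by apply: prodr_ge0 => i _; rewrite addr_ge0// sqr_ge0.
rewrite big_cat/=; apply=> x; apply: (le_trans (hC x)).
by rewrite ler_wpM2r ?ler_norm// ltW// decay_gt0.
Qed.

Lemma powR_le_1Dsqr (t s : R) : 0 <= t -> 0 < s -> s < 1 -> t `^ s <= 1 + t ^+ 2.
Proof.
move=> t0 s0 s1; have [t1|t1] := leP t 1.
  apply: (@le_trans _ _ 1); last by rewrite lerDl sqr_ge0.
  have <- : 1 `^ s = 1 :> R by rewrite powR1.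
  by apply: ge0_ler_powR; rewrite ?nnegrE// ltW.
apply: (@le_trans _ _ (t ^+ 2)); last by rewrite lerDr.
apply: (@le_trans _ _ (t `^ 2)).
  by apply: ler_powR; [exact: ltW|lra].
by rewrite powR_mulrn.
Qed.

Definition symb (s : R) xi : R := (2 * pi * enorm xi) `^ s.

Lemma symb_ge0 s xi : 0 <= symb s xi.
Proof. exact: powR_ge0. Qed.

Lemma symb_le s xi : 0 < s -> s < 1 -> symb s xi <= bigD xi.
Proof.
move=> s0 s1; apply: le_trans (bigD_ge xi).
have e0 : 0 <= 2 * pi * enorm xi by rewrite !mulr_ge0 ?pi_ge0// sqrtr_ge0.
apply: (le_trans (powR_le_1Dsqr e0 s0 s1)).
by rewrite lerD2l exprMn /enorm sqr_sqrtr// dotR_ge0.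
Qed.

Lemma measurable_symb s d (T : measurableType d) (g : T -> V) : measurable_fun setT g ->
  measurable_fun setT (fun t => symb s (g t)).
Proof.
move=> mg; apply: measurable_powR_comp; apply: measurable_funM => //.
apply: (measurableT_comp (f := @Num.sqrt R)); last exact: measurable_dotR.
by apply: continuous_measurable_fun; exact: sqrt_continuous.
Qed.

Lemma wcos_decay f (s : R) : Cc_infty f -> 0 < s -> s < 1 ->
  exists2 C : R, 0 <= C & forall th xi,
    `|wcos f th xi| <= C * decay xi /\ symb s xi * `|wcos f th xi| <= C * decay xi.
Proof.
move=> Cf s0 s1; have [C C0 hC] := wcos_bigD Cf; exists C => // th xi.
have D0 := bigD_gt0 xi; have H := hC th xi.
suff H2 : bigD xi * `|wcos f th xi| <= C * decay xi.
  split; apply: le_trans H2; last by rewrite ler_wpM2r// symb_le.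
  by rewrite ler_peMl// bigD_ge1.
apply: (@le_trans _ _ ((bigD xi * decay xi) * (bigD xi * `|wcos f th xi|))).
  by rewrite ler_peMl ?bigD_decay// mulr_ge0// ltW.
rewrite [X in X <= _](_ : _ = (bigD xi * bigD xi * `|wcos f th xi|) * decay xi); last by ring.
by rewrite ler_wpM2r// ltW// decay_gt0.
Qed.

(** Translating f by z adds 2 pi z.xi to the phase, so this is the convolution theorem for [gamma]
    and f. *)
Lemma gamma_wcos f rho th xi : dominated f -> 0 < rho ->
  \int[mu n]_z (gamma rho z * wcos f (2 * pi * dotR z xi + th) xi) =
  expR (- pi * rho ^+ 2 * dotR xi xi) * wcos f th xi.
Proof.
move=> df r0; have dg := dominated_gamma r0.
have [mg [C gC]] := dg.
transitivity (\int[mu n]_z \int[mu n]_y (gamma rho z * f y * cos (2 * pi * dotR y xi + (2 * pi * dotR z xi + th)))).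
  apply: eq_Rintegral => z _; rewrite /wcos -RintegralZl//; last first.
    by apply: dominated_integrable; exact: dominated_phase.
  by apply: eq_Rintegral => y _; rewrite mulrA.
rewrite (@Rintegral_swap _ _ _ V (mu n) _ f C); last 3 first.
- apply: measurable_funM.
    by apply: measurable_funM; [exact: (measurableT_comp mg)|exact: (measurableT_comp df.1)].
  apply: measurable_phase; [exact: measurable_snd|exact: measurable_cst|].
  apply: measurable_funD => //; apply: measurable_funM => //.
  by apply: measurable_dotR; [exact: measurable_fst|exact: measurable_cst].
- exact: dominated_integrable.
- move=> z y; rewrite normrM [X in X * _]normrM; apply: (@le_trans _ _ (`|gamma rho z| * `|f y|)).
    by rewrite ler_piMr ?cos_max// mulr_ge0.
  by rewrite ler_wpM2r.
rewrite /wcos -RintegralZl//; last by apply: dominated_integrable; exact: dominated_phase.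
apply: eq_Rintegral => y _.
transitivity (f y * \int[mu n]_z (gamma rho z * cos (2 * pi * dotR z xi + (2 * pi * dotR y xi + th)))).
  rewrite -RintegralZl//; last by apply: dominated_integrable; exact: dominated_phase.
  by apply: eq_Rintegral => z _; rewrite addrCA mulrA [f y * _]mulrC.
by rewrite gamma_fourier// mulrCA.
Qed.

End fourier.

(** * Fourier inversion *)

Section inversion.
Context {R : realType} {n : nat}.
Local Notation leb := (@lebesgue_measure R).
Local Notation V := 'rV[R]_n.
Implicit Types (f g : V -> R) (th rho : R) (x y z xi : V).

Lemma expR_sigma_gauss rho xi : expR (- pi * rho ^+ 2 * dotR xi xi) = gauss (pi * rho ^+ 2) xi.
Proof. by rewrite /gauss mulNr. Qed.

(** The Gaussian factor makes the double integral absolutely convergent. After the exchange the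
    integral in xi is a Gaussian in y - x of width rho, and y = rho z + x rescales it to width 1. *)
Lemma wcos_smoothing f rho x : dominated f -> 0 < rho ->
  \int[mu n]_xi (expR (- pi * rho ^+ 2 * dotR xi xi) * wcos f (- (2 * pi * dotR x xi)) xi) =
  \int[mu n]_z (f (rho *: z + x) * gauss pi z).
Proof.
move=> df r0; have A0 : 0 < pi * rho ^+ 2 by rewrite mulr_gt0 ?pi_gt0// exprn_gt0.
have rV0 : 0 < rho^-1 by rewrite invr_gt0.
have dg := @dominated_gauss R n _ A0; have [mg [C gC]] := dg.
have AE : pi * rho ^+ 2 = pi / (rho^-1) ^+ 2 by rewrite exprVn invrK.
transitivity (\int[mu n]_xi \int[mu n]_y (gauss (pi * rho ^+ 2) xi * f y *
    cos (2 * pi * dotR y xi + - (2 * pi * dotR x xi)))).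
  apply: eq_Rintegral => xi _; rewrite expR_sigma_gauss /wcos -RintegralZl//; last first.
    by apply: dominated_integrable; exact: dominated_phase.
  by apply: eq_Rintegral => y _; rewrite mulrA.
rewrite (@Rintegral_swap _ _ _ V (mu n) _ f C); last 3 first.
- apply: measurable_funM.
    by apply: measurable_funM; [exact: (measurableT_comp mg)|exact: (measurableT_comp df.1)].
  apply: measurable_phase; [exact: measurable_snd|exact: measurable_fst|].
  apply: measurableT_comp => //; apply: measurable_funM => //.
  by apply: measurable_dotR; [exact: measurable_cst|exact: measurable_fst].
- exact: dominated_integrable.
- move=> xi y; rewrite normrM [X in X * _]normrM.
  apply: (@le_trans _ _ (`|gauss (pi * rho ^+ 2) xi| * `|f y|)).
    by rewrite ler_piMr ?cos_max// mulr_ge0.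
  by rewrite ler_wpM2r.
pose h y := f y * (rho ^- n * expR (- pi * rho^-1 ^+ 2 * dotR (y - x) (y - x))).
transitivity (\int[mu n]_y h y).
  apply: eq_Rintegral => y _.
  transitivity (f y * \int[mu n]_xi (gauss (pi * rho ^+ 2) xi * cos (2 * pi * dotR xi (y - x) + 0))).
    rewrite -RintegralZl//; last by apply: dominated_integrable; exact: dominated_phase.
    apply: eq_Rintegral => xi _; rewrite mulrA [f y * _]mulrC addr0; congr (_ * cos _).
    by rewrite [dotR xi _]dotRC dotRBl mulrBr.
  by rewrite AE gauss_sigma_fourier// cos0 mulr1 exprVn.
have ih : (mu n).-integrable setT (EFin \o h).
  apply: dominated_integrable; apply: dominatedM => //.
    apply: measurable_funM => //; apply: measurableT_comp => //; apply: measurable_funM => //.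
    by apply: measurable_dotR; apply: measurable_rVB => //; exact: measurable_id.
  exists (rho ^- n) => y; rewrite ger0_norm; last by rewrite mulr_ge0 ?expR_ge0// invr_ge0 exprn_ge0// ltW.
  rewrite ler_piMr ?invr_ge0 ?exprn_ge0 ?(ltW r0)// -[leRHS]expR0 ler_expR mulNr mulNr oppr_le0.
  by rewrite mulr_ge0 ?dotR_ge0// mulr_ge0 ?sqr_ge0// pi_ge0.
have rn0 : rho ^+ n != 0 by rewrite expf_neq0// gt_eqF.
have := Rintegral_affine x (lt0r_neq0 r0) ih.
rewrite ger0_norm ?(ltW r0)// => E.
apply: (mulfI (x := rho^-1 ^+ n)); first by rewrite exprVn invr_eq0.
have Hh z : h (rho *: z + x) = rho^-1 ^+ n * (f (rho *: z + x) * gauss pi z).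
  rewrite /h addrK [in RHS]exprVn mulrCA; congr (_ * (_ * _)).
  rewrite /gauss dotRZl dotRZr; congr expR.
  have -> (P t v : R) : - P * t^-1 ^+ 2 * (t * (t * v)) = - P * (t^-1 * t) ^+ 2 * v by ring.
  by rewrite mulVf ?gt_eqF// expr1n mulr1.
have ig : (mu n).-integrable setT (EFin \o (fun z => f (rho *: z + x) * gauss pi z)).
  apply: dominated_integrable.
  have dgp := @dominated_gauss R n pi (pi_gt0 R).
  have [mf [D fD]] := df.
  have -> : (fun z => f (rho *: z + x) * gauss pi z) = (fun z => gauss pi z * f (rho *: z + x)).
    by apply/funext => z; rewrite mulrC.
  apply: dominatedM => //.
    by apply: (measurableT_comp mf); exact: measurable_affine.
  exists `|D| => z; apply: (le_trans (fD _)); apply: (@le_trans _ _ (`|D| * decay (rho *: z + x))).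
    by rewrite ler_wpM2r ?ler_norm// ltW// decay_gt0.
  by rewrite ler_piMr// decay_le1.
rewrite -E -(RintegralZl _ measurableT ig).
by apply: eq_Rintegral => z _; exact: Hh.
Qed.

Lemma cvg_natSinv : (fun k => k.+1%:R^-1 : R) @ \oo --> 0.
Proof.
apply/cvgrPdist_lt => e e0; near=> k.
by rewrite sub0r normrN ger0_norm ?invr_ge0//; near: k; exact: near_infty_natSinv_lt (PosNum e0).
Unshelve. all: by end_near. Qed.

(** Let rho tend to 0 on both sides of [wcos_smoothing]: the left is dominated thanks to the decay
    of the transform, the right tends to f x because the Gaussian has mass 1. *)
Lemma fourier_inversion f x : Cc_infty f ->
  \int[mu n]_xi wcos f (- (2 * pi * dotR x xi)) xi = f x.
Proof.
move=> Cf; have df := Cc_infty_dominated Cf.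
(* [wcos_decay] wants an exponent in (0, 1); only its first bound, which does not mention the
   exponent, is used here. *)
have h01 : 0 < 2^-1 :> R by lra.
have h11 : 2^-1 < 1 :> R by lra.
have [C C0 hC] := wcos_decay Cf h01 h11.
pose r k : R := k.+1%:R^-1.
have r0 k : 0 < r k by rewrite invr_gt0.
have mphase : measurable_fun setT (fun xi => - (2 * pi * dotR x xi)).
  apply: measurableT_comp => //; apply: measurable_funM => //.
  by apply: measurable_dotR => //; exact: measurable_id.
have mw : measurable_fun setT (fun xi => wcos f (- (2 * pi * dotR x xi)) xi).
  by apply: measurable_wcos => //; exact: measurable_id.
have dCd : (mu n).-integrable setT (EFin \o (fun y : V => C * decay y)).
  apply: dominated_integrable; apply: dominatedZ; split; first exact: measurable_decay.
  by exists 1 => y; rewrite mul1r ger0_norm// ltW// decay_gt0.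
have L1 : \int[mu n]_xi (expR (- pi * r k ^+ 2 * dotR xi xi) * wcos f (- (2 * pi * dotR x xi)) xi)
    @[k --> \oo] --> \int[mu n]_xi wcos f (- (2 * pi * dotR x xi)) xi.
  apply: (Rintegral_dominated_cvg _ mw dCd).
  - move=> k; apply: measurable_funM => //; apply: measurableT_comp => //; apply: measurable_funM => //.
    by apply: measurable_dotR; exact: measurable_id.
  - move=> xi; rewrite -[X in _ --> X]mul1r; apply: cvgMl.
    rewrite -[X in _ --> X](@expR0 R).
    apply: (@continuous_cvg _ _ _ _ _ (fun k => - pi * r k ^+ 2 * dotR xi xi) expR 0); first exact: continuous_expR.
    have -> : 0 = - pi * (0 * 0) * dotR xi xi :> R by ring.
    apply: cvgMl; apply: cvgMr; under eq_cvg do rewrite expr2.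
    by apply: cvgM; exact: cvg_natSinv.
  - move=> k xi; rewrite normrM ger0_norm ?expR_ge0//; apply: le_trans (hC (- (2 * pi * dotR x xi)) xi).1.
    rewrite ler_piMl// -[leRHS]expR0 ler_expR mulNr mulNr oppr_le0.
    by rewrite mulr_ge0 ?dotR_ge0// mulr_ge0 ?sqr_ge0// pi_ge0.
have [M M0 fM] := Cc_infty_bounded Cf.
have dgp := @dominated_gauss R n pi (pi_gt0 R).
have L2 : \int[mu n]_z (f (r k *: z + x) * gauss pi z) @[k --> \oo] --> \int[mu n]_z (f x * gauss pi z).
  apply: (@Rintegral_dominated_cvg _ _ _ _ _ _ (fun z => M * gauss pi z)).
  - move=> k; apply: measurable_funM; last exact: measurable_gauss.
    by apply: (measurableT_comp df.1); exact: measurable_affine.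
  - by apply: measurable_funM => //; exact: measurable_gauss.
  - by apply: dominated_integrable; exact: dominatedZ.
  - move=> z; apply: cvgMl.
    apply: (@continuous_cvg _ _ _ _ _ (fun k => r k *: z + x) f x); first exact: smooth_continuous Cf.1 x.
    rewrite -[X in _ --> X]add0r; apply: cvgD; last exact: cvg_cst.
    rewrite -[X in _ --> X](scale0r z); apply: cvgZl; exact: cvg_natSinv.
  - move=> k z; rewrite normrM (ger0_norm (ltW (gauss_gt0 _ _))) ler_wpM2r//.
    by rewrite ltW// gauss_gt0.
have E : \int[mu n]_z (f x * gauss pi z) = f x.
  rewrite RintegralZl//; last exact: dominated_integrable.
  by rewrite integral_gauss ?pi_gt0// mulfV ?expr1n ?mulr1// gt_eqF// sqrtr_gt0 pi_gt0.
move: L2; under eq_cvg do rewrite -wcos_smoothing//; rewrite E => L2.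
exact: (cvg_unique _ L1 L2).
Qed.

Lemma mu_dot0 : (0 < n)%N -> mu n [set x : V | dotR x x = 0] = 0.
Proof.
move=> n0; apply/eqP; rewrite eq_le measure_ge0 andbT; apply/lee_addgt0Pr => e e0; rewrite add0e.
(* With u <= 1 and n positive, u^n <= u <= e. *)
pose u := Num.min e 1.
have u0 : 0 < u by rewrite lt_min e0 ltr01.
have mN : measurable [set x : V | dotR x x = 0].
  have -> : [set x : V | dotR x x = 0] = setT `&` (fun x : V => dotR x x) @^-1` [set 0].
    by rewrite setTI.
  by apply: measurable_dotR => //; exact: measurable_id.
apply: (@le_trans _ _ (mu n (cube 0 (u / 2)))).
  apply: le_measure; rewrite ?inE//; first exact: measurable_cube.
  move=> x /= x0 i; have /eqP := x0.
  rewrite /dotR psumr_eq0; last by move=> j _; rewrite -expr2 sqr_ge0.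
  move=> /allP/(_ i (mem_index_enum i)); rewrite mulf_eq0 orbb => /eqP xi0.
  by rewrite mxE xi0; lra.
have -> : mu n (cube 0 (u / 2)) = ((2 * (u / 2)) ^+ n)%:E by apply: mu_cube; rewrite divr_ge0// ltW.
rewrite lee_fin mulrCA mulfV ?mulr1 ?pnatr_eq0//.
apply: (@le_trans _ _ u); last by rewrite ge_min lexx.
by rewrite -[leRHS]expr1 ler_wiXn2l ?(ltW u0)// ge_min lexx orbT.
Qed.

End inversion.

(** * The fractional Laplacian and its subordination to Gaussians *)

Section mellin.
Context {R : realType}.
Local Notation leb := (@lebesgue_measure R).

(** The value is a Gamma factor, but finiteness and positivity suffice: the integral is compared
    with powers on (0, 1] and beyond 1 from above, and with a constant on [1, 2] from below. *)
Lemma mellin_gauss (s : R) : 0 < s -> s < 1 ->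
  exists2 c : R, 0 < c & (\int[leb]_r (wpow (s - 1) r * expR (- pi * r ^+ 2))%:E = c%:E)%E.
Proof.
move=> s0 s1.
have mf : measurable_fun setT (fun r : R => wpow (s - 1) r * expR (- pi * r ^+ 2)).
  apply: measurable_funM; first by apply: measurable_wpow; exact: measurable_id.
  by apply: measurableT_comp => //; apply: measurable_funM => //.
have f0 r : 0 <= wpow (s - 1) r * expR (- pi * r ^+ 2) by rewrite mulr_ge0 ?wpow_ge0 ?expR_ge0.
set I := (\int[leb]_r _)%E.
have Ile : (I <= (s^-1 + (1 - s)^-1)%:E)%E.
  pose f1 (r : R) := if r \in `]0%R, 1%R]%classic then wpow (s - 1) r * 1 else 0.
  pose f2 (r : R) := if r \in `]1%R, +oo[%classic then wpow (- (1 - s) - 1) r * 1 else 0.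
  have mif (D : set R) (c : R) : measurable D -> measurable_fun setT (fun r : R => if r \in D then wpow c r * 1 else 0).
    move=> mD; apply: measurable_fun_ifT => //; first exact: measurable_fun_mem.
    by apply: measurable_funM => //; apply: measurable_wpow; exact: measurable_id.
  apply: (@le_trans _ _ (\int[leb]_r ((f1 r)%:E + (f2 r)%:E))%E).
    apply: ge0_le_integral => //.
    - by move=> r _; rewrite lee_fin.
    - exact/measurable_EFinP.
    - by apply: emeasurable_funD; apply/measurable_EFinP; exact: mif.
    move=> r _; rewrite -EFinD lee_fin /f1 /f2 !mem_setE !in_itv/=.
    have [r0|r0] := leP r 0; first by rewrite /wpow ltNge r0/= mul0r andbT ltNge (le_trans r0)//= addr0.
    have [r1|r1] := leP r 1.
      rewrite /= addr0 ler_wpM2l ?wpow_ge0// -[leRHS]expR0 ler_expR mulNr oppr_le0.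
      by rewrite mulr_ge0 ?sqr_ge0 ?pi_ge0.
    rewrite andbT add0r mulr1 /wpow r0.
    (* For r > 1 the Gaussian is at most 1/r, which lowers the exponent to the integrable s - 2. *)
    have -> : - (1 - s) - 1 = (s - 1) + (-1) by ring.
    rewrite [leRHS]powRD; last by rewrite (gt_eqF r0) implybT.
    rewrite ler_wpM2l ?powR_ge0// powR_inv1 ?(ltW r0)// mulNr expRN lef_pV2 ?posrE ?expR_gt0//.
    apply: le_trans (expR_ge1Dx _).
    have p2 := @pi_ge2 R; have : r <= pi * r ^+ 2; last by lra.
    by rewrite expr2 mulrA ler_peMl ?(ltW r0)//; nra.
  rewrite ge0_integralD//; last 4 first.
  - by move=> r _; rewrite lee_fin /f1; case: ifP => // _; rewrite mulr1 wpow_ge0.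
  - by apply/measurable_EFinP; exact: mif.
  - by move=> r _; rewrite lee_fin /f2; case: ifP => // _; rewrite mulr1 wpow_ge0.
  - by apply/measurable_EFinP; exact: mif.
  rewrite EFinD; apply: leeD.
    rewrite integral_wpow_itv// ?mul1e; last by move=> r /=; rewrite !in_itv/= andbT => /andP[].
    by apply: (le_trans (integral_powR0_le s0 ltr01)); rewrite powR1 mul1r.
  rewrite integral_wpow_itv// ?mul1e; last first.
    by move=> r /=; rewrite !in_itv/= !andbT; exact: lt_trans.
  by rewrite integral_powRy ?subr_gt0// powR1 mul1r.
have Ige : ((2 `^ (s - 1) * expR (- pi * 4))%:E <= I)%E.
  pose c : R := 2 `^ (s - 1) * expR (- pi * 4).
  have c0 : 0 <= c by rewrite mulr_ge0 ?powR_ge0 ?expR_ge0.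
  apply: (@le_trans _ _ (\int[leb]_r (c * \1_(`[1%R, 2%R]) r)%:E)%E).
    under eq_integral do rewrite EFinM.
    rewrite ge0_integralZl//; last by apply/measurable_EFinP.
    rewrite integral_indic// setIT [X in (_ * X)%E](lebesgue_measure_itv `[1%R, 2%R])/= lte_fin ltr1n.
    by rewrite -EFinD -EFinM lee_fin /c; lra.
  apply: ge0_le_integral => //.
  - by move=> r _; rewrite lee_fin mulr_ge0.
  - by apply/measurable_EFinP; apply: measurable_funM.
  - exact/measurable_EFinP.
  move=> r _; rewrite lee_fin indicE mem_setE in_itv/=.
  case: (boolP (1 <= r <= 2)) => [/andP[r1 r2]|_]; last by rewrite mulr0.
  have r0 : 0 < r by exact: lt_le_trans r1.
  rewrite mulr1 /c /wpow r0; apply: ler_pM; rewrite ?powR_ge0 ?expR_ge0//.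
    have -> : s - 1 = - (1 - s) by ring.
    by apply: powR_anti => //; rewrite subr_ge0 ltW.
  rewrite ler_expR !mulNr lerN2 ler_wpM2l ?pi_ge0//.
  have -> : 4 = 2 ^+ 2 :> R by ring.
  by rewrite lerXn2r ?nnegrE// ltW.
have If : I \is a fin_num.
  by rewrite ge0_fin_numE ?(le_lt_trans Ile) ?ltry//; apply: integral_ge0 => r _; rewrite lee_fin.
exists (fine I); last by rewrite fineK.
rewrite -lte_fin fineK//; apply: lt_le_trans Ige.
by rewrite lte_fin mulr_gt0 ?powR_gt0 ?expR_gt0.
Qed.

(** Rescaling r by |xi| produces |xi|^(-s), which cancels the symbol. At xi = 0 the symbol, and with
    it the integral, is 0, hence the exception. *)
Lemma mellin_symb n (s : R) : 0 < s -> s < 1 ->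
  exists2 c : R, 0 < c & forall xi : 'rV[R]_n, dotR xi xi != 0 ->
    (\int[leb]_r (wpow (s - 1) r * (symb s xi * expR (- pi * r ^+ 2 * dotR xi xi)))%:E = c%:E)%E.
Proof.
move=> s0 s1; have [c c0 hc] := mellin_gauss s0 s1.
exists ((2 * pi) `^ s * c); first by rewrite mulr_gt0// powR_gt0// mulr_gt0// pi_gt0.
move=> xi xi0; have d0 : 0 < dotR xi xi by rewrite lt_def xi0 dotR_ge0.
pose q := enorm xi; have q0 : 0 < q by rewrite sqrtr_gt0.
have q2 : dotR xi xi = q ^+ 2 by rewrite /q /enorm sqr_sqrtr// ltW.
pose f (r : R) := (wpow (s - 1) r * expR (- pi * r ^+ 2))%:E.
have mf : measurable_fun setT f.
  apply/measurable_EFinP; apply: measurable_funM; first by apply: measurable_wpow; exact: measurable_id.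
  by apply: measurableT_comp => //; apply: measurable_funM => //.
have f0 r : (0 <= f r)%E by rewrite lee_fin mulr_ge0 ?wpow_ge0 ?expR_ge0.
have := ge0_integral_affine1 0 (lt0r_neq0 q0) mf f0.
rewrite hc (gtr0_norm q0) => E.
have K0 : (0%:E <= ((2 * pi) `^ s * q)%:E)%E by rewrite lee_fin mulr_ge0 ?powR_ge0 ?(ltW q0).
transitivity (((2 * pi) `^ s * q)%:E * \int[leb]_r f (q * r + 0)%R)%E; last first.
  by rewrite E -!EFinM; congr EFin; rewrite mulrA mulfK ?gt_eqF.
have mfq : measurable_fun setT (fun r => f (q * r + 0)).
  by apply: (measurableT_comp mf); exact: measurable_affine1.
rewrite -(ge0_integralZl leb measurableT mfq (fun r _ => f0 (q * r + 0)) K0).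
apply: eq_integral => r _; rewrite /f -EFinM addr0; congr EFin.
rewrite /wpow pmulr_rgt0//; case: ifPn => r0; last by rewrite !mul0r mulr0.
have -> : symb s xi = (2 * pi) `^ s * q `^ s.
  by rewrite /symb powRM ?(ltW q0)// mulr_ge0 ?pi_ge0.
rewrite q2 [(q * r) `^ _]powRM ?(ltW q0) ?(ltW r0)//.
have qq : q * q `^ (s - 1) = q `^ s.
  have {1}-> : q = q `^ 1 by rewrite powRr1// ltW.
  by rewrite -powRD; [congr (_ `^ _); ring|rewrite (gt_eqF q0) implybT].
have -> : - pi * (q * r) ^+ 2 = - pi * r ^+ 2 * q ^+ 2 by ring.
rewrite -qq; ring.
Qed.

End mellin.

Section flap.
Context {R : realType} {n : nat}.
Local Notation leb := (@lebesgue_measure R).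
Local Notation V := 'rV[R]_n.
Implicit Types (f g : V -> R) (rho : R) (x y z xi : V).
Variable s : R.
Hypotheses (s0 : 0 < s) (s1 : s < 1).

(** The real part of the Fourier transform of f at xi times exp(2 pi i x.xi). Accordingly [flap] is
    the real part of [fraclap], and all of it on test functions ([fraclapE]). *)
Definition wave f x xi : R := wcos f (- (2 * pi * dotR x xi)) xi.

Definition flap f x : R := \int[mu n]_xi (symb s xi * wave f x xi).

Definition heat rho xi : R := expR (- pi * rho ^+ 2 * dotR xi xi).

(** On the frequency side, the convolution of [flap s f] with [gamma rho] ([flap_heatE]). In this
    form it is bounded uniformly in rho. *)
Definition flap_heat f rho x : R := \int[mu n]_xi (symb s xi * heat rho xi * wave f x xi).

Lemma heat_ge0 rho xi : 0 <= heat rho xi.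
Proof. exact: expR_ge0. Qed.

Lemma heat_le1 rho xi : heat rho xi <= 1.
Proof.
rewrite -[leRHS]expR0 ler_expR !mulNr oppr_le0.
by rewrite mulr_ge0 ?dotR_ge0// mulr_ge0 ?sqr_ge0// pi_ge0.
Qed.

Lemma measurable_heat d (T : measurableType d) (a : T -> R) (g : T -> V) :
  measurable_fun setT a -> measurable_fun setT g -> measurable_fun setT (fun t => heat (a t) (g t)).
Proof.
move=> ma mg; apply: measurableT_comp => //; apply: measurable_funM; last exact: measurable_dotR.
by apply: measurable_funM => //; exact: measurable_funX.
Qed.

Lemma measurable_wave f d (T : measurableType d) (a g : T -> V) : dominated f ->
  measurable_fun setT a -> measurable_fun setT g -> measurable_fun setT (fun t => wave f (a t) (g t)).
Proof.
move=> df ma mg; apply: measurable_wcos => //.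
apply: measurableT_comp => //; apply: measurable_funM => //; exact: measurable_dotR.
Qed.

Lemma wave_decay f : Cc_infty f -> exists2 C : R, 0 <= C & forall x xi,
  `|wave f x xi| <= C * decay xi /\ `|symb s xi * wave f x xi| <= C * decay xi.
Proof.
move=> Cf; have [C C0 hC] := wcos_decay Cf s0 s1; exists C => // x xi.
by have [h1 h2] := hC (- (2 * pi * dotR x xi)) xi; split => //; rewrite normrM ger0_norm ?symb_ge0.
Qed.

Lemma measurable_flap f : Cc_infty f -> measurable_fun setT (flap f).
Proof.
move=> Cf; have df := Cc_infty_dominated Cf.
have [C C0 hC] := wave_decay Cf.
apply: (@measurable_Rintegral_param _ _ _ V (fun x xi => symb s xi * wave f x xi) C).
  apply: measurable_funM; first exact: measurable_symb.
  exact: measurable_wave.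
by move=> x xi; exact: (hC x xi).2.
Qed.

Lemma flap_bounded f : Cc_infty f -> exists2 C : R, 0 <= C & forall x, `|flap f x| <= C.
Proof.
move=> Cf; have [C C0 hC] := wave_decay Cf; have df := Cc_infty_dominated Cf.
exists (C * pi ^+ n); first by rewrite mulr_ge0// exprn_ge0// pi_ge0.
move=> x; apply: normr_Rintegral_le; last by move=> xi; exact: (hC x xi).2.
by apply: measurable_funM; [apply: measurable_symb|apply: measurable_wave] => //; exact: measurable_id.
Qed.

Lemma flap_heat_bound f C x rho xi :
  `|symb s xi * wave f x xi| <= C * decay xi ->
  `|symb s xi * heat rho xi * wave f x xi| <= C * decay xi.
Proof.
apply: le_trans; rewrite mulrAC normrM ler_piMr// ger0_norm ?heat_ge0//.
exact: heat_le1.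
Qed.

Lemma flap_heat_bounded f : Cc_infty f -> exists2 C : R, 0 <= C & forall rho x, `|flap_heat f rho x| <= C.
Proof.
move=> Cf; have [C C0 hC] := wave_decay Cf; have df := Cc_infty_dominated Cf.
exists (C * pi ^+ n); first by rewrite mulr_ge0// exprn_ge0// pi_ge0.
move=> rho x; apply: normr_Rintegral_le; last by move=> xi; apply: flap_heat_bound; exact: (hC x xi).2.
apply: measurable_funM; last by apply: measurable_wave => //; exact: measurable_id.
by apply: measurable_funM; [apply: measurable_symb|apply: measurable_heat] => //; exact: measurable_id.
Qed.

Lemma measurable_flap_heat f d (T : measurableType d) (a : T -> R) (g : T -> V) : Cc_infty f ->
  measurable_fun setT a -> measurable_fun setT g -> measurable_fun setT (fun t => flap_heat f (a t) (g t)).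
Proof.
move=> Cf ma mg; have df := Cc_infty_dominated Cf.
have [C C0 hC] := wave_decay Cf.
apply: (@measurable_Rintegral_param _ _ _ T (fun t xi => symb s xi * heat (a t) xi * wave f (g t) xi) C).
  apply: measurable_funM.
    apply: measurable_funM; first exact: measurable_symb.
    by apply: measurable_heat => //; exact: (measurableT_comp ma).
  by apply: measurable_wave => //; exact: (measurableT_comp mg).
by move=> t xi; apply: flap_heat_bound; exact: (hC _ xi).2.
Qed.

Lemma flap_heatE f rho x : Cc_infty f -> 0 < rho ->
  flap_heat f rho x = \int[mu n]_z (gamma rho z * flap f (x - z)).
Proof.
move=> Cf r0; have df := Cc_infty_dominated Cf.
have [C C0 hC] := wave_decay Cf.
have dg := @dominated_gamma R n _ r0; have [mg [D gD]] := dg.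
have iC : (mu n).-integrable setT (EFin \o (fun xi : V => C * decay xi)).
  apply: dominated_integrable; apply: dominatedZ; split; first exact: measurable_decay.
  by exists 1 => y; rewrite mul1r ger0_norm// ltW// decay_gt0.
have iw y : (mu n).-integrable setT (EFin \o (fun xi => symb s xi * wave f y xi)).
  apply: dominated_integrable; split; last by exists C => xi; exact: (hC y xi).2.
  by apply: measurable_funM; [apply: measurable_symb|apply: measurable_wave] => //; exact: measurable_id.
transitivity (\int[mu n]_z \int[mu n]_xi (gamma rho z * (symb s xi * wave f (x - z) xi))); last first.
  by apply: eq_Rintegral => z _; rewrite RintegralZl.
rewrite (@Rintegral_swap _ _ _ V (mu n) _ (fun xi => C * decay xi) D); last 3 first.
- apply: measurable_funM; first exact: (measurableT_comp mg).
  apply: measurable_funM; first exact: measurable_symb.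
  by apply: measurable_wave => //; apply: measurable_rVB => //; exact: measurable_cst.
- exact: iC.
- move=> z xi; rewrite normrM; apply: ler_pM => //.
  by apply: (le_trans (hC (x - z) xi).2); exact: ler_norm.
apply: eq_Rintegral => xi _.
transitivity (symb s xi * \int[mu n]_z (gamma rho z * wcos f (2 * pi * dotR z xi + - (2 * pi * dotR x xi)) xi)).
  by rewrite gamma_wcos// mulrA.
have ig : (mu n).-integrable setT (EFin \o
    (fun z => gamma rho z * wcos f (2 * pi * dotR z xi + - (2 * pi * dotR x xi)) xi)).
  apply: dominated_integrable; apply: dominatedM => //.
    apply: measurable_wcos => //.
    apply: measurable_funD => //; apply: measurable_funM => //.
    by apply: measurable_dotR => //; exact: measurable_id.
  have [mf [M fM]] := df.
  by exists (M * pi ^+ n) => z; exact: wcos_le.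
rewrite -(RintegralZl _ measurableT ig).
apply: eq_Rintegral => z _; rewrite mulrCA.
suff -> : 2 * pi * dotR z xi + - (2 * pi * dotR x xi) = - (2 * pi * dotR (x - z) xi) by [].
by rewrite dotRBl mulrBr opprB.
Qed.

Section subordination.
Variable c : R.
Hypothesis c0 : 0 < c.
Hypothesis hc : forall xi : V, dotR xi xi != 0 ->
  (\int[leb]_r (wpow (s - 1) r * (symb s xi * heat r xi))%:E = c%:E)%E.
Hypothesis n0 : (0 < n)%N.

(** The value of the integral over r at every frequency, the origin included, so that Fubini can be
    used with no exceptional slice. *)
Let m xi : R := if dotR xi xi == 0 then 0 else c.

Let hm xi : (\int[leb]_r (wpow (s - 1) r * (symb s xi * heat r xi))%:E = (m xi)%:E)%E.
Proof.
rewrite /m; case: eqVneq => [d0|/hc//].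
have -> : symb s xi = 0 by rewrite /symb /enorm d0 sqrtr0 mulr0 powR0// gt_eqF.
by under eq_integral do rewrite mul0r mulr0; rewrite integral0.
Qed.

Let mle xi : 0 <= m xi <= c.
Proof. by rewrite /m; case: ifP => _; rewrite lexx (ltW c0). Qed.

Let mwh xi : measurable_fun setT (fun r => wpow (s - 1) r * (symb s xi * heat r xi)).
Proof.
apply: measurable_funM; first by apply: measurable_wpow; exact: measurable_id.
by apply: measurable_funM => //; apply: measurable_heat; [exact: measurable_id|exact: measurable_cst].
Qed.

Let wh0 xi r : 0 <= wpow (s - 1) r * (symb s xi * heat r xi).
Proof. by rewrite !mulr_ge0 ?wpow_ge0 ?symb_ge0 ?heat_ge0. Qed.

Let iwh xi : leb.-integrable setT (fun r => (wpow (s - 1) r * (symb s xi * heat r xi))%:E).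
Proof.
apply/integrableP; split; first by apply/measurable_EFinP; exact: mwh.
under eq_integral do rewrite gee0_abs ?lee_fin//.
by rewrite hm ltry.
Qed.

(** Exchanging the integrals over r and xi leaves c times the inversion formula. The last clause
    bounds the absolute integral uniformly in x; multiplied by a dominated function of x it gives
    joint integrability in [integrable_subordination]. *)
Lemma subordination f : Cc_infty f ->
  exists2 C : R, 0 <= C & forall x,
    leb.-integrable setT (fun r => (wpow (s - 1) r * flap_heat f r x)%:E) /\
    c * f x = \int[leb]_r (wpow (s - 1) r * flap_heat f r x) /\
    (\int[leb]_r `|(wpow (s - 1) r * flap_heat f r x)%:E| <= C%:E)%E.
Proof.
move=> Cf; have df := Cc_infty_dominated Cf.
have [C C0 hC] := wave_decay Cf.
exists (c * C * pi ^+ n); first by rewrite !mulr_ge0 ?(ltW c0)// exprn_ge0// pi_ge0.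
move=> x.
pose k xi := wave f x xi.
have dk : dominated k.
  split; first by apply: measurable_wave => //; exact: measurable_id.
  by exists C => xi; exact: (hC x xi).1.
pose h xi (r : R) := wpow (s - 1) r * (symb s xi * heat r xi) * k xi.
have mh : measurable_fun setT (fun z : V * measurableTypeR R => h z.1 z.2).
  apply: measurable_funM; last exact: (measurableT_comp dk.1).
  apply: measurable_funM; first exact: measurable_wpow.
  by apply: measurable_funM; [exact: measurable_symb|exact: measurable_heat].
have hr r : dominated (h^~ r).
  split; first exact: (measurable_curry2 (T2 := measurableTypeR R) r mh).
  exists (wpow (s - 1) r * C) => xi.
  rewrite /h -mulrA normrM (ger0_norm (wpow_ge0 _ _)) -[leRHS]mulrA; apply: ler_wpM2l; first exact: wpow_ge0.
  by apply: flap_heat_bound; exact: (hC x xi).2.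
have hE r : \int[mu n]_xi h xi r = wpow (s - 1) r * flap_heat f r x.
  rewrite /flap_heat -RintegralZl//.
    by apply: eq_Rintegral => xi _; rewrite /h /k -!mulrA.
  apply: dominated_integrable; split; last by exists C => xi; apply: flap_heat_bound; exact: (hC x xi).2.
  apply: measurable_funM; last exact: dk.1.
  by apply: measurable_funM; [apply: measurable_symb|apply: measurable_heat] => //; exact: measurable_id.
have iabs xi : (\int[leb]_r `|(h xi r)%:E| = (m xi * `|k xi|)%:E)%E.
  under eq_integral do rewrite /h abse_EFin normrM ger0_norm// EFinM.
  have mwE : measurable_fun setT (fun r => (wpow (s - 1) r * (symb s xi * heat r xi))%:E).
    by apply/measurable_EFinP; exact: mwh.
  have wE0 r : setT r -> (0 <= (wpow (s - 1) r * (symb s xi * heat r xi))%:E)%E by rewrite lee_fin.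
  have k0 : (0 <= `|k xi|%:E)%E by rewrite lee_fin.
  by rewrite (ge0_integralZr leb measurableT mwE wE0 k0) hm -EFinM.
have iabs_le : (\int[mu n]_xi \int[leb]_r `|(h xi r)%:E| <= (c * C * pi ^+ n)%:E)%E.
  apply: (@le_trans _ _ (\int[mu n]_xi (c * C * decay xi)%:E)%E).
    apply: ge0_le_integral => //.
    - by move=> xi _; exact: integral_ge0.
    - apply: (@measurable_integral_param _ _ _ leb _ V (fun xi r => `|(h xi r)%:E|)%E) => //.
      by apply: measurableT_comp => //; apply/measurable_EFinP.
    - by apply/measurable_EFinP; apply: measurable_funM => //; exact: measurable_decay.
    move=> xi _; rewrite iabs lee_fin -mulrA.
    have /andP[m0 mc] := mle xi.
    by apply: ler_pM => //; exact: (hC x xi).1.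
  under eq_integral do rewrite EFinM.
  rewrite ge0_integralZl//; last 3 first.
  - by apply/measurable_EFinP; exact: measurable_decay.
  - by move=> xi _; rewrite lee_fin ltW// decay_gt0.
  - by rewrite lee_fin mulr_ge0// ltW.
  by rewrite integral_decay -EFinM.
have mhE : measurable_fun setT (fun z : V * measurableTypeR R => (h z.1 z.2)%:E) by exact/measurable_EFinP.
have ih : (mu n \x leb)%E.-integrable setT (fun z : V * measurableTypeR R => (h z.1 z.2)%:E).
  by apply/(integrable12ltyP (mu n) leb mhE); apply: le_lt_trans iabs_le _; rewrite ltry.
have F := @Rintegral_Fubini R _ _ _ _ (mu n) leb h ih _ (fun r => dominated_integrable (hr r)).
have mP : measurable_fun setT (fun r : measurableTypeR R => wpow (s - 1) r * flap_heat f r x).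
  apply: measurable_funM; first exact: measurable_wpow.
  by apply: measurable_flap_heat => //; exact: measurable_cst.
have bnd : (\int[leb]_r `|(wpow (s - 1) r * flap_heat f r x)%:E| <= (c * C * pi ^+ n)%:E)%E.
  apply: le_trans iabs_le.
  rewrite (tonelli2 (mu n) leb (f := fun xi r => `|(h xi r)%:E|)%E) => //; last first.
    by apply: measurableT_comp.
  apply: ge0_le_integral => //.
  - by apply: measurableT_comp => //; exact/measurable_EFinP.
  - apply: (@measurable_integral_param _ _ _ (mu n) _ (measurableTypeR R) (fun r xi => `|(h xi r)%:E|)%E) => //.
    apply: measurableT_comp => //; apply/measurable_EFinP.
    apply: measurable_funM; last exact: (measurableT_comp dk.1).
    apply: measurable_funM; first exact: measurable_wpow.
    by apply: measurable_funM; [exact: measurable_symb|exact: measurable_heat].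
  move=> r _; rewrite -hE abse_EFin EFin_normr_Rintegral//; last exact: dominated_integrable.
  apply: le_abse_integral => //; apply/measurable_EFinP; exact: (hr r).1.
split; [|split] => //.
  apply/integrableP; split; first exact/measurable_EFinP.
  by apply: le_lt_trans bnd _; rewrite ltry.
under eq_Rintegral do rewrite -hE.
rewrite -F; last first.
  move=> xi; have := integrableZr measurableT (k xi) (iwh xi).
  by apply: eq_integrable.
rewrite -(fourier_inversion x Cf) -(RintegralZl _ measurableT (dominated_integrable dk)).
have hrE xi : \int[leb]_r h xi r = m xi * k xi.
  by rewrite (RintegralZr _ measurableT (iwh xi)); congr (_ * _); exact: (congr1 fine (hm xi)).
under [RHS]eq_Rintegral do rewrite hrE.
(* [m] and c differ at the origin only, a null set because n is positive. *)
rewrite /Rintegral; congr fine; apply: ae_eq_integral => //.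
- by apply/measurable_EFinP; apply: measurable_funM => //; exact: dk.1.
- apply/measurable_EFinP; apply: measurable_funM; last exact: dk.1.
  apply: measurable_fun_ifT => //; apply: measurable_fun_eqr => //.
  by apply: measurable_dotR; exact: measurable_id.
exists [set xi : V | dotR xi xi = 0]; split.
- have -> : [set xi : V | dotR xi xi = 0] = setT `&` (fun x : V => dotR x x) @^-1` [set 0] by rewrite setTI.
  by apply: measurable_dotR => //; exact: measurable_id.
- exact: mu_dot0.
move=> xi /= hxi; apply: contra_notP hxi => /eqP/negbTE d0 _.
by rewrite /m d0.
Qed.

End subordination.

End flap.

(** * The commutator *)

Section commutator_form.
Context {R : realType} {n : nat}.
Local Notation leb := (@lebesgue_measure R).
Local Notation V := 'rV[R]_n.
Implicit Types (phi f g : V -> R) (rho : R) (x y z xi : V).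
Variable s : R.
Hypotheses (s0 : 0 < s) (s1 : s < 1) (n0 : (0 < n)%N).

Lemma integrable_dominated_shift (u v : V -> R) (M : R) z : dominated u -> measurable_fun setT v ->
  (forall x, `|v x| <= M) -> dominated (fun x => u x * v (x - z)).
Proof.
move=> du mv vM; apply: dominatedM => //; last by exists M.
by apply: (measurableT_comp mv); apply: measurable_rVB => //; exact: measurable_id.
Qed.

(** In the second term z is reflected, which the even kernel allows, and x is translated: both terms
    then contain F (x - z) G x, with phi x in one and phi (x - z) in the other. Only after this
    subtraction are absolute values taken. *)
Lemma even_kernel_form (g : V -> R) phi (F G : V -> R) (MF MG : R) :
  dominated g -> (forall z, 0 <= g z) -> (forall z, g (- z) = g z) -> dominated phi ->
  (exists M, forall x, `|phi x| <= M) ->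
  measurable_fun setT F -> measurable_fun setT G ->
  (forall x, `|F x| <= MF) -> (forall x, `|G x| <= MG) ->
  (`|\int[mu n]_x (phi x * G x * \int[mu n]_z (g z * F (x - z)))
    - \int[mu n]_x (phi x * F x * \int[mu n]_z (g z * G (x - z)))|%:E <=
   \int[mu n]_z \int[mu n]_x (g z * (`|phi x - phi (x - z)| * `|F (x - z)| * `|G x|))%:E)%E.
Proof.
move=> dg g0 gN dphi [M phiM] mF mG FM GM; have [mg [D gD]] := dg.
have mphi := dphi.1; have [_ [C phiC]] := dphi.
have MF0 : 0 <= MF by exact: le_trans (normr_ge0 _) (FM 0).
have MG0 : 0 <= MG by exact: le_trans (normr_ge0 _) (GM 0).
have swap (U W : V -> R) (MU MW : R) : measurable_fun setT U -> measurable_fun setT W ->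
    (forall x, `|U x| <= MU) -> (forall x, `|W x| <= MW) ->
    \int[mu n]_x (phi x * W x * \int[mu n]_z (g z * U (x - z))) =
    \int[mu n]_z (g z * \int[mu n]_x (phi x * W x * U (x - z))).
  move=> mU mW UM WM.
  have dW : dominated (fun x => phi x * W x) by apply: dominatedM => //; exists MW.
  have MU0 : 0 <= MU by exact: le_trans (normr_ge0 _) (UM 0).
  transitivity (\int[mu n]_x \int[mu n]_z (phi x * W x * (g z * U (x - z)))).
    apply: eq_Rintegral => x _; rewrite RintegralZl//; apply: dominated_integrable.
    apply: dominatedM => //; last by exists MU => z.
    by apply: (measurableT_comp mU); apply: measurable_rVB => //; exact: measurable_id.
  rewrite (@Rintegral_swap _ _ _ V (mu n) _ (fun z => MU * g z) (C * MW)); last 3 first.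
  - apply: measurable_funM.
      by apply: measurable_funM; [exact: (measurableT_comp mphi)|exact: (measurableT_comp mW)].
    apply: measurable_funM; first exact: (measurableT_comp mg).
    by apply: (measurableT_comp mU); apply: measurable_rVB.
  - by apply: dominated_integrable; exact: dominatedZ.
  - move=> x z; rewrite normrM; apply: ler_pM => //.
      by rewrite normrM mulrAC; apply: ler_pM.
    by rewrite normrM [leRHS]normrM mulrC (ger0_norm MU0); apply: ler_wpM2r.
  apply: eq_Rintegral => z _; rewrite -RintegralZl//.
    by apply: eq_Rintegral => x _; rewrite mulrCA.
  by apply: dominated_integrable; exact: (integrable_dominated_shift _ dW mU UM).
have dFphi : dominated (fun x => phi x * F x) by apply: dominatedM => //; exists MF.
have dGphi : dominated (fun x => phi x * G x) by apply: dominatedM => //; exists MG.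
have dPhi z : dominated (fun x => phi x * G x * F (x - z)).
  exact: (integrable_dominated_shift _ dGphi mF FM).
have dPsi z : dominated (fun x => phi x * F x * G (x - z)).
  exact: (integrable_dominated_shift _ dFphi mG GM).
have bound (u w : V -> R) (Mw : R) : dominated u -> measurable_fun setT w -> (forall x, `|w x| <= Mw) ->
    dominated (fun z => g z * \int[mu n]_x (u x * w (x - z))).
  move=> du mw wM; have [mu_ [Cu uC]] := du.
  have Mw0 : 0 <= Mw by exact: le_trans (normr_ge0 _) (wM 0).
  have le_u z x : `|u x * w (x - z)| <= Cu * Mw * decay x.
    by rewrite normrM mulrAC; apply: ler_pM.
  apply: dominatedM => //; last first.
    exists (Cu * Mw * pi ^+ n) => z; apply: normr_Rintegral_le => //.
    exact: (integrable_dominated_shift _ du mw wM).1.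
  apply: (@measurable_Rintegral_param _ _ _ V (fun z x => u x * w (x - z)) (Cu * Mw)) => //.
  apply: measurable_funM; first exact: (measurableT_comp mu_).
  by apply: (measurableT_comp mw); apply: measurable_rVB.
have d1 := bound _ _ _ dGphi mF FM.
have d2 := bound _ _ _ dFphi mG GM.
rewrite (swap F G MF MG)// (swap G F MG MF)//.
(* Reflection in z turns G (x - z) into G (x + z); replacing x by x - z then moves the shift onto
   phi and F. *)
have reflE : \int[mu n]_z (g z * \int[mu n]_x (phi x * F x * G (x - z))) =
    \int[mu n]_z (g z * \int[mu n]_x (phi (x - z) * F (x - z) * G x)).
  rewrite -(Rintegral_reflect 0 (dominated_integrable d2)).
  apply: eq_Rintegral => z _; rewrite sub0r gN; congr (_ * _).
  have := Rintegral_shift (- z) (dominated_integrable (dPsi (- z))).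
  by move=> <-; apply: eq_Rintegral => x _; rewrite opprK subrK.
have dSh z : (mu n).-integrable setT (EFin \o (fun x => phi (x - z) * F (x - z) * G x)).
  have := @integrable_affine _ n 1 (- z) _ (oner_neq0 _) (dominated_integrable (dPsi (- z))).
  by apply: (eq_integrable measurableT) => x _ /=; rewrite scale1r opprK subrK.
have d3 : dominated (fun z => g z * \int[mu n]_x (phi (x - z) * F (x - z) * G x)).
  have [md [C3 hC3]] := d2.
  have E : (fun z => g z * \int[mu n]_x (phi (x - z) * F (x - z) * G x)) =
    (fun z => (fun z => g z * \int[mu n]_x (phi x * F x * G (x - z))) (- z)).
    apply/funext => z; rewrite gN; congr (_ * _).
    have := Rintegral_shift (- z) (dominated_integrable (dPsi (- z))).
    by move=> <-; apply: eq_Rintegral => x _; rewrite opprK subrK.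
  rewrite E; split.
    apply: (measurableT_comp md).
    have -> : (-%R : V -> V) = (fun x : V => (-1 : R) *: x + 0).
      by apply/funext => x; rewrite scaleN1r addr0.
    exact: measurable_affine.
  exists C3 => z; apply: (le_trans (hC3 (- z))).
  suff -> : decay (- z) = decay z by [].
  by apply: eq_bigr => i _; rewrite mxE /oneDsqr sqrrN.
rewrite reflE -(RintegralB measurableT (dominated_integrable d1) (dominated_integrable d3)).
clear swap bound reflE d2.
pose K z := \int[mu n]_x ((phi x - phi (x - z)) * F (x - z) * G x).
have KE z : g z * \int[mu n]_x (phi x * G x * F (x - z)) -
    g z * \int[mu n]_x (phi (x - z) * F (x - z) * G x) = g z * K z.
  rewrite -mulrBr -(RintegralB measurableT (dominated_integrable (dPhi z)) (dSh z)).
  by congr (_ * _); apply: eq_Rintegral => x _; ring.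
under eq_Rintegral do rewrite KE.
have dK : dominated (fun z => g z * K z).
  have := dominatedB d1 d3; congr dominated; apply/funext => z; exact: KE.
rewrite (EFin_normr_Rintegral measurableT (dominated_integrable dK)).
clear KE d1 d3 dPsi.
apply: (le_trans (le_abse_integral _ measurableT _)).
  by apply/measurable_EFinP; exact: dK.1.
have mI : measurable_fun setT (fun q : V * V =>
   (g q.1 * (`|phi q.2 - phi (q.2 - q.1)| * `|F (q.2 - q.1)| * `|G q.2|))%:E).
  apply/measurable_EFinP; apply: measurable_funM; first exact: (measurableT_comp mg).
  have mB : measurable_fun setT (fun q : V * V => q.2 - q.1) by exact: measurable_rVB.
  apply: measurable_funM; last first.
    by apply: measurableT_comp => //; exact: (measurableT_comp mG).
  apply: measurable_funM; last first.
    by apply: measurableT_comp => //; exact: (measurableT_comp mF).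
  apply: measurableT_comp => //; apply: measurable_funB; first exact: (measurableT_comp mphi).
  exact: (measurableT_comp mphi).
have I0 z x : (0 <= (g z * (`|phi x - phi (x - z)| * `|F (x - z)| * `|G x|))%:E)%E.
  by rewrite lee_fin mulr_ge0 ?g0// !mulr_ge0.
apply: (ge0_le_integral _ measurableT); first by move=> z _; exact: abse_ge0.
- exact: (measurableT_comp (@abse_measurable R setT) (proj2 (measurable_EFinP _ _) dK.1)).
- exact: (@measurable_integral_param _ _ _ (mu n) _ V (fun z x => (g z * (`|phi x - phi (x - z)| * `|F (x - z)| * `|G x|))%:E)).
move=> z _; rewrite abse_EFin normrM (ger0_norm (g0 _)) EFinM.
have iK : (mu n).-integrable setT (EFin \o (fun x => (phi x - phi (x - z)) * F (x - z) * G x)).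
  have := integrableB measurableT (dominated_integrable (dPhi z)) (dSh z).
  by apply: eq_integrable => // x _ /=; rewrite -EFinB; congr EFin; ring.
rewrite (EFin_normr_Rintegral measurableT iK).
have mKx := measurable_int _ iK.
apply: (@le_trans _ _ ((g z)%:E * \int[mu n]_x `|((phi x - phi (x - z)) * F (x - z) * G x)%:E|)%E).
  by apply: lee_wpmul2l; [by rewrite lee_fin g0|exact: le_abse_integral].
rewrite -(ge0_integralZl _ measurableT (measurableT_comp (@abse_measurable R setT) mKx) (fun x _ => abse_ge0 _)); last by rewrite lee_fin g0.
rewrite le_eqVlt; apply/orP; left; apply/eqP.
by apply: eq_integral => x _; rewrite /= -EFinM !normrM.
Qed.

Lemma gamma_form phi (F G : V -> R) rho (MF MG : R) : 0 < rho -> dominated phi ->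
  (exists M, forall x, `|phi x| <= M) ->
  measurable_fun setT F -> measurable_fun setT G ->
  (forall x, `|F x| <= MF) -> (forall x, `|G x| <= MG) ->
  (`|\int[mu n]_x (phi x * G x * \int[mu n]_z (gamma rho z * F (x - z)))
    - \int[mu n]_x (phi x * F x * \int[mu n]_z (gamma rho z * G (x - z)))|%:E <=
   \int[mu n]_z \int[mu n]_x (gamma rho z * (`|phi x - phi (x - z)| * `|F (x - z)| * `|G x|))%:E)%E.
Proof.
move=> r0; apply: even_kernel_form; first exact: dominated_gamma.
  by move=> z; apply: gamma_ge0; exact: ltW.
exact: gammaN.
Qed.

End commutator_form.

Section commutator_kernel.
Context {R : realType} {n : nat}.
Local Notation leb := (@lebesgue_measure R).
Local Notation V := 'rV[R]_n.
Implicit Types (phi f g : V -> R) (rho : R) (x y z xi : V).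
Variable s : R.
Hypotheses (s0 : 0 < s) (s1 : s < 1) (n0 : (0 < n)%N).
Variable c : R.
Hypothesis c0 : 0 < c.
Hypothesis hc : forall xi : V, dotR xi xi != 0 ->
  (\int[leb]_r (wpow (s - 1) r * (symb s xi * heat r xi))%:E = c%:E)%E.

(** Integrability is not assumed: [fine] sends an infinite integral to 0. *)
Lemma normr_Rintegral_abse d (T : measurableType d) (m : {measure set T -> \bar R}) (h : T -> R) :
  measurable_fun setT h -> (`|\int[m]_x h x|%:E <= \int[m]_x `|(h x)%:E|)%E.
Proof.
move=> mh.
have mhE : measurable_fun setT (EFin \o h) by exact/measurable_EFinP.
apply: le_trans (le_abse_integral m measurableT mhE).
rewrite /Rintegral -[(\int[m]_x (EFin \o h) x)%E]/(\int[m]_x (h x)%:E)%E.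
by case: (\int[m]_x _)%E => [r| |] //=; rewrite normr0 leey.
Qed.

Lemma measurable_gamma d (T : measurableType d) (a : T -> R) (h : T -> V) :
  measurable_fun setT a -> measurable_fun setT h -> measurable_fun setT (fun t => gamma (a t) (h t)).
Proof.
move=> ma mh; have mX k : measurable_fun setT (fun t => (a t ^+ k)^-1).
  by apply: (measurableT_comp measurable_invr); exact: measurable_funX.
apply: measurable_funM => //; apply: measurableT_comp => //.
apply: measurable_funM; last exact: measurable_dotR.
by apply: measurableT_comp => //; apply: measurable_funM => //; exact: mX.
Qed.

Definition form_kernel phi (F G : V -> R) z x : R :=
  `|phi x - phi (x - z)| * `|F (x - z)| * `|G x|.

Lemma form_kernel_ge0 phi (F G : V -> R) z x : 0 <= form_kernel phi F G z x.
Proof. by rewrite !mulr_ge0. Qed.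

Lemma measurable_form_kernel phi (F G : V -> R) :
  measurable_fun setT phi -> measurable_fun setT F -> measurable_fun setT G ->
  measurable_fun setT (fun q : V * V => form_kernel phi F G q.1 q.2).
Proof.
move=> mphi mF mG.
have mB : measurable_fun setT (fun q : V * V => q.2 - q.1) by exact: measurable_rVB.
apply: measurable_funM; last first.
  by apply: measurableT_comp => //; exact: (measurableT_comp mG).
apply: measurable_funM; last first.
  by apply: measurableT_comp => //; exact: (measurableT_comp mF).
apply: measurableT_comp => //; apply: measurable_funB; first exact: (measurableT_comp mphi).
exact: (measurableT_comp mphi).
Qed.

Lemma weighted_form_le (D : measurableTypeR R -> R) (P : V -> V -> R) :
  measurable_fun setT D -> (forall z x, 0 <= P z x) ->
  measurable_fun setT (fun q : V * V => P q.1 q.2) ->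
  (forall r, 0 < r -> (`|D r|%:E <= \int[mu n]_z \int[mu n]_x (gamma r z * P z x)%:E)%E) ->
  (`|\int[leb]_r (wpow (s - 1) r * D r)|%:E <=
   \int[leb]_r \int[mu n]_z \int[mu n]_x (wpow (s - 1) r * gamma r z * P z x)%:E)%E.
Proof.
move=> mD P0 mP Dle.
have mwD : measurable_fun setT (fun r : measurableTypeR R => wpow (s - 1) r * D r).
  by apply: measurable_funM => //; apply: measurable_wpow; exact: measurable_id.
apply: (le_trans (normr_Rintegral_abse leb mwD)).
have wg0 r z : 0 <= wpow (s - 1) r * gamma r z.
  rewrite /wpow; case: ifPn => [r0|_]; last by rewrite mul0r.
  by rewrite mulr_ge0 ?powR_ge0 ?gamma_ge0 ?(ltW r0).
have mI : measurable_fun setT (fun q : measurableTypeR R * V * V =>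
    (wpow (s - 1) q.1.1 * gamma q.1.1 q.1.2 * P q.1.2 q.2)%:E).
  apply/measurable_EFinP; apply: measurable_funM; last first.
    by apply: (measurableT_comp (g := fun q : measurableTypeR R * V * V => (q.1.2, q.2)) mP);
      apply/measurable_fun_pairP; split => //; measurable_proj.
  apply: measurable_funM; first by apply: measurable_wpow; measurable_proj.
  by apply: measurable_gamma; measurable_proj.
have I0 r z x : (0 <= (wpow (s - 1) r * gamma r z * P z x)%:E)%E by rewrite lee_fin mulr_ge0.
have mI2 : measurable_fun setT (fun q : measurableTypeR R * V =>
    \int[mu n]_x (wpow (s - 1) q.1 * gamma q.1 q.2 * P q.2 x)%:E)%E.
  exact: (@measurable_integral_param _ _ _ (mu n) _ _ (fun (q : measurableTypeR R * V) x => (wpow (s - 1) q.1 * gamma q.1 q.2 * P q.2 x)%:E)).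
apply: ge0_le_integral => //.
- by apply: measurableT_comp => //; exact/measurable_EFinP.
- apply: (@measurable_integral_param _ _ _ (mu n) _ (measurableTypeR R) (fun r z => \int[mu n]_x (wpow (s - 1) r * gamma r z * P z x)%:E)%E) => //.
  by move=> r z; exact: integral_ge0.
move=> r _; have [r0|r0] := ltP 0 r; last first.
  have -> : wpow (s - 1) r * D r = 0 by rewrite /wpow ltNge r0 mul0r.
  rewrite abse0.
  by apply: integral_ge0 => z _; exact: integral_ge0.
rewrite abse_EFin normrM (ger0_norm (wpow_ge0 _ _)) EFinM.
apply: (le_trans (lee_wpmul2l _ (Dle _ r0))); first by rewrite lee_fin wpow_ge0.
have mgP : measurable_fun setT (fun q : V * V => (gamma r q.1 * P q.1 q.2)%:E).
  apply/measurable_EFinP; apply: measurable_funM => //.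
  by apply: measurable_gamma; [exact: measurable_cst|exact: measurable_fst].
have gP0 z x : (0 <= (gamma r z * P z x)%:E)%E by rewrite lee_fin mulr_ge0 ?gamma_ge0 ?(ltW r0).
have w0 : (0 <= (wpow (s - 1) r)%:E)%E by rewrite lee_fin wpow_ge0.
rewrite -ge0_integralZl//; last 2 first.
- exact: (@measurable_integral_param _ _ _ (mu n) _ V (fun z x => (gamma r z * P z x)%:E)).
- by move=> z _; exact: integral_ge0.
rewrite le_eqVlt; apply/orP; left; apply/eqP.
apply: eq_integral => z _; rewrite -ge0_integralZl//.
  by apply: eq_integral => x _; rewrite -EFinM mulrA.
exact: (measurable_curry1 (h := fun z x => (gamma r z * P z x)%:E) z mgP).
Qed.

Lemma integrable_subordination f (u : V -> R) : Cc_infty f -> dominated u ->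
  (mu n \x leb)%E.-integrable setT (fun z : V * measurableTypeR R =>
     (u z.1 * (wpow (s - 1) z.2 * flap_heat s f z.2 z.1))%:E).
Proof.
move=> Cf du; have [C C0 hC] := subordination s0 s1 c0 hc n0 Cf.
have mh : measurable_fun setT (fun z : V * measurableTypeR R =>
     (u z.1 * (wpow (s - 1) z.2 * flap_heat s f z.2 z.1))%:E).
  apply/measurable_EFinP; apply: measurable_funM; first exact: (measurableT_comp du.1).
  apply: measurable_funM; first exact: measurable_wpow.
  exact: measurable_flap_heat.
apply/(integrable12ltyP (mu n) leb mh).
have mr x : measurable_fun setT (fun r : R => `|(wpow (s - 1) r * flap_heat s f r x)%:E|%E).
  apply: measurableT_comp => //; apply/measurable_EFinP.
  apply: measurable_funM; first by apply: measurable_wpow; exact: measurable_id.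
  by apply: measurable_flap_heat => //; exact: measurable_cst.
have du' : dominated (fun x => C * u x) by exact: dominatedZ.
apply: (@le_lt_trans _ _ (\int[mu n]_x `|(C * u x)%:E|)%E); last first.
  by have /integrableP[] := dominated_integrable du'.
apply: ge0_le_integral => //.
- by move=> x _; exact: integral_ge0.
- apply: (@measurable_integral_param _ _ _ leb _ V
    (fun x r => `|(u x * (wpow (s - 1) r * flap_heat s f r x))%:E|)%E) => //.
  exact: measurableT_comp.
- by apply: measurableT_comp => //; apply/measurable_EFinP; exact: du'.1.
move=> x _.
have -> : (\int[leb]_r `|(u x * (wpow (s - 1) r * flap_heat s f r x))%:E| =
    `|u x|%:E * \int[leb]_r `|(wpow (s - 1) r * flap_heat s f r x)%:E|)%E.
  have u0 : (0 <= `|u x|%:E)%E by rewrite lee_fin.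
  rewrite -(ge0_integralZl leb measurableT (mr x) (fun r _ => abse_ge0 _) u0).
  by apply: eq_integral => r _; rewrite !abse_EFin -EFinM normrM.
rewrite abse_EFin normrM (ger0_norm C0) mulrC EFinM lee_wpmul2l ?lee_fin//.
exact: (hC x).2.2.
Qed.

(** Both c f and c g are expanded by [subordination] and Fubini is applied to the difference [H] as
    a whole. For fixed r the difference [D r] is the one that [gamma_form] bounds, so the
    cancellation takes place before the integration over r. *)
Lemma commutator_kernel phi f g : Cc_infty phi -> Cc_infty f -> Cc_infty g ->
  ((c * `|\int[mu n]_x (phi x * f x * flap s g x - phi x * g x * flap s f x)|)%:E <=
   \int[leb]_r \int[mu n]_z \int[mu n]_x (wpow (s - 1) r * gamma r z *
      form_kernel phi (flap s f) (flap s g) z x)%:E)%E.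
Proof.
move=> Cphi Cf Cg.
have dphi := Cc_infty_dominated Cphi; have mphi := dphi.1.
have [M M0 phiM] := Cc_infty_bounded Cphi.
set F := flap s f; set G := flap s g.
have mF : measurable_fun setT F by exact: measurable_flap.
have mG : measurable_fun setT G by exact: measurable_flap.
have [MF MF0 FM] := flap_bounded s0 s1 Cf.
have [MG MG0 GM] := flap_bounded s0 s1 Cg.
have [Pf Pf0 PfM] := flap_heat_bounded s0 s1 Cf.
have [Pg Pg0 PgM] := flap_heat_bounded s0 s1 Cg.
have [Cf' _ hf] := subordination s0 s1 c0 hc n0 Cf.
have [Cg' _ hg] := subordination s0 s1 c0 hc n0 Cg.
have dG : dominated (fun x => phi x * G x) by apply: dominatedM => //; exists MG.
have dF : dominated (fun x => phi x * F x) by apply: dominatedM => //; exists MF.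
have df := Cc_infty_dominated Cf; have dg := Cc_infty_dominated Cg.
have mPf r : measurable_fun setT (flap_heat s f r).
  by apply: measurable_flap_heat => //; exact: measurable_cst.
have mPg r : measurable_fun setT (flap_heat s g r).
  by apply: measurable_flap_heat => //; exact: measurable_cst.
pose H x (r : R) := phi x * G x * (wpow (s - 1) r * flap_heat s f r x) -
   phi x * F x * (wpow (s - 1) r * flap_heat s g r x).
have iH : (mu n \x leb)%E.-integrable setT (fun z : V * measurableTypeR R => (H z.1 z.2)%:E).
  by have := integrableB measurableT (integrable_subordination Cf dG) (integrable_subordination Cg dF).
have i1 x : leb.-integrable setT (fun r => (phi x * G x * (wpow (s - 1) r * flap_heat s f r x))%:E).
  by have := integrableZl measurableT (phi x * G x) (hf x).1; apply: eq_integrable.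
have i2 x : leb.-integrable setT (fun r => (phi x * F x * (wpow (s - 1) r * flap_heat s g r x))%:E).
  by have := integrableZl measurableT (phi x * F x) (hg x).1; apply: eq_integrable.
have dPf r : dominated (fun x => phi x * G x * flap_heat s f r x).
  exact: dominatedM (mPf r) (ex_intro _ Pf (PfM r)) dG.
have dPg r : dominated (fun x => phi x * F x * flap_heat s g r x).
  exact: dominatedM (mPg r) (ex_intro _ Pg (PgM r)) dF.
pose D (r : R) := \int[mu n]_x (phi x * G x * flap_heat s f r x) - \int[mu n]_x (phi x * F x * flap_heat s g r x).
have HE x r : H x r = wpow (s - 1) r * (phi x * G x * flap_heat s f r x - phi x * F x * flap_heat s g r x).
  have rg (a b w p q : R) : a * (w * p) - b * (w * q) = w * (a * p - b * q) by ring.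
  exact: rg.
have dH r : dominated (H^~ r).
  have := dominatedZ (wpow (s - 1) r) (dominatedB (dPf r) (dPg r)).
  by congr dominated; apply/funext => x; rewrite HE.
have DE r : \int[mu n]_x H x r = wpow (s - 1) r * D r.
  rewrite /D -(RintegralB measurableT (dominated_integrable (dPf r)) (dominated_integrable (dPg r))).
  rewrite -(RintegralZl _ measurableT (dominated_integrable (dominatedB (dPf r) (dPg r)))).
  by apply: eq_Rintegral => x _; exact: HE.
have mD : measurable_fun setT (D : measurableTypeR R -> R).
  have P (u h : V -> R) (Ch : R) : Cc_infty h -> dominated u -> (forall r x, `|flap_heat s h r x| <= Ch) ->
      measurable_fun setT (fun r : measurableTypeR R => \int[mu n]_x (u x * flap_heat s h r x)).
    move=> Ch' [mu_ [Cu uC]] hCh.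
    apply: (@measurable_Rintegral_param _ _ _ (measurableTypeR R) (fun r x => u x * flap_heat s h r x) (Cu * Ch)).
      apply: measurable_funM; first exact: (measurableT_comp mu_).
      exact: measurable_flap_heat.
    by move=> r x; rewrite normrM mulrAC; apply: ler_pM.
  exact: measurable_funB (P (fun x => phi x * G x) f Pf Cf dG PfM) (P (fun x => phi x * F x) g Pg Cg dF PgM).
have -> : c * `|\int[mu n]_x (phi x * f x * G x - phi x * g x * F x)| = `|\int[leb]_r (wpow (s - 1) r * D r)|.
  have dfG : dominated (fun x => phi x * f x * G x).
    have [Mf _ fM] := Cc_infty_bounded Cf.
    exact: dominatedM mG (ex_intro _ MG GM) (dominatedM df.1 (ex_intro _ Mf fM) dphi).
  have dgF : dominated (fun x => phi x * g x * F x).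
    have [Mg _ gM] := Cc_infty_bounded Cg.
    exact: dominatedM mF (ex_intro _ MF FM) (dominatedM dg.1 (ex_intro _ Mg gM) dphi).
  rewrite -{1}(gtr0_norm c0) -normrM; congr (`|_|).
  rewrite -(RintegralZl _ measurableT (dominated_integrable (dominatedB dfG dgF))).
  under [RHS]eq_Rintegral do rewrite -DE.
  rewrite -(Rintegral_Fubini iH _ (fun r => dominated_integrable (dH r))); last first.
    by move=> x; have := integrableB measurableT (i1 x) (i2 x).
  apply: eq_Rintegral => x _.
  rewrite (RintegralB measurableT (i1 x) (i2 x)).
  have rg (a u v U W w : R) : w * (a * u * W - a * v * U) = a * W * (w * u) - a * U * (w * v) by ring.
  transitivity (phi x * G x * (c * f x) - phi x * F x * (c * g x)); first exact: rg.
  congr (_ - _).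
    exact: (etrans (congr1 (fun t => _ * t) (hf x).2.1) (esym (RintegralZl _ measurableT (hf x).1))).
  exact: (etrans (congr1 (fun t => _ * t) (hg x).2.1) (esym (RintegralZl _ measurableT (hg x).1))).
apply: (weighted_form_le mD (form_kernel_ge0 phi F G) (measurable_form_kernel mphi mF mG)) => r r0.
have E1 : \int[mu n]_x (phi x * G x * flap_heat s f r x) =
    \int[mu n]_x (phi x * G x * \int[mu n]_z (gamma r z * F (x - z))).
  by apply: eq_Rintegral => x _; rewrite (flap_heatE s0 s1 x Cf r0).
have E2 : \int[mu n]_x (phi x * F x * flap_heat s g r x) =
    \int[mu n]_x (phi x * F x * \int[mu n]_z (gamma r z * G (x - z))).
  by apply: eq_Rintegral => x _; rewrite (flap_heatE s0 s1 x Cg r0).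
rewrite (congr2 (fun a b : R => a - b) E1 E2 : D r = _).
exact: (gamma_form r0 dphi (ex_intro _ M phiM) mF mG FM GM).
Qed.

End commutator_kernel.

(** * From Gaussians to cubes *)

Section kernel_bound.
Context {R : realType} {n : nat}.
Local Notation leb := (@lebesgue_measure R).
Local Notation V := 'rV[R]_n.
Implicit Types (x y z : V).
Variable s : R.
Hypotheses (s0 : 0 < s) (s1 : s < 1) (n0 : (0 < n)%N).

Lemma exists_max_coord z : exists i, forall j, `|z ord0 j| <= `|z ord0 i|.
Proof.
case: (@Order.TotalTheory.arg_maxP _ R 'I_n (Ordinal n0) xpredT (fun j => `|z ord0 j|)) => // i _ h.
by exists i => j; exact: h.
Qed.

(** The left side is the power of order n of t exp(- t/n), and exp(t/n) >= 1 + t/n bounds that by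
    n. *)
Lemma exprn_expRN_le (t : R) : 0 <= t -> t ^+ n * expR (- t) <= n%:R ^+ n.
Proof.
move=> t0; have nR : 0 < n%:R :> R by rewrite ltr0n.
have -> : expR (- t) = (expR (t / n%:R)) ^- n.
  by rewrite expRN; congr (_^-1); rewrite -expRM_natl mulrC divfK// gt_eqF.
rewrite -exprVn -exprMn lerXn2r ?nnegrE ?mulr_ge0 ?invr_ge0 ?expR_ge0// ?(ltW nR)//.
rewrite ler_pdivrMr ?expR_gt0//.
apply: (@le_trans _ _ (n%:R * (1 + t / n%:R))); last by rewrite ler_wpM2l ?expR_ge1Dx// ltW.
by rewrite mulrDr mulr1 mulrCA mulfV ?gt_eqF// mulr1 lerDr ltW.
Qed.

(** With t = v/r >= 1 the Gaussian factor is at most exp(- t^2), hence at most exp(- t), and r^(-n)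
    = t^n v^(-n). *)
Lemma gamma_le_near (r v : R) z i : 0 < r -> `|z ord0 i| = v -> r <= v ->
  gamma r z <= n%:R ^+ n * v ^- n.
Proof.
move=> r0 zv rv; have v0 : 0 < v by exact: lt_le_trans rv.
pose t := v / r; have t1 : 1 <= t by rewrite ler_pdivlMr// mul1r.
have t0 : 0 <= t by exact: le_trans t1.
have ge : gauss (pi / r ^+ 2) z <= expR (- t).
  rewrite ler_expR mulNr lerN2.
  apply: (@le_trans _ _ (t ^+ 2)); first by rewrite expr2 ler_peMl.
  have d2 : v ^+ 2 <= dotR z z.
    rewrite -zv real_normK ?num_real// /dotR (bigD1 i)//= -expr2 lerDl.
    by apply: sumr_ge0 => j _; rewrite -expr2 sqr_ge0.
  rewrite /t expr_div_n [leRHS]mulrAC ler_wpM2r ?invr_ge0 ?sqr_ge0//.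
  apply: (le_trans d2); rewrite ler_peMl ?dotR_ge0//.
  by apply: le_trans (pi_ge2 R); lra.
apply: (@le_trans _ _ (r ^- n * expR (- t))).
  by rewrite ler_wpM2l// invr_ge0 exprn_ge0// ltW.
have -> : r ^- n * expR (- t) = (t ^+ n * expR (- t)) * v ^- n.
  rewrite /t expr_div_n; have vn : v ^+ n != 0 by rewrite expf_neq0// gt_eqF.
  have rn : r ^+ n != 0 by rewrite expf_neq0// gt_eqF.
  have E (a b e : R) : a != 0 -> b != 0 -> a^-1 * e = b / a * e / b.
    by move=> a0 b0; field; rewrite a0 b0.
  exact: E.
by rewrite ler_wpM2r ?exprn_expRN_le// invr_ge0 exprn_ge0// ltW.
Qed.

(** Let v be the largest |z_i|. For r > v, where [near0] is 1, the trivial bound r^(-n) gives the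
    integrand of the right side. For r <= v the bound n^n v^(-n) integrates to a multiple of
    v^(s-n), as does the right side over u > v. *)
Lemma gamma_kernel : exists2 C : R, 0 < C & forall z,
  (\int[leb]_r (wpow (s - 1) r * gamma r z)%:E <=
   C%:E * \int[leb]_u (wpow (s - n%:R - 1) u * near0 u z)%:E)%E.
Proof.
have nR : 1 <= n%:R :> R by rewrite ler1n.
have ns : 0 < n%:R - s by rewrite subr_gt0; exact: lt_le_trans nR.
(* The ratio of n^n v^(-n) v^s / s, the contribution of r <= v, to v^(s-n)/(n-s), the integral of
   u^(s-n-1) beyond v. *)
pose K : R := n%:R ^+ n * (n%:R - s) / s.
have K0 : 0 <= K by rewrite divr_ge0 ?(ltW s0)// mulr_ge0 ?exprn_ge0// ?(ltW ns)// (le_trans _ nR).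
exists (1 + K); first by rewrite ltr_wpDr.
move=> z; have [i hi] := exists_max_coord z.
pose v := `|z ord0 i|; have v0 : 0 <= v by exact: normr_ge0.
have near1 u : v < u -> near0 u z = 1.
  by move=> vu; apply: big1 => j _; rewrite (le_lt_trans (hi j)).
have mA : measurable_fun setT (fun u : R => (wpow (s - n%:R - 1) u * near0 u z)%:E).
  apply/measurable_EFinP; apply: measurable_funM; first by apply: measurable_wpow; exact: measurable_id.
  by apply: measurable_near0; [exact: measurable_id|exact: measurable_cst].
have A0 u : (0 <= (wpow (s - n%:R - 1) u * near0 u z)%:E)%E.
  by rewrite lee_fin mulr_ge0 ?wpow_ge0 ?near0_ge0.
pose h : R := n%:R ^+ n * v ^- n.
have h0 : 0 <= h by rewrite mulr_ge0 ?invr_ge0 ?exprn_ge0// (le_trans _ nR).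
pose B (r : R) := if r \in `]0%R, v]%classic then wpow (s - 1) r * h else 0.
have B0 r : 0 <= B r by rewrite /B; case: ifP => // _; rewrite mulr_ge0 ?wpow_ge0.
have mB : measurable_fun setT B.
  apply: measurable_fun_ifT => //; first exact: measurable_fun_mem.
  by apply: measurable_funM => //; apply: measurable_wpow; exact: measurable_id.
apply: (@le_trans _ _ (\int[leb]_r ((wpow (s - n%:R - 1) r * near0 r z)%:E + (B r)%:E))%E).
  apply: ge0_le_integral => //.
  - move=> r _; rewrite lee_fin /wpow; case: ifPn => [r0|_]; last by rewrite mul0r.
    by rewrite mulr_ge0 ?powR_ge0// gamma_ge0// ltW.
  - apply/measurable_EFinP; apply: measurable_funM; first by apply: measurable_wpow; exact: measurable_id.
    by apply: measurable_gamma; [exact: measurable_id|exact: measurable_cst].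
  - by apply: emeasurable_funD => //; apply/measurable_EFinP.
  move=> r _; rewrite -EFinD lee_fin.
  have [r0|r0] := leP r 0.
    by rewrite {1 2}/wpow ltNge r0/= !mul0r add0r.
  have [rv|vr] := leP r v; last first.
    rewrite near1// mulr1 /B ifF; last first.
      by apply/negbTE; rewrite mem_setE in_itv/= r0/= -ltNge.
    rewrite addr0 /wpow r0.
    have -> : s - n%:R - 1 = (s - 1) + - n%:R by ring.
    rewrite [X in _ <= X]powRD; last by rewrite (gt_eqF r0) implybT.
    rewrite ler_wpM2l ?powR_ge0// powRN powR_mulrn ?(ltW r0)//.
    rewrite ler_piMr ?invr_ge0 ?exprn_ge0 ?(ltW r0)// -[leRHS]expR0 ler_expR mulNr oppr_le0.
    by rewrite mulr_ge0 ?dotR_ge0// divr_ge0 ?pi_ge0// sqr_ge0.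
  rewrite /B ifT; last by rewrite mem_setE in_itv/= r0.
  apply: (@le_trans _ _ (wpow (s - 1) r * h)).
    by rewrite ler_wpM2l ?wpow_ge0//; exact: (gamma_le_near r0 _ rv).
  by rewrite lerDr mulr_ge0 ?wpow_ge0 ?near0_ge0.
rewrite ge0_integralD//; last 2 first.
- by move=> r _; rewrite lee_fin.
- exact/measurable_EFinP.
set I := (\int[leb]_r (_ * near0 r z)%:E)%E.
have I0 : (0 <= I)%E by exact: integral_ge0.
rewrite EFinD ge0_muleDl ?lee_fin// mul1e leeD2l//.
rewrite /B integral_wpow_itv//; last by move=> r /=; rewrite !in_itv/= andbT => /andP[].
(* For z = 0 the range r <= v is empty. *)
have [v00|v00] := eqVneq v 0.
  rewrite v00 (_ : `]0%R, 0%R]%classic = set0) ?integral_set0 ?mule0 ?mule_ge0 ?lee_fin//.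
  by rewrite set_itv_ge// bnd_simp ltxx.
have vp : 0 < v by rewrite lt_def v00.
have Ige : ((v `^ (- (n%:R - s)) / (n%:R - s))%:E <= I)%E.
  rewrite -(integral_powRy ns vp) -[leLHS]mul1e.
  rewrite -integral_wpow_itv//; last by move=> u /=; rewrite !in_itv/= !andbT; exact: lt_trans.
  apply: ge0_le_integral => //.
  - by move=> u _; rewrite lee_fin; case: ifP => // _; rewrite mulr1 wpow_ge0.
  - apply/measurable_EFinP; apply: measurable_fun_ifT => //; first exact: measurable_fun_mem.
    by apply: measurable_funM => //; apply: measurable_wpow; exact: measurable_id.
  move=> u _; case: ifPn => [|_ //].
  rewrite mem_setE in_itv/= andbT => vu; rewrite near1//.
  by have -> : - (n%:R - s) - 1 = s - n%:R - 1 by ring.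
apply: (@le_trans _ _ (h%:E * (v `^ s / s)%:E)%E).
  by rewrite lee_wpmul2l ?lee_fin//; exact: integral_powR0_le.
apply: (@le_trans _ _ (K%:E * (v `^ (- (n%:R - s)) / (n%:R - s))%:E)%E); last first.
  by rewrite lee_wpmul2l ?lee_fin.
rewrite -!EFinM lee_fin le_eqVlt; apply/orP; left; apply/eqP.
have -> : v `^ (- (n%:R - s)) = v `^ s * v ^- n.
  have -> : - (n%:R - s) = s + - n%:R by ring.
  rewrite powRD; last by rewrite (gt_eqF vp) implybT.
  by rewrite powRN powR_mulrn.
rewrite /h /K; set a := v `^ s; set b := v ^- n; set N := n%:R ^+ n.
have nss : n%:R - s != 0 by rewrite gt_eqF.
have E (N' b' a' k s' : R) : k != 0 -> N' * b' * (a' * s') = N' * k * s' * (a' * b' * k^-1).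
  by move=> k0; field.
exact: E.
Qed.

(** Tonelli brings the integral over r inside, where the pointwise kernel bound applies; then y = x
    - z restores the two points. *)
Lemma kernel_form_le (C : R) phi (F G : V -> R) : 0 < C ->
  (forall z, (\int[leb]_r (wpow (s - 1) r * gamma r z)%:E <=
     C%:E * \int[leb]_u (wpow (s - n%:R - 1) u * near0 u z)%:E)%E) ->
  measurable_fun setT phi -> measurable_fun setT F -> measurable_fun setT G ->
  (\int[leb]_r \int[mu n]_z \int[mu n]_x (wpow (s - 1) r * gamma r z * form_kernel phi F G z x)%:E <=
   C%:E * \int[mu n]_x \int[mu n]_y \int[leb]_u (wpow (s - n%:R - 1) u * near0 u (x - y) *
      (`|phi x - phi y| * `|F y| * `|G x|))%:E)%E.
Proof.
move=> C0 hC mphi mF mG.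
pose P := form_kernel phi F G.
have P0 z x : 0 <= P z x by exact: form_kernel_ge0.
have mP : measurable_fun setT (fun q : V * V => P q.1 q.2) by exact: measurable_form_kernel.
have wg0 r z : 0 <= wpow (s - 1) r * gamma r z.
  rewrite /wpow; case: ifPn => [r0|_]; last by rewrite mul0r.
  by rewrite mulr_ge0 ?powR_ge0 ?gamma_ge0 ?(ltW r0).
have mPc d (T : measurableType d) (a b : T -> V) : measurable_fun setT a -> measurable_fun setT b ->
    measurable_fun setT (fun t => P (a t) (b t)).
  by move=> ma mb; apply: (measurableT_comp (g := fun t => (a t, b t)) mP); exact/measurable_fun_pairP.
have mQ d (T : measurableType d) (r : T -> measurableTypeR R) (a b : T -> V) :
    measurable_fun setT r -> measurable_fun setT a -> measurable_fun setT b ->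
    measurable_fun setT (fun t => (wpow (s - 1) (r t) * gamma (r t) (a t) * P (a t) (b t))%:E).
  move=> mr ma mb; apply/measurable_EFinP; apply: measurable_funM; last exact: mPc.
  by apply: measurable_funM; [exact: measurable_wpow|exact: measurable_gamma].
have Q0 r z x : (0 <= (wpow (s - 1) r * gamma r z * P z x)%:E)%E by rewrite lee_fin mulr_ge0.
rewrite (tonelli3 leb (mu n) (mu n) (f := fun r z x => (wpow (s - 1) r * gamma r z * P z x)%:E)) => //; last first.
  by apply: mQ; measurable_proj.
pose W x z := (C%:E * \int[leb]_u (wpow (s - n%:R - 1) u * near0 u z * P z x)%:E)%E.
have mWi d (T : measurableType d) (u : T -> measurableTypeR R) (a b : T -> V) :
    measurable_fun setT u -> measurable_fun setT a -> measurable_fun setT b ->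
    measurable_fun setT (fun t => (wpow (s - n%:R - 1) (u t) * near0 (u t) (a t) * P (a t) (b t))%:E).
  move=> mr ma mb; apply/measurable_EFinP; apply: measurable_funM; last exact: mPc.
  by apply: measurable_funM; [exact: measurable_wpow|exact: measurable_near0].
have Wi0 u z x : (0 <= (wpow (s - n%:R - 1) u * near0 u z * P z x)%:E)%E.
  by rewrite lee_fin mulr_ge0// mulr_ge0 ?wpow_ge0 ?near0_ge0.
have W0 x z : (0 <= W x z)%E by rewrite mule_ge0 ?lee_fin ?(ltW C0)//; exact: integral_ge0.
have mW : measurable_fun setT (fun q : V * V => W q.1 q.2).
  apply: measurable_funeM.
  apply: (@measurable_integral_param _ _ _ leb _ (V * V)%type
    (fun q u => (wpow (s - n%:R - 1) u * near0 u q.2 * P q.2 q.1)%:E)) => //.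
  by apply: mWi; measurable_proj.
have mWx x : measurable_fun setT (W x) by exact: (measurable_curry1 x mW).
apply: (@le_trans _ _ (\int[mu n]_x \int[mu n]_z W x z)%E).
  apply: ge0_le_integral => //.
  - by move=> x _; apply: integral_ge0 => r _; exact: integral_ge0.
  - apply: (@measurable_integral_param _ _ _ leb _ V
      (fun x r => \int[mu n]_z (wpow (s - 1) r * gamma r z * P z x)%:E)%E).
      apply: (@measurable_integral_param _ _ _ (mu n) _ _
        (fun (q : V * measurableTypeR R) z => (wpow (s - 1) q.2 * gamma q.2 z * P z q.1)%:E)) => //.
      by apply: mQ; measurable_proj.
    by move=> x r; exact: integral_ge0.
  - exact: (@measurable_integral_param _ _ _ (mu n) _ V W).
  move=> x _.
  rewrite (tonelli2 leb (mu n) (f := fun r z => (wpow (s - 1) r * gamma r z * P z x)%:E)) => //; last first.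
    by apply: mQ; measurable_proj.
  apply: ge0_le_integral => //.
  - by move=> z _; exact: integral_ge0.
  - apply: (@measurable_integral_param _ _ _ leb _ V (fun z r => (wpow (s - 1) r * gamma r z * P z x)%:E)) => //.
    by apply: mQ; measurable_proj.
  move=> z _; rewrite /W.
  have mg : measurable_fun setT (fun r : measurableTypeR R => (wpow (s - 1) r * gamma r z)%:E).
    apply/measurable_EFinP; apply: measurable_funM; first by apply: measurable_wpow; exact: measurable_id.
    by apply: measurable_gamma; [exact: measurable_id|exact: measurable_cst].
  have mn : measurable_fun setT (fun r : measurableTypeR R => (wpow (s - n%:R - 1) r * near0 r z)%:E).
    apply/measurable_EFinP; apply: measurable_funM; first by apply: measurable_wpow; exact: measurable_id.
    by apply: measurable_near0; [exact: measurable_id|exact: measurable_cst].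
  under eq_integral do rewrite EFinM.
  have g0 (r : R) : setT r -> (0 <= (wpow (s - 1) r * gamma r z)%:E)%E by rewrite lee_fin.
  have w0 (r : R) : setT r -> (0 <= (wpow (s - n%:R - 1) r * near0 r z)%:E)%E.
    by rewrite lee_fin mulr_ge0 ?wpow_ge0 ?near0_ge0.
  have p0 : (0 <= (P z x)%:E)%E by rewrite lee_fin.
  rewrite (ge0_integralZr leb measurableT mg g0 p0).
  under [in leRHS]eq_integral do rewrite EFinM.
  rewrite (ge0_integralZr leb measurableT mn w0 p0) muleA.
  by rewrite lee_wpmul2r.
have CE : (0 <= C%:E)%E by rewrite lee_fin ltW.
have PE x y : P (x - y) x = `|phi x - phi y| * `|F y| * `|G x|.
  by rewrite /P /form_kernel; have -> : x - (x - y) = y by rewrite opprB addrCA subrr addr0.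
have mX x : measurable_fun setT (fun y => \int[leb]_u (wpow (s - n%:R - 1) u * near0 u (x - y) *
      (`|phi x - phi y| * `|F y| * `|G x|))%:E)%E.
  under eq_fun => y do under eq_integral do rewrite -PE.
  apply: (@measurable_integral_param _ _ _ leb _ V
    (fun y u => (wpow (s - n%:R - 1) u * near0 u (x - y) * P (x - y) x)%:E)) => //.
  by apply: mWi; (try measurable_proj); apply: measurable_rVB; measurable_proj.
have X0 x y : (0 <= \int[leb]_u (wpow (s - n%:R - 1) u * near0 u (x - y) *
      (`|phi x - phi y| * `|F y| * `|G x|))%:E)%E.
  by apply: integral_ge0 => u _; rewrite -PE.
have mXX : measurable_fun setT (fun x => \int[mu n]_y \int[leb]_u (wpow (s - n%:R - 1) u * near0 u (x - y) *
      (`|phi x - phi y| * `|F y| * `|G x|))%:E)%E.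
  apply: (@measurable_integral_param _ _ _ (mu n) _ V (fun x y => \int[leb]_u (wpow (s - n%:R - 1) u * near0 u (x - y) *
      (`|phi x - phi y| * `|F y| * `|G x|))%:E)%E) => //.
  under eq_fun => q do under eq_integral do rewrite -PE.
  apply: (@measurable_integral_param _ _ _ leb _ (V * V)%type
    (fun q u => (wpow (s - n%:R - 1) u * near0 u (q.1 - q.2) * P (q.1 - q.2) q.1)%:E)) => //.
  by apply: mWi; (try measurable_proj); apply: measurable_rVB; measurable_proj.
rewrite -(ge0_integralZl (mu n) measurableT mXX _ CE); last first.
  by move=> x _; exact: integral_ge0.
rewrite le_eqVlt; apply/orP; left; apply/eqP.
apply: eq_integral => x _.
rewrite -(ge0_integralZl (mu n) measurableT (mX x) (fun y _ => X0 x y) CE).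
have N1 : -1 != 0 :> R by rewrite oppr_eq0 oner_neq0.
have := ge0_integral_affine x N1 (mWx x) (W0 x).
rewrite normrN1 invr1 expr1n mul1e => <-.
apply: eq_integral => y _; rewrite /W scaleN1r [- y + x]addrC; congr (_ * _)%E.
by apply: eq_integral => u _; rewrite PE.
Qed.

End kernel_bound.

Local Open Scope complex_scope.

(** * The complex definitions in real terms *)

Section fraclap_flap.
Context {R : realType} {n : nat}.
Local Notation V := 'rV[R]_n.
Implicit Types (phi f g : V -> R) (x y z xi : V).
Variable s : R.
Hypotheses (s0 : 0 < s) (s1 : s < 1).

Lemma wcos_add f th b xi : dominated f ->
  wcos f (th + b) xi = wcos f th xi * cos b + wcos f (th + pi / 2) xi * sin b.
Proof.
move=> df.
have d1 := dominated_integrable (dominated_phase th xi df).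
have d2 := dominated_integrable (dominated_phase (th + pi / 2) xi df).
rewrite /wcos -(RintegralZr _ measurableT d1) -(RintegralZr _ measurableT d2).
rewrite -(RintegralD measurableT (integrableZr measurableT _ d1) (integrableZr measurableT _ d2)).
apply: eq_Rintegral => y _; rewrite !addrA cosDpihalf cosD.
ring.
Qed.

Lemma wcosDpi f th xi : dominated f -> wcos f (th + pi / 2 + pi / 2) xi = - wcos f th xi.
Proof.
move=> df; have d1 := dominated_integrable (dominated_phase th xi df).
rewrite -[RHS]mulN1r /wcos -(RintegralZl _ measurableT d1).
by apply: eq_Rintegral => y _; rewrite !addrA !cosDpihalf sinDpihalf mulrN mulN1r.
Qed.

(** The imaginary part is minus the sine transform, that is the cosine transform with phase pi/2. *)
Lemma fourierE f xi : dominated f ->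
  fourier f xi = Complex (wcos f 0 xi) (wcos f (pi / 2) xi).
Proof.
move=> df; rewrite /fourier /cint.
have E1 : (fun y => complex.Re ((f y)%:C * cexpi (- (2 * pi * dotR y xi)))%C) =
    (fun y => f y * cos (2 * pi * dotR y xi + 0)).
  by apply/funext => y; rewrite /= mul0r subr0 cosN addr0.
have E2 : (fun y => complex.Im ((f y)%:C * cexpi (- (2 * pi * dotR y xi)))%C) =
    (fun y => f y * cos (2 * pi * dotR y xi + pi / 2)).
  by apply/funext => y; rewrite /= mul0r addr0 sinN cosDpihalf.
by rewrite E1 E2 !dominated_rintE//; exact: dominated_phase.
Qed.

Lemma fraclapE f x : Cc_infty f -> fraclap s f x = Complex (flap s f x) 0.
Proof.
move=> Cf; have df := Cc_infty_dominated Cf.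
have [C C0 hC] := wcos_decay Cf s0 s1.
rewrite /fraclap /cint.
have E1 : (fun xi => complex.Re (((2 * pi * enorm xi) `^ s)%:C * fourier f xi * cexpi (2 * pi * dotR x xi))%C) =
    (fun xi => symb s xi * wcos f (- (2 * pi * dotR x xi)) xi).
  apply/funext => xi; rewrite fourierE//= -[- _ in RHS]add0r wcos_add// cosN sinN add0r.
  rewrite /symb; ring.
have E2 : (fun xi => complex.Im (((2 * pi * enorm xi) `^ s)%:C * fourier f xi * cexpi (2 * pi * dotR x xi))%C) =
    (fun xi => symb s xi * wcos f (pi / 2 - 2 * pi * dotR x xi) xi).
  apply/funext => xi; rewrite fourierE//= wcos_add// cosN sinN.
  have -> : wcos f (pi / 2 + pi / 2) xi = - wcos f 0 xi by rewrite -(wcosDpi 0 xi df) add0r.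
  rewrite /symb; ring.
have mdot : measurable_fun setT (fun xi => 2 * pi * dotR x xi).
  by apply: measurable_funM => //; apply: measurable_dotR => //; exact: measurable_id.
have dom (a : V -> R) : measurable_fun setT a -> dominated (fun xi => symb s xi * wcos f (a xi) xi).
  move=> ma; split; last first.
    by exists C => xi; rewrite normrM (ger0_norm (symb_ge0 _ _)); exact: (hC (a xi) xi).2.
  apply: measurable_funM; first by apply: measurable_symb; exact: measurable_id.
  by apply: measurable_wcos => //; exact: measurable_id.
have d1 := dom (fun xi => - (2 * pi * dotR x xi)) (measurableT_comp (@oppr_measurable R setT) mdot).
have d2 := dom (fun xi => pi / 2 - 2 * pi * dotR x xi) (measurable_funB (measurable_cst _) mdot).
rewrite E1 E2 !dominated_rintE//; congr Complex.
(* The imaginary part is the integral of an odd function of xi, so it equals its own negative. *)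
set I := Rintegral _ _ _.
have : I = - I.
  rewrite /I -{1}(Rintegral_reflect 0 (dominated_integrable d2)).
  rewrite -[RHS]mulN1r -(RintegralZl _ measurableT (dominated_integrable d2)).
  apply: eq_Rintegral => xi _; rewrite sub0r.
  have -> : symb s (- xi) = symb s xi by rewrite /symb /enorm dotRNl dotRNr opprK.
  rewrite mulrCA; congr (_ * _).
  have d3 := dominated_integrable (dominated_phase (pi / 2 - 2 * pi * dotR x xi) xi df).
  rewrite /wcos -(RintegralZl _ measurableT d3); apply: eq_Rintegral => y _.
  rewrite mulrCA; congr (_ * _); rewrite !dotRNr !mulrN opprK mulN1r.
  set a := 2 * pi * dotR y xi; set b := 2 * pi * dotR x xi.
  have -> : - a + (pi / 2 + b) = - (a - b) + pi / 2 by ring.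
  have -> : a + (pi / 2 - b) = (a - b) + pi / 2 by ring.
  by rewrite !cosDpihalf sinN.
move/eqP; rewrite -addr_eq0 -mulr2n -mulr_natl mulf_eq0 pnatr_eq0/= => /eqP.
exact.
Qed.

(** The kernel cos(2 pi (y - x).xi) is symmetric in x and y. Integrated against the symbol, this is
    the self-adjointness [flap_sym], which takes the place of Parseval. *)
Lemma wave_sym f g xi : dominated f -> dominated g ->
  \int[mu n]_x (g x * wave f x xi) = \int[mu n]_x (f x * wave g x xi).
Proof.
move=> df dg; have [mf [Cf fC]] := df; have [mg [Cg gC]] := dg.
transitivity (\int[mu n]_x \int[mu n]_y (g x * (f y * cos (2 * pi * dotR y xi + - (2 * pi * dotR x xi))))).
  apply: eq_Rintegral => x _.
  by rewrite -(RintegralZl _ measurableT (dominated_integrable (dominated_phase _ xi df))).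
rewrite (@Rintegral_swap _ _ _ V (mu n) _ f Cg); last 3 first.
- apply: measurable_funM; first exact: (measurableT_comp mg).
  apply: measurable_funM; first exact: (measurableT_comp mf).
  apply: measurable_phase; [exact: measurable_snd|exact: measurable_cst|].
  apply: measurableT_comp => //; apply: measurable_funM => //.
  by apply: measurable_dotR; [exact: measurable_fst|exact: measurable_cst].
- exact: dominated_integrable.
- move=> x y; rewrite normrM; apply: ler_pM => //.
  by rewrite normrM ler_piMr// cos_max.
apply: eq_Rintegral => y _.
rewrite /wave /wcos -(RintegralZl _ measurableT (dominated_integrable (dominated_phase _ xi dg))).
apply: eq_Rintegral => x _; rewrite mulrCA; congr (_ * (_ * _)).
by rewrite -cosN opprB.
Qed.

Lemma flap_sym f g : Cc_infty f -> Cc_infty g ->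
  \int[mu n]_x (g x * flap s f x) = \int[mu n]_x (f x * flap s g x).
Proof.
have E u v : Cc_infty u -> Cc_infty v -> \int[mu n]_x (v x * flap s u x) =
    \int[mu n]_xi (symb s xi * \int[mu n]_x (v x * wave u x xi)).
  move=> Cu Cv; have du := Cc_infty_dominated Cu; have dv := Cc_infty_dominated Cv.
  have [mv [C vC]] := dv; have [D D0 hD] := wave_decay s0 s1 Cu.
  have mw x : measurable_fun setT (wave u x).
    by apply: measurable_wave => //; exact: measurable_id.
  have iw x : (mu n).-integrable setT (EFin \o (fun xi => symb s xi * wave u x xi)).
    apply: dominated_integrable; split; last by exists D => xi; exact: (hD x xi).2.
    by apply: measurable_funM => //; apply: measurable_symb; exact: measurable_id.
  transitivity (\int[mu n]_x \int[mu n]_xi (v x * (symb s xi * wave u x xi))).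
    by apply: eq_Rintegral => x _; rewrite (RintegralZl _ measurableT (iw x)).
  rewrite (@Rintegral_swap _ _ _ V (mu n) _ (fun xi => D * decay xi) C); last 3 first.
  - apply: measurable_funM; first exact: (measurableT_comp mv).
    by apply: measurable_funM; [exact: measurable_symb|exact: measurable_wave].
  - apply: dominated_integrable; apply: dominatedZ; split; first exact: measurable_decay.
    by exists 1 => y; rewrite mul1r ger0_norm// ltW// decay_gt0.
  - move=> x xi; rewrite normrM; apply: ler_pM => //.
    by apply: (le_trans (hD x xi).2); exact: ler_norm.
  apply: eq_Rintegral => xi _.
  have iv : (mu n).-integrable setT (EFin \o (fun x => v x * wave u x xi)).
    apply: dominated_integrable; apply: dominatedM => //.
      by apply: measurable_wave => //; exact: measurable_id.
    by exists (D * decay xi) => x; exact: (hD x xi).1.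
  by rewrite -(RintegralZl _ measurableT iv); apply: eq_Rintegral => x _; rewrite mulrCA.
move=> Cf Cg; apply: (etrans (E f g Cf Cg)); apply: etrans (esym (E g f Cg Cf)).
apply: eq_Rintegral => xi _.
exact: (congr1 (fun t => symb s xi * t) (wave_sym xi (Cc_infty_dominated Cf) (Cc_infty_dominated Cg))).
Qed.

Lemma dominatedM_flap f u : Cc_infty f -> dominated u -> dominated (fun x => u x * flap s f x).
Proof.
move=> Cf du; apply: dominatedM => //; first exact: measurable_flap.
by have [C _ hC] := flap_bounded s0 s1 Cf; exists C.
Qed.

(** [flap_sym] moves the operator from phi f onto g, so that only the fractional Laplacians of f and
    g remain. *)
Lemma commutator_integralE phi f g : Cc_infty phi -> Cc_infty f -> Cc_infty g ->
  cabs (cint (fun x => commut s phi f x * (g x)%:C)%C) =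
  `|\int[mu n]_x (phi x * f x * flap s g x - phi x * g x * flap s f x)|.
Proof.
move=> Cphi Cf Cg; have Cpf := Cc_inftyM Cphi Cf; have Cpg := Cc_inftyM Cphi Cg.
have dg := Cc_infty_dominated Cg.
have E x : (commut s phi f x * (g x)%:C)%C =
    Complex (g x * flap s (fun y => phi y * f y) x - phi x * g x * flap s f x) 0.
  rewrite /commut (fraclapE x Cpf) (fraclapE x Cf).
  have gen (a b c d : R) : ((Complex a 0 - c%:C * Complex b 0) * d%:C)%C = Complex (d * a - c * d * b) 0.
    by apply/eqP; rewrite eq_complex/=; apply/andP; split; apply/eqP; ring.
  exact: gen.
have d1 := dominatedM_flap Cpf dg.
have d2 := dominatedM_flap Cf (Cc_infty_dominated Cpg).
have d3 := dominatedM_flap Cg (Cc_infty_dominated Cpf).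
rewrite /cint.
under eq_fun do rewrite E.
under [X in Complex _ (rint X)]eq_fun do rewrite E.
rewrite /= [rint (fun=> 0)](_ : _ = 0); last first.
  by rewrite /rint ge0_lintE ?integral0.
rewrite /cabs/= expr0n addr0 sqrtr_sqr dominated_rintE; last exact: dominatedB.
have e1 := RintegralB measurableT (dominated_integrable d1) (dominated_integrable d2).
have e2 := RintegralB measurableT (dominated_integrable d3) (dominated_integrable d2).
exact: (congr1 (fun t : R => `|t|) (etrans e1 (etrans (congr1 (fun t => t - _) (flap_sym Cpf Cg)) (esym e2)))).
Qed.

Lemma Lpnorm_fraclapE f (p : R) : Cc_infty f ->
  Lpnorm p (fraclap s f) = ((\int[mu n]_x (`|flap s f x| `^ p)%:E) `^ p^-1)%E.
Proof.
move=> Cf; rewrite /Lpnorm; congr (_ `^ _)%E.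
have E x : cabs (fraclap s f x) = `|flap s f x|.
  by rewrite fraclapE// /cabs/= expr0n addr0 sqrtr_sqr.
under eq_fun do rewrite E.
rewrite ge0_lintE//.
  apply/measurable_EFinP; apply: measurable_powR_comp; apply: measurableT_comp => //.
  exact: measurable_flap.
Qed.

End fraclap_flap.

(** * Mean oscillation over balls and over cubes *)

Section bmo_cubes.
Context {R : realType} {n : nat}.
Local Notation V := 'rV[R]_n.
Implicit Types (phi : V -> R) (x y z : V).

Lemma enorm_coord_le y i : `|y ord0 i| <= enorm y.
Proof.
rewrite -sqrtr_sqr /enorm ler_sqrt ?dotR_ge0// /dotR (bigD1 i)//= expr2 lerDl.
by apply: sumr_ge0 => j _; rewrite -expr2 sqr_ge0.
Qed.

Lemma eball_sub_cube z (r : R) : eball z r `<=` cube z r.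
Proof.
move=> y /= yr i; have := enorm_coord_le (y - z) i; rewrite !mxE => h.
have := le_lt_trans h yr; rewrite ltr_norml => /andP[h1 h2].
by apply/andP; split; lra.
Qed.

(** The factor n + 1 strictly exceeds the square root of n, as the open ball requires, and is
    positive in dimension 0 too. *)
Lemma cube_sub_eball z (u : R) : 0 < u -> cube z u `<=` eball z (n.+1%:R * u).
Proof.
move=> u0 y hy; rewrite /eball /= /enorm.
have k0 : 0 < n.+1%:R * u by rewrite mulr_gt0.
rewrite -[ltRHS](ger0_norm (ltW k0)) -[ltRHS]sqrtr_sqr ltr_sqrt ?exprn_gt0//.
apply: (@le_lt_trans _ _ (\sum_(i < n) u ^+ 2)).
  apply: ler_sum => i _; rewrite -expr2 !mxE -[leLHS]real_normK ?num_real// lerXn2r ?nnegrE ?(ltW u0)//.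
  by have /andP[h1 h2] := hy i; rewrite ler_norml; apply/andP; split; lra.
rewrite sumr_const card_ord -[ltLHS]mulr_natl exprMn ltr_pM2r ?exprn_gt0//.
by rewrite -natrX ltr_nat -mulnn leq_pmulr.
Qed.

Lemma measurable_eball z (r : R) : measurable (eball z r : set V).
Proof.
have m : measurable_fun setT (fun y : V => enorm (y - z)).
  apply: (measurableT_comp (f := @Num.sqrt R)).
    by apply: continuous_measurable_fun; exact: sqrt_continuous.
  by apply: measurable_dotR; apply: measurable_rVB => //; exact: measurable_id.
have -> : (eball z r : set V) = setT `&` (fun y : V => enorm (y - z)) @^-1` `]-oo, r[%classic.
  by rewrite setTI; apply/seteqP; split => y; rewrite /eball /= in_itv.
exact: m.
Qed.

(** The cube sits in a ball of radius (n+1) u, which sits in a cube of that half-side; hence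
    (n+1)^n, without computing the volume of a ball. The factor 2 pays for replacing the mean over
    the ball by the mean over the cube. *)
Lemma bmo_cube_le phi (be : R) : bm phi -> (bmo phi <= be%:E)%E ->
  forall z (u : R), 0 < u ->
  cI z u (fun x => `|phi x - mean phi z u|) <= 2 * n.+1%:R ^+ n * be * (2 * u) ^+ n.
Proof.
move=> bphi hb z u u0; have u0' := ltW u0.
pose r := n.+1%:R * u; have r0 : 0 < r by rewrite mulr_gt0.
pose B : set V := eball z r; pose m := avg B phi.
have mB : measurable B by exact: measurable_eball.
have m1B : measurable_fun setT (\1_B : V -> R) by exact: measurable_indic.
have bd : bm (fun x => `|phi x - m|) by apply: bm_norm; apply: bmB => //; exact: bm_cst.
have B01 x : 0 <= (\1_B x : R) <= 1 by rewrite indicE; case: (_ \in _); rewrite ?lexx ?ler01.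
have B_chi x : (\1_B x : R) <= chi z r x.
  rewrite /chi !indicE; case: (boolP (x \in B)) => [/set_mem xB|_]; last by rewrite ler0n.
  by rewrite mem_set//; exact: eball_sub_cube.
have chi_B x : chi z u x <= (\1_B x : R).
  rewrite /chi !indicE; case: (boolP (x \in cube z u)) => [/set_mem xB|_]; last by rewrite ler0n.
  by rewrite mem_set//; exact: cube_sub_eball.
have iB h : bm h -> (mu n).-integrable setT (EFin \o (fun x => \1_B x * h x)).
  move=> bh; apply: (le_integrable measurableT _ _ (integrable_chi z (ltW r0) (bm_norm bh))).
    by apply/measurable_EFinP; apply: measurable_funM => //; exact: bh.1.
  move=> x _; rewrite /= lee_fin !normrM normr_id; have /andP[b0 b1] := B01 x.
  by rewrite ler_wpM2r// !ger0_norm ?chi_ge0.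
have volE : vol B = \int[mu n]_x (\1_B x * 1).
  rewrite /vol /rint ge0_lintE; last 2 first.
  - exact/measurable_EFinP.
  - by move=> x; rewrite lee_fin; have /andP[] := B01 x.
  by congr fine; apply: eq_integral => x _; rewrite mulr1.
have rintE : rint (fun x => \1_B x * `|phi x - m|) = \int[mu n]_x (\1_B x * `|phi x - m|).
  rewrite /rint ge0_lintE//.
  by apply/measurable_EFinP; apply: measurable_funM => //; exact: bd.1.
have vol_ge : (2 * u) ^+ n <= vol B.
  rewrite -[leLHS]mul1r -(cI_cst z 1 u0') volE; apply: le_Rintegral => //.
  - by apply: integrable_chi => //; exact: bm_cst.
  - by apply: iB; exact: bm_cst.
  - by move=> x _; rewrite !mulr1.
have vol_le : vol B <= (2 * r) ^+ n.
  rewrite -[leRHS]mul1r -(cI_cst z 1 (ltW r0)) volE; apply: le_Rintegral => //.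
  - by apply: iB; exact: bm_cst.
  - by apply: integrable_chi; [exact: ltW|exact: bm_cst].
  - by move=> x _; rewrite !mulr1.
have vol0 : 0 < vol B by apply: lt_le_trans vol_ge; rewrite exprn_gt0// mulr_gt0.
have osc : \int[mu n]_x (\1_B x * `|phi x - m|) <= be * vol B.
  rewrite -rintE -ler_pdivrMr// -lee_fin; apply: le_trans hb.
  by apply: ereal_sup_ubound; exists z => //; exists r.
have be0 : 0 <= be.
  rewrite -(pmulr_lge0 _ vol0); apply: le_trans osc; apply: Rintegral_ge0 => x _.
  by rewrite mulr_ge0//; have /andP[] := B01 x.
have cle : cI z u (fun x => `|phi x - m|) <= be * vol B.
  apply: le_trans osc; apply: le_Rintegral => //.
  - exact: integrable_chi.
  - exact: iB.
  - by move=> x _; rewrite ler_wpM2r.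
have w0 : 0 < (2 * u) ^+ n by rewrite exprn_gt0// mulr_gt0.
have mm : `|mean phi z u - m| * (2 * u) ^+ n <= cI z u (fun x => `|phi x - m|).
  have bB : bm (fun x => phi x - m) by apply: bmB => //; exact: bm_cst.
  apply: le_trans (cI_norm z u0' bB).
  rewrite -{1}(gtr0_norm w0) -normrM le_eqVlt; apply/orP; left; apply/eqP; congr (`|_|).
  rewrite cID//; last exact: bm_cst.
  by rewrite cI_cst// mulrBl /mean mulrAC mulVf ?mul1r ?gt_eqF// mulNr.
apply: (@le_trans _ _ (cI z u (fun x => `|phi x - m| + `|mean phi z u - m|))).
  apply: cI_le => //.
  - by apply: bm_norm; apply: bmB => //; exact: bm_cst.
  - by apply: bmD => //; exact: bm_cst.
  - by move=> x _; rewrite -[phi x - mean phi z u](subrKA m) (le_trans (ler_normD _ _))// lerD2l distrC.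
rewrite cID//; last exact: bm_cst.
rewrite cI_cst//.
apply: (@le_trans _ _ (be * vol B + be * vol B)); first by rewrite lerD// (le_trans mm).
have -> : 2 * n.+1%:R ^+ n * be * (2 * u) ^+ n = be * (2 * r) ^+ n + be * (2 * r) ^+ n.
  have -> : 2 * r = n.+1%:R * (2 * u) by rewrite mulrCA.
  rewrite [(n.+1%:R * _) ^+ n]exprMn; set a := n.+1%:R ^+ n; set w := (2 * u) ^+ n.
  by ring.
by rewrite lerD// ler_wpM2l.
Qed.

Lemma bmo_ge0 phi : bm phi -> (0 <= bmo phi)%E.
Proof.
move=> bphi; apply: (@le_trans _ _ (avg (eball 0 1) (fun x => `|phi x - avg (eball 0 1) phi|))%:E); last first.
  by apply: ereal_sup_ubound; exists 0 => //; exists 1 => //=; exact: ltr01.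
have mB : measurable (eball 0 1 : set V) by exact: measurable_eball.
have m1B : measurable_fun setT (\1_(eball 0 1) : V -> R) by exact: measurable_indic.
have B0 x : 0 <= (\1_(eball 0 1 : set V) x : R) by rewrite indicE ler0n.
rewrite lee_fin /avg divr_ge0// /vol /rint ge0_lintE.
- by apply: fine_ge0; apply: integral_ge0 => x _; rewrite lee_fin mulr_ge0.
- apply/measurable_EFinP; apply: measurable_funM => //; apply: measurableT_comp => //.
  by apply: measurable_funB => //; exact: bphi.1.
- by move=> x; rewrite lee_fin mulr_ge0.
- by apply: fine_ge0; apply: integral_ge0 => x _; rewrite lee_fin.
- exact/measurable_EFinP.
- by move=> x; rewrite lee_fin.
Qed.

(** Without oscillation, |phi| on a fixed cube integrates to at most the volume times the absolute
    mean over any larger concentric cube, and these means tend to 0 because phi is integrable. *)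
Lemma bmo_eq0_integral phi : (0 < n)%N -> bm phi -> dominated phi -> (bmo phi <= 0)%E ->
  \int[mu n]_x `|phi x| = 0.
Proof.
move=> n0 bphi dphi hb; have [mphi [C phiC]] := dphi.
have dabs : dominated (fun x => `|phi x|).
  split; first exact: measurableT_comp.
  by exists C => x; rewrite normr_id.
have babs : bm (fun x => `|phi x|) by exact: bm_norm.
have osc z u : 0 < u -> cI z u (fun x => `|phi x - mean phi z u|) <= 0.
  by move=> u0; have := bmo_cube_le bphi hb z u0; rewrite mulr0 mul0r.
have C0 : 0 <= C.
  by have := le_trans (normr_ge0 _) (phiC 0); rewrite pmulr_lge0// decay_gt0.
have zero (M : R) : 0 < M -> cI (0 : V) M (fun x => `|phi x|) = 0.
  move=> M0; apply/eqP; rewrite eq_le cI_ge0// andbT; apply/ler_addgt0Pr => e e0; rewrite add0r.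
  pose D := C * pi ^+ n; have D0 : 0 <= D by rewrite mulr_ge0// exprn_ge0// pi_ge0.
  (* Enlarging the cube k times leaves at most D / k^n, which is at most D / k since n >= 1, and
     this k makes it less than e. *)
  pose k := 1 + D / e; have k1 : 1 <= k by rewrite lerDl divr_ge0// ltW.
  have k0 : 0 < k by exact: lt_le_trans k1.
  pose N := k * M; have N0 : 0 < N by rewrite mulr_gt0.
  have MN : M <= N by rewrite ler_peMl// ltW.
  pose m := mean phi 0 N.
  have bm1 : bm (fun x => `|phi x - m|) by apply: bm_norm; apply: bmB => //; exact: bm_cst.
  apply: (@le_trans _ _ (cI 0 M (fun x => `|phi x - m| + `|m|))).
    apply: cI_le => //; first exact: ltW.
      by apply: bmD => //; exact: bm_cst.
    by move=> x _; rewrite -{1}(subrK m (phi x)); exact: ler_normD.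
  rewrite cID ?(ltW M0)//; last exact: bm_cst.
  rewrite cI_cst ?(ltW M0)//.
  apply: (@le_trans _ _ (0 + `|m| * (2 * M) ^+ n)).
    rewrite lerD2r; apply: le_trans (osc 0 N N0); apply: le_Rintegral => //.
    - by apply: integrable_chi => //; exact: ltW.
    - by apply: integrable_chi => //; exact: ltW.
    move=> x _; rewrite ler_wpM2r// /chi !indicE.
    case: (boolP (x \in cube 0 M)) => [/set_mem xB|_]; last by rewrite ler0n.
    rewrite mem_set// => i; have := xB i; rewrite mxE => /andP[h1 h2].
    by apply/andP; split; lra.
  rewrite add0r /m /mean normrM.
  have cI_le0 : `|cI 0 N phi| <= D.
    rewrite /cI; apply: normr_Rintegral_le.
      by apply: measurable_funM => //; apply: measurable_chi.
    move=> x; rewrite normrM; apply: le_trans (phiC x).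
    by rewrite ler_piMl// /chi indicE; case: (_ \in _); rewrite ?normr1 ?normr0 ?ler01.
  have p0 : 0 < (2 * M) ^+ n by rewrite exprn_gt0// mulr_gt0.
  have -> : `|((2 * N) ^+ n)^-1| = (k ^+ n)^-1 * ((2 * M) ^+ n)^-1.
    rewrite ger0_norm; last by rewrite invr_ge0 exprn_ge0// mulr_ge0// ltW.
    by rewrite /N mulrCA exprMn invfM.
  rewrite mulrAC mulfVK ?gt_eqF//.
  apply: (@le_trans _ _ (k^-1 * D)).
    apply: ler_pM => //; first by rewrite invr_ge0 exprn_ge0// ltW.
    rewrite lef_pV2 ?posrE ?exprn_gt0// -[leLHS]expr1.
    by rewrite ler_weXn2l.
  rewrite mulrC ler_pdivrMr// /k mulrDr mulr1 mulrCA mulfV ?gt_eqF// mulr1 lerDr ltW//.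
have L : (\int[mu n]_x (chi 0 k.+1%:R x * `|phi x|)) @[k --> \oo] --> \int[mu n]_x `|phi x|.
  apply: (@Rintegral_dominated_cvg _ _ _ _ _ _ (fun x => C * decay x)).
  - move=> k; apply: measurable_funM; last exact: dabs.1.
    by apply: measurable_chi.
  - exact: dabs.1.
  - apply: dominated_integrable; apply: dominatedZ; split; first exact: measurable_decay.
    by exists 1 => y; rewrite mul1r ger0_norm// ltW// decay_gt0.
  - move=> x; apply: cvg_near_cst; near=> k.
    suff -> : chi 0 k.+1%:R x = 1 by rewrite mul1r.
    rewrite /chi indicE mem_set// => i; rewrite mxE sub0r add0r.
    have h : `|x ord0 i| < k.+1%:R.
      apply: (@le_lt_trans _ _ (\sum_j `|x ord0 j|)).
        by rewrite (bigD1 i)//= lerDl sumr_ge0.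
      apply: (@lt_trans _ _ k%:R); last by rewrite ltr_nat.
      by near: k; exact: nbhs_infty_gtr.
    by move: h; rewrite ltr_norml => /andP[h1 h2]; rewrite (ltW h1).
  - move=> k x; rewrite normrM normr_id; apply: le_trans (phiC x).
    by rewrite ler_piMl// /chi indicE; case: (_ \in _); rewrite ?normr1 ?normr0 ?ler01.
have Z k : \int[mu n]_x (chi 0 k.+1%:R x * `|phi x|) = 0 by exact: zero.
move: L; under eq_cvg do rewrite Z.
by move=> L; apply/esym; apply: (cvg_unique _ (@cvg_cst _ 0 _ _ _) L).
Unshelve. all: by end_near. Qed.

End bmo_cubes.

(** * Scaling, degenerate cases and the final estimate *)

Section assembly.
Context {R : realType} {n : nat}.
Local Notation leb := (@lebesgue_measure R).
Local Notation V := 'rV[R]_n.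
Implicit Types (phi f g : V -> R) (x y z xi : V).

Lemma Cc_infty_bm f : Cc_infty f -> bm f.
Proof.
move=> Cf; split; first exact: Cc_infty_measurable.
by have [M _ hM] := Cc_infty_bounded Cf; exists M.
Qed.

Lemma Cc_infty_osc f (be : R) : Cc_infty f -> 0 < be -> exists2 dl : R, 0 < dl &
  forall (z : V) (u : R) (x y : V), 0 < u -> u <= dl -> cube z u x -> cube z u y -> `|f x - f y| <= be.
Proof.
move=> Cf be0; have [M M0 hM] := Cc_infty_lipschitz Cf.
(* Two points of the cube differ by at most 2 u in each of the n coordinates; the 1 keeps D positive
   when M is 0. *)
pose D := M * n%:R * 2 + 1; have D0 : 0 < D by rewrite ltr_wpDl// mulr_ge0// mulr_ge0.
exists (be / D); first by rewrite divr_gt0.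
move=> z u x y u0 ud xz yz; apply: (le_trans (hM x y)).
apply: (@le_trans _ _ (M * \sum_(i < n) (2 * u))).
  rewrite ler_wpM2l//; apply: ler_sum => i _.
  have /andP[a1 a2] := xz i; have /andP[b1 b2] := yz i.
  by rewrite ler_norml; apply/andP; split; lra.
rewrite sumr_const card_ord -[2 * u *+ n]mulr_natl.
apply: (@le_trans _ _ (D * u)); last by rewrite mulrC -ler_pdivlMr.
have -> : M * (n%:R * (2 * u)) = M * n%:R * 2 * u by ring.
by rewrite ler_wpM2r ?(ltW u0)// lerDl.
Qed.

Lemma ge0_integral3Zl (k : R) (h : V -> V -> measurableTypeR R -> R) :
  measurable_fun setT (fun q : V * V * measurableTypeR R => h q.1.1 q.1.2 q.2) ->
  (forall x y u, 0 <= h x y u) -> 0 <= k ->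
  (\int[mu n]_x \int[mu n]_y \int[leb]_u (k * h x y u)%:E =
   k%:E * \int[mu n]_x \int[mu n]_y \int[leb]_u (h x y u)%:E)%E.
Proof.
move=> mh h0 k0; have kE : (0 <= k%:E)%E by rewrite lee_fin.
have hE x y u : (0 <= (h x y u)%:E)%E by rewrite lee_fin.
have m3 : measurable_fun setT (fun q : V * V * measurableTypeR R => (h q.1.1 q.1.2 q.2)%:E).
  exact/measurable_EFinP.
have m2 : measurable_fun setT (fun q : V * V => \int[leb]_u (h q.1 q.2 u)%:E)%E.
  exact: (@measurable_integral_param _ _ _ leb _ (V * V)%type (fun q u => (h q.1 q.2 u)%:E)).
have m1 : measurable_fun setT (fun x => \int[mu n]_y \int[leb]_u (h x y u)%:E)%E.
  apply: (@measurable_integral_param _ _ _ (mu n) _ V (fun x y => \int[leb]_u (h x y u)%:E)%E) => //.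
  by move=> x y; exact: integral_ge0.
have p2 x y : (0 <= \int[leb]_u (h x y u)%:E)%E by exact: integral_ge0.
have p1 x : (0 <= \int[mu n]_y \int[leb]_u (h x y u)%:E)%E by exact: integral_ge0.
rewrite -(ge0_integralZl (mu n) measurableT m1 (fun x _ => p1 x) kE).
apply: eq_integral => x _.
rewrite -(ge0_integralZl (mu n) measurableT (measurable_curry1 (h := fun x y => (\int[leb]_u (h x y u)%:E)%E) x m2) (fun y _ => p2 x y) kE).
apply: eq_integral => y _.
rewrite -(ge0_integralZl leb measurableT (measurable_curry1 (h := fun q u => (h q.1 q.2 u)%:E) (x, y) m3) (fun u _ => hE x y u) kE).
by apply: eq_integral => u _; rewrite EFinM.
Qed.

(** Homogeneity: the normalised bound is applied to |F| / N1 and |G| / N2. *)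
Lemma form_bound_scaled (s p1 p2 : R) : (0 < n)%N -> 0 < s -> 1 < p1 -> 1 < p2 ->
  p1^-1 + p2^-1 = 1 + s / n%:R ->
  exists2 C : R, 0 < C & forall (b F G : V -> R) (be dl N1 N2 : R),
    bm b -> 0 < be -> 0 < dl -> 0 < N1 -> 0 < N2 ->
    (forall (z : V) (u : R), 0 < u ->
      cI z u (fun x => `|b x - mean b z u|) <= be * (2 * u) ^+ n) ->
    (forall (z : V) (u : R) (x y : V), 0 < u -> u <= dl -> cube z u x -> cube z u y ->
      `|b x - b y| <= be) ->
    bm F -> bm G ->
    (\int[mu n]_x (`|F x| `^ p1)%:E <= (N1 `^ p1)%:E)%E ->
    (\int[mu n]_x (`|G x| `^ p2)%:E <= (N2 `^ p2)%:E)%E ->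
    (\int[mu n]_x \int[mu n]_y \int[leb]_u
       (wpow (s - n%:R - 1) u * near0 u (x - y) * (`|b x - b y| * `|F y| * `|G x|))%:E
       <= (C * be * N1 * N2)%:E)%E.
Proof.
move=> n0 s0 p11 p21 pp.
have [C [C0 hC]] := form_bound n0 s0 p11 p21 pp; exists C => //.
move=> b F G be dl N1 N2 bb be0 dl0 N10 N20 hb ho bF bG hF hG.
have normalize (H : V -> R) (N p : R) : 0 < N -> 1 < p -> bm H ->
    (\int[mu n]_x (`|H x| `^ p)%:E <= (N `^ p)%:E)%E ->
    (\int[mu n]_x ((N^-1 * `|H x|) `^ p)%:E <= 1)%E.
  move=> N0 _ bH hH; have NV : 0 <= N^-1 by rewrite invr_ge0 ltW.
  have k0 : (0 <= (N^-1 `^ p)%:E)%E by rewrite lee_fin powR_ge0.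
  have mH : measurable_fun setT (fun x => (`|H x| `^ p)%:E).
    by apply/measurable_EFinP; apply: measurable_powR_comp; apply: measurableT_comp => //; exact: bH.1.
  under eq_integral do rewrite powRM// EFinM.
  rewrite (ge0_integralZl (mu n) measurableT mH _ k0); last by move=> x _; rewrite lee_fin powR_ge0.
  apply: (le_trans (lee_wpmul2l k0 hH)).
  by rewrite -EFinM -powRM ?(ltW N0)// mulVf ?gt_eqF// powR1.
have bscale (H : V -> R) (N : R) : 0 < N -> bm H -> bm (fun x => N^-1 * `|H x|).
  by move=> N0 bH; apply: bmM; [exact: bm_cst|exact: bm_norm].
have F0 x : 0 <= N1^-1 * `|F x| by rewrite mulr_ge0// invr_ge0 ltW.
have G0 x : 0 <= N2^-1 * `|G x| by rewrite mulr_ge0// invr_ge0 ltW.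
have := hC b _ _ be dl bb be0 dl0 hb ho (bscale F N1 N10 bF) F0 (bscale G N2 N20 bG) G0
  (normalize F N1 p1 N10 p11 bF hF) (normalize G N2 p2 N20 p21 bG hG).
pose h x y (u : measurableTypeR R) := wpow (s - n%:R - 1) u * near0 u (x - y) *
   (`|b x - b y| * (N1^-1 * `|F y|) * (N2^-1 * `|G x|)).
have mb := bb.1; have mF := bF.1; have mG := bG.1.
have mh : measurable_fun setT (fun q : V * V * measurableTypeR R => h q.1.1 q.1.2 q.2).
  have m1 : measurable_fun setT (fun q : V * V * measurableTypeR R => q.1.1) by measurable_proj.
  have m2 : measurable_fun setT (fun q : V * V * measurableTypeR R => q.1.2) by measurable_proj.
  apply: measurable_funM.
    apply: measurable_funM; first by apply: measurable_wpow; measurable_proj.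
    by apply: measurable_near0; [measurable_proj|exact: measurable_rVB].
  apply: measurable_funM; last first.
    by apply: measurable_funM => //; apply: measurableT_comp => //; exact: (measurableT_comp mG m1).
  apply: measurable_funM; last first.
    by apply: measurable_funM => //; apply: measurableT_comp => //; exact: (measurableT_comp mF m2).
  apply: measurableT_comp => //; apply: measurable_funB; first exact: (measurableT_comp mb m1).
  exact: (measurableT_comp mb m2).
have h0 x y u : 0 <= h x y u.
  apply: mulr_ge0; first by rewrite mulr_ge0 ?wpow_ge0 ?near0_ge0.
  by apply: mulr_ge0 => //; apply: mulr_ge0.
have k0 : 0 <= N1 * N2 by rewrite mulr_ge0// ltW.
have kE : (0 <= (N1 * N2)%:E)%E by rewrite lee_fin.
move=> /(lee_wpmul2l kE); rewrite -(ge0_integral3Zl mh h0 k0) -EFinM.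
have -> : N1 * N2 * (C * be) = C * be * N1 * N2 by ring.
apply: le_trans; rewrite le_eqVlt; apply/orP; left; apply/eqP.
apply: eq_integral => x _; apply: eq_integral => y _; apply: eq_integral => u _; congr EFin.
rewrite /h; set w := wpow _ _ * _; set d := `|b x - b y|.
have rg (a c e k N M : R) : N != 0 -> M != 0 ->
    a * (c * e * k) = N * M * (a * (c * (N^-1 * e) * (M^-1 * k))).
  by move=> N0 M0; field; rewrite N0 M0.
by apply: rg; rewrite gt_eqF.
Qed.

Variable s : R.
Hypotheses (s0 : 0 < s) (s1 : s < 1) (n0 : (0 < n)%N).

Lemma flap_zero x : flap s (fun=> 0 : R) x = 0 :> R.
Proof.
rewrite /flap (_ : \int[mu n]_xi _ = \int[mu n]_xi 0); first by rewrite /Rintegral integral0.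
apply: eq_Rintegral => xi _; rewrite /wave /wcos.
rewrite (_ : \int[mu n]_y _ = \int[mu n]_y 0); first by rewrite /Rintegral integral0 mulr0.
by apply: eq_Rintegral => y _; rewrite mul0r.
Qed.

(** If [flap s f] vanishes almost everywhere, its convolution with each Gaussian vanishes
    everywhere, and [subordination] recovers f from these convolutions. *)
Lemma flap_null f (p : R) : Cc_infty f -> 0 < p ->
  (\int[mu n]_x (`|flap s f x| `^ p)%:E = 0)%E -> f = (fun=> 0).
Proof.
move=> Cf p0 hF.
have [c c0 hc] := @mellin_symb R n s s0 s1.
have [C _ hC] := subordination s0 s1 c0 hc n0 Cf.
have mF := measurable_flap s0 s1 Cf.
have mFp : measurable_fun setT (fun x => (`|flap s f x| `^ p)%:E).
  by apply/measurable_EFinP; apply: measurable_powR_comp; exact: measurableT_comp.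
have ae0 : ae_eq (mu n) setT (fun x => (`|flap s f x| `^ p)%:E) (cst 0%E).
  apply/(ae_eq_integral_abs (mu n) measurableT mFp); rewrite -[RHS]hF.
  by apply: eq_integral => x _; rewrite gee0_abs// lee_fin powR_ge0.
have hz r x : 0 < r -> flap_heat s f r x = 0.
  move=> r0; rewrite (flap_heatE s0 s1 x Cf r0).
  have dg := @dominated_gamma R n _ r0.
  have [MF _ FM] := flap_bounded s0 s1 Cf.
  have mB : measurable_fun setT (fun z : V => x - z).
    by apply: measurable_rVB => //; exact: measurable_id.
  have d1 : dominated (fun z => gamma r z * flap s f (x - z)).
    exact: dominatedM (measurableT_comp mF mB) (ex_intro _ MF (fun z => FM (x - z))) dg.
  rewrite -(Rintegral_reflect x (dominated_integrable d1)) /Rintegral.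
  have Z : (\int[mu n]_y (gamma r (x - y) * flap s f (x - (x - y)))%:E = \int[mu n]_y (cst 0%E y))%E.
    apply: ae_eq_integral => //.
      by apply/measurable_EFinP; exact: (measurableT_comp d1.1 mB).
    apply: filterS ae0 => y /= hy _; congr EFin.
    have -> : x - (x - y) = y by rewrite opprB addrCA subrr addr0.
    have /eqP := EFin_inj (hy I); rewrite powR_eq0 normr_eq0 => /andP[/eqP -> _].
    by rewrite mulr0.
  by rewrite Z integral0.
apply/funext => x; apply: (mulfI (lt0r_neq0 c0)); rewrite mulr0 (hC x).2.1.
rewrite (_ : \int[leb]_r _ = \int[leb]_r 0); first by rewrite /Rintegral integral0.
apply: eq_Rintegral => r _; have [r0|r0] := ltP 0 r; first by rewrite hz// mulr0.
by rewrite /wpow ltNge r0 mul0r.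
Qed.

End assembly.

Lemma poweRV_EFin {R : realType} (J : \bar R) (p a : R) : 0 < p -> (0 <= J)%E ->
  (J `^ p^-1 = a%:E)%E -> J = (a `^ p)%:E.
Proof.
move=> p0; have pn : p^-1 != 0 by rewrite invr_eq0 gt_eqF.
case: J => [j| |]//; last by rewrite poweRyr.
rewrite lee_fin => j0; rewrite poweR_EFin => -[<-].
by rewrite -powRrM mulVf ?gt_eqF// powRr1.
Qed.

(** If no factor is 0, one infinite factor makes the right side infinite, so only finite positive
    factors need an argument. Zeros are excluded because 0 times infinity is 0. *)
Lemma le_mule_poweRV {R : realType} (C I p q : R) (B J1 J2 : \bar R) :
  0 < C -> 0 < p -> 0 < q -> (0 <= B)%E -> (0 <= J1)%E -> (0 <= J2)%E ->
  B != 0%E -> J1 != 0%E -> J2 != 0%E ->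
  (forall b N1 N2 : R, 0 < b -> 0 < N1 -> 0 < N2 ->
    B = b%:E -> J1 = (N1 `^ p)%:E -> J2 = (N2 `^ q)%:E -> I <= C * b * N1 * N2) ->
  (I%:E <= C%:E * B * J1 `^ p^-1 * J2 `^ q^-1)%E.
Proof.
move=> C0 p0 q0 B0 J10 J20 Bnz J1nz J2nz H.
have bp : (0 < B)%E by rewrite lt_def Bnz.
have Fp : (0 < J1 `^ p^-1)%E by rewrite poweR_gt0// lt_def J1nz.
have Gp : (0 < J2 `^ q^-1)%E by rewrite poweR_gt0// lt_def J2nz.
have CE : (0 < C%:E)%E by rewrite lte_fin.
case Eb : B bp => [b| |] bp //; last by rewrite gt0_muley// gt0_mulye// gt0_mulye// leey.
case EF : (J1 `^ p^-1)%E Fp => [N1| |] Fp //; last first.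
  by rewrite gt0_muley ?mule_gt0// gt0_mulye// leey.
case EG : (J2 `^ q^-1)%E Gp => [N2| |] Gp //; last first.
  by rewrite gt0_muley ?mule_gt0// leey.
move: bp Fp Gp; rewrite !lte_fin => bp N10 N20.
rewrite -!EFinM lee_fin.
exact: H bp N10 N20 Eb (poweRV_EFin p0 J10 EF) (poweRV_EFin q0 J20 EG).
Qed.

Theorem theorem3p7 (R : realType) (n : nat) (s p q q' : R) :
  0 < s -> s < 1 -> 1 < p -> p < n%:R / s ->
  q^-1 = p^-1 - s / n%:R -> q'^-1 + q^-1 = 1 ->
  exists C : R, 0 < C /\
    forall phi f g : 'rV[R]_n -> R,
      Cc_infty phi -> Cc_infty f -> Cc_infty g ->
      ((cabs (cint (fun x => commut s phi f x * (g x)%:C)))%:E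
        <= C%:E * bmo phi * Lpnorm p (fraclap s f) * Lpnorm q' (fraclap s g))%E.
Proof.
move=> s0 s1 p1 pns qE q'E.
have p0 : 0 < p by exact: lt_trans p1.
(* In dimension 0 the quotient n/s is 0 and cannot exceed p. *)
have n0 : (0 < n)%N.
  by case: n pns {qE} => [|//]; rewrite mul0r => /(lt_trans p0); rewrite ltxx.
have nR : 0 < n%:R :> R by rewrite ltr0n.
have q'V : q'^-1 = 1 - p^-1 + s / n%:R by move: q'E; rewrite qE => E; lra.
have pp : p^-1 + q'^-1 = 1 + s / n%:R by rewrite q'V; ring.
have sp : s / n%:R < p^-1.
  by rewrite -[p^-1]mul1r ltr_pdivlMr// mulrAC ltr_pdivrMr// mul1r mulrC -ltr_pdivlMr.
have pV1 : p^-1 < 1 by rewrite invf_lt1.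
have sn0 : 0 < s / n%:R by rewrite divr_gt0.
have q'V0 : 0 < q'^-1 by rewrite q'V; lra.
have q'0 : 0 < q' by rewrite -invr_gt0.
have q'1 : 1 < q' by rewrite -invf_lt1// q'V; lra.
have [c c0 hc] := @mellin_symb R n s s0 s1.
have [C0 C00 hC0] := @gamma_kernel R n s s0 s1 n0.
have [CF CF0 hCF] := form_bound_scaled n0 s0 p1 q'1 pp.
(* The final constant collects [c] from subordination, [C0] from the passage to cubes, [CF] from the
   form, and [K] from replacing balls by cubes in the seminorm. *)
pose K : R := 2 * n.+1%:R ^+ n.
have K0 : 0 < K by rewrite mulr_gt0// exprn_gt0.
have Cpos : 0 < C0 * CF * K / c by rewrite divr_gt0// !mulr_gt0.
exists (C0 * CF * K / c); split => // phi f g Cphi Cf Cg.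
pose I := `|\int[mu n]_x (phi x * f x * flap s g x - phi x * g x * flap s f x)|.
pose JF := (\int[mu n]_x (`|flap s f x| `^ p)%:E)%E.
pose JG := (\int[mu n]_x (`|flap s g x| `^ q')%:E)%E.
have IE : cabs (cint (fun x => commut s phi f x * (g x)%:C)) = I := commutator_integralE s0 s1 Cphi Cf Cg.
have LF : (Lpnorm p (fraclap s f) = JF `^ p^-1)%E := Lpnorm_fraclapE s0 s1 p Cf.
have LG : (Lpnorm q' (fraclap s g) = JG `^ q'^-1)%E := Lpnorm_fraclapE s0 s1 q' Cg.
rewrite IE LF LG.
have mF := measurable_flap s0 s1 Cf; have mG := measurable_flap s0 s1 Cg.
have [MF MF0 FM] := flap_bounded s0 s1 Cf.
have [MG MG0 GM] := flap_bounded s0 s1 Cg.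
have bphi := Cc_infty_bm Cphi; have dphi := Cc_infty_dominated Cphi.
have JF0 : (0 <= JF)%E by apply: integral_ge0 => x _; rewrite lee_fin powR_ge0.
have JG0 : (0 <= JG)%E by apply: integral_ge0 => x _; rewrite lee_fin powR_ge0.
have b0 := bmo_ge0 bphi.
have rhs0 : (0 <= (C0 * CF * K / c)%:E * bmo phi * JF `^ p^-1 * JG `^ q'^-1)%E.
  by rewrite !mule_ge0 ?poweR_ge0 ?lee_fin ?(ltW Cpos).
(* In each degenerate case the left side is shown to be 0 and the nonnegativity [rhs0] concludes.
   Here it is at most a multiple of the integral of |phi|. *)
have [bz|bnz] := eqVneq (bmo phi) 0%E.
  suff -> : I = 0 by [].
  have hz : \int[mu n]_x `|phi x| = 0 by apply: bmo_eq0_integral => //; rewrite bz.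
  have [Mf _ fM] := Cc_infty_bounded Cf; have [Mg _ gM] := Cc_infty_bounded Cg.
  have df := Cc_infty_dominated Cf; have dg := Cc_infty_dominated Cg.
  have d1 : dominated (fun x => phi x * f x * flap s g x).
    exact: dominatedM mG (ex_intro _ MG GM) (dominatedM df.1 (ex_intro _ Mf fM) dphi).
  have d2 : dominated (fun x => phi x * g x * flap s f x).
    exact: dominatedM mF (ex_intro _ MF FM) (dominatedM dg.1 (ex_intro _ Mg gM) dphi).
  have d12 := dominated_integrable (dominatedB d1 d2).
  have dabs : dominated (fun x => `|phi x|).
    apply: (dominated_le (C := 1) _ dphi); first exact: (measurableT_comp (@normr_measurable R setT) dphi.1).
    by move=> x; rewrite normr_id mul1r.
  apply/eqP; rewrite eq_le normr_ge0 andbT.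
  apply: (le_trans (le_normr_Rintegral measurableT d12)).
  have <- : \int[mu n]_x ((Mf * MG + Mg * MF) * `|phi x|) = 0.
    by rewrite (RintegralZl _ measurableT (dominated_integrable dabs)) hz mulr0.
  apply: (le_Rintegral measurableT (integrable_abse d12) (dominated_integrable (dominatedZ _ dabs))) => x _.
  rewrite mulrDl; apply: (le_trans (ler_normB _ _)); apply: lerD.
    by rewrite !normrM -mulrA mulrC; apply: ler_wpM2r => //; apply: ler_pM.
  by rewrite !normrM -mulrA mulrC; apply: ler_wpM2r => //; apply: ler_pM.
have [Fz|Fnz] := eqVneq JF 0%E.
  suff -> : I = 0 by [].
  have fz := flap_null s0 s1 n0 Cf p0 Fz.
  rewrite /I /Rintegral integral0_eq ?normr0// => x _.
  by rewrite fz flap_zero !mulr0 mul0r subrr.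
have [Gz|Gnz] := eqVneq JG 0%E.
  suff -> : I = 0 by [].
  have gz := flap_null s0 s1 n0 Cg q'0 Gz.
  rewrite /I /Rintegral integral0_eq ?normr0// => x _.
  by rewrite gz flap_zero !mulr0 mul0r subrr.
apply: (le_mule_poweRV Cpos p0 q'0 b0 JF0 JG0 bnz Fnz Gnz) => b N1 N2 bp N10 N20 Eb JFE JGE.
have be0 : 0 < K * b by rewrite mulr_gt0.
have [dl dl0 hosc] := Cc_infty_osc Cphi be0.
have hb : (bmo phi <= b%:E)%E by rewrite Eb.
have hcube := bmo_cube_le bphi hb.
have bF : bm (flap s f) := conj mF (ex_intro _ MF FM).
have bG : bm (flap s g) := conj mG (ex_intro _ MG GM).
have hF : (JF <= (N1 `^ p)%:E)%E := eq_ind_r (fun J => (J <= (N1 `^ p)%:E)%E) (lexx _) JFE.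
have hG : (JG <= (N2 `^ q')%:E)%E := eq_ind_r (fun J => (J <= (N2 `^ q')%:E)%E) (lexx _) JGE.
have H := hCF phi _ _ _ dl N1 N2 bphi be0 dl0 N10 N20 hcube hosc bF bG hF hG.
have H1 := commutator_kernel s0 s1 n0 c0 hc Cphi Cf Cg.
have H2 := kernel_form_le C00 hC0 bphi.1 mF mG.
have C0E : (0 <= C0%:E)%E by rewrite lee_fin ltW.
have := le_trans H1 (le_trans H2 (lee_wpmul2l C0E H)).
rewrite -EFinM lee_fin -ler_pdivlMl// => HI.
have rg (a e k d : R) : c^-1 * (a * (e * (k * b) * N1 * N2)) = a * e * k / c * b * N1 * N2 by ring.
by rewrite -rg.
Qed.
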